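(* Let $\Gamma$ be an undirected graph with vertex set $V$ and let $\mathbf{k}$ be a nonzero commutative ring. There is a faithful representation (injective group homomorphism) $$\mu\colon A_\Gamma\to\overline{R_\Gamma}^\times;\quad v\mapsto 1+v\quad\text{for } v\in V.$$ The corresponding generalized dimension subgroups satisfy $$\delta_{n,\mu}=\begin{cases}\gamma_{n,0}&\text{if }\mathbf{k}\text{ has characteristic }0,\\ \gamma_{n,p}&\text{if }\mathbf{k}\text{ has prime characteristic }p.\end{cases}$$ Furthermore there is an isomorphism of filtered associative $\mathbf{k}$-algebras $$\overline{\mathbf{k}A_\Gamma}:=\varprojlim_n\big(\mathbf{k}A_\Gamma/\varpi(A_\Gamma)^n\big)\xrightarrow{\ \cong\ }\varprojlim_n\big(R_\Gamma/\varpi^n\big)=\overline{R_\Gamma}.$$ In particular, the classical dimension subgroups coincide with these: $\delta_{n,\mathbf{k}A_\Gamma}=\delta_{n,\mu}$ for all $n$.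
   Context: $\Gamma$ has edge set $E$, consisting of $2$-element subsets of $V$, and $A_\Gamma=\langle V\mid vw=wv\text{ whenever }\{v,w\}\in E\rangle$. $R_\Gamma$ is the unital associative $\mathbf{k}$-algebra with generating set $V$ and relations $vw=wv$ whenever $\{v,w\}\in E$, graded by $\deg(v)=1$ for $v\in V$; $\varpi=\langle V\rangle$ is its augmentation ideal (elements with zero constant term), so $\varpi^n$ consists of the polynomials with no terms of degree $<n$. $\overline{R_\Gamma}=\varprojlim R_\Gamma/\varpi^n$ is the algebra of power series in partially commuting variables; its augmentation ideal $\overline\varpi$ consists of power series with zero constant term, and $\overline\varpi^n$ consists of the power series with no terms of degree $<n$. $\overline{R_\Gamma}^\times$ is the group of units. $\varpi(A_\Gamma)$ is the augmentation ideal of the group ring $\mathbf{k}A_\Gamma$. The completions are filtered by the closures of the powers of the augmentation ideals. Given a representation $\rho\colon G\to R^\times$ of a group in an augmented associative $\mathbf{k}$-algebra $R$ with augmentation ideal $\varpi_R$, the generalized dimension subgroups are $\delta_{n,\rho}=\rho^{-1}(1+\varpi_R^n)=\ker(G\to(R/\varpi_R^n)^\times)$, $n\ge1$; when $R=\mathbf{k}G$ and $\rho$ is the regular representation $g\mapsto g$, write $\delta_{n,\mathbf{k}G}$. Subgroup series of $G=A_\Gamma$: $\gamma_1=G$, $\gamma_n=[\gamma_{n-1},G]$; $\gamma_{n,0}=\{g\in G\mid g^k\in\gamma_n\text{ for some integer }k\ne0\}$; $\gamma_{1,p}=G$, $\gamma_{n,p}=[\gamma_{n-1,p},G]\,\gamma_{\lceil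 n/p\rceil,p}^p$ (equivalently $\gamma_{n,p}=\prod_{mp^i\ge n}\gamma_m^{p^i}$), where $H^q$ is the subgroup generated by $q$-th powers of elements of $H$. *)

(* Defs.v *)
From HB Require Import structures.
From mathcomp Require Import all_boot all_order all_algebra.
From mathcomp Require Import finmap monalg.
From mathcomp Require Import boolp classical_sets.
From mathcomp Require Import zify.

Set Implicit Arguments.
Unset Strict Implicit.
Unset Printing Implicit Defensive.

Import GRing.Theory.

Local Open Scope classical_set_scope.
Local Open Scope quotient_scope.
Local Open Scope ring_scope.

Definition ideal_axiom (A : pzRingType) (I : set A) : Prop :=
  [/\ I 0, forall x y, I x -> I y -> I (x - y),
      forall a x, I x -> I (a * x) & forall a x, I x -> I (x * a)].

Record ideal (A : pzRingType) :=
  Ideal { ideal_set :> set A; idealP : ideal_axiom ideal_set }.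

Identity Coercion set_fun : set >-> Funclass.

Section IdealTheory.
Variable A : pzRingType.
Implicit Types (I : ideal A) (S : set A).

Lemma ideal_smallest S : ideal_axiom (smallest (@ideal_axiom A) S).
Proof.
split.
- by move=> I [[]].
- by move=> x y Ix Iy I [hI SI]; have [_ + _ _] := hI; apply; [apply: Ix|apply: Iy].
- by move=> a x Ix I [hI SI]; have [_ _ + _] := hI; apply; apply: Ix.
- by move=> a x Ix I [hI SI]; have [_ _ _] := hI; apply; apply: Ix.
Qed.

Definition ideal_gen S : ideal A := Ideal (ideal_smallest S).

Lemma ideal_full_subproof : ideal_axiom [set: A].
Proof. by []. Qed.

Definition ideal_full : ideal A := Ideal ideal_full_subproof.

Fixpoint ideal_pow I n : ideal A :=
  if n is m.+1 then ideal_gen [set x * y | x in ideal_pow I m & y in I]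
  else ideal_full.

Lemma ideal0 I : I 0. Proof. by case: I => I []. Qed.
Lemma idealB I x y : I x -> I y -> I (x - y).
Proof. by case: I => I [*] /=; auto. Qed.
Lemma idealMl I a x : I x -> I (a * x).
Proof. by case: I => I [*] /=; auto. Qed.
Lemma idealMr I a x : I x -> I (x * a).
Proof. by case: I => I [*] /=; auto. Qed.
Lemma idealN I x : I x -> I (- x).
Proof. by move=> Ix; rewrite -sub0r; apply: idealB => //; apply: ideal0. Qed.
Lemma idealD I x y : I x -> I y -> I (x + y).
Proof. by move=> Ix Iy; rewrite -[y]opprK; apply: idealB => //; apply: idealN. Qed.

Lemma ideal_gen_sub S I : S `<=` I -> ideal_gen S `<=` I.
Proof. by move=> SI; apply: smallest_sub => //; apply: idealP. Qed.

Lemma ideal_pow_sub I n : ideal_pow I n.+1 `<=` ideal_pow I n.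
Proof. by apply: ideal_gen_sub => _ [x Ix [y Iy <-]]; apply: idealMr. Qed.

Lemma ideal_pow_leq I m n : (m <= n)%N -> ideal_pow I n `<=` ideal_pow I m.
Proof.
elim: n => [|n IH]; first by rewrite leqn0 => /eqP ->.
rewrite leq_eqVlt => /orP [/eqP -> //|/IH h].
by apply: subset_trans h; apply: ideal_pow_sub.
Qed.

Lemma ideal_pow1_sub I : ideal_pow I 1 `<=` I.
Proof. by apply: ideal_gen_sub => _ [x _ [y Iy <-]]; apply: idealMl. Qed.

Definition ideal_pred I : {pred A} := [pred x | `[<I x>]].

Lemma ideal_predP I : zmod_closed (ideal_pred I).
Proof.
split; first exact/asboolP/ideal0.
by move=> x y /asboolP Ix /asboolP Iy; apply/asboolP/idealB.
Qed.
HB.instance Definition _ I :=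
  GRing.isZmodClosed.Build A (ideal_pred I) (ideal_predP I).

End IdealTheory.

Arguments ideal_pow : simpl never.

(* MathComp's ring structure on [{ideal_quot _}] is limited to proper ideals of
   commutative rings; here the ideal is two-sided and possibly the whole ring, so
   the quotient may be the zero ring. *)
Definition quotient_alg (A : pzRingType) (I : ideal A) : Type :=
  {ideal_quot (ideal_pred I)}.

Section QuotientRing.
Variables (A : pzRingType) (I : ideal A).
Local Notation Q := (quotient_alg I).

HB.instance Definition _ := GRing.Zmodule.on Q.

Definition qpi (x : A) : Q := (\pi_{ideal_quot (ideal_pred I)} x)%qT.
Definition qrepr (x : Q) : A := repr (x : {ideal_quot (ideal_pred I)}).

Lemma qreprK x : qpi (qrepr x) = x.
Proof. exact: reprK. Qed.

Lemma qpiP x y : qpi x = qpi y <-> I (x - y).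
Proof.
rewrite /qpi; split=> [/eqP|] h.
  by apply/asboolP; rewrite -Quotient.idealrBE in h.
by apply/eqP; rewrite -Quotient.idealrBE; apply/asboolP.
Qed.

Lemma qrepr_pi x : I (qrepr (qpi x) - x).
Proof. by apply/qpiP; rewrite qreprK. Qed.

Lemma qpi_is_zmod : zmod_morphism qpi.
Proof. by move=> x y; rewrite /qpi !piE. Qed.
HB.instance Definition _ := GRing.isZmodMorphism.Build A Q qpi qpi_is_zmod.

Definition qone : Q := qpi 1.
Definition qmul (x y : Q) : Q := qpi (qrepr x * qrepr y).

Lemma qmul_pi x y : qmul (qpi x) (qpi y) = qpi (x * y).
Proof.
apply/qpiP.
have -> : qrepr (qpi x) * qrepr (qpi y) - x * y =
    (qrepr (qpi x) - x) * qrepr (qpi y) + x * (qrepr (qpi y) - y).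
  by rewrite mulrBl mulrBr addrA subrK.
by apply: idealD; [apply: idealMr|apply: idealMl]; apply: qrepr_pi.
Qed.

Lemma qmulA : associative qmul.
Proof.
move=> x y z; rewrite -[x]qreprK -[y]qreprK -[z]qreprK.
by rewrite !qmul_pi mulrA.
Qed.
Lemma qmul1 : left_id qone qmul.
Proof. by move=> x; rewrite -[x]qreprK qmul_pi mul1r. Qed.
Lemma qmulr1 : right_id qone qmul.
Proof. by move=> x; rewrite -[x]qreprK qmul_pi mulr1. Qed.
Lemma qmulDl : left_distributive qmul +%R.
Proof.
move=> x y z; rewrite -[x]qreprK -[y]qreprK -[z]qreprK.
by rewrite -raddfD !qmul_pi mulrDl raddfD.
Qed.
Lemma qmulDr : right_distributive qmul +%R.
Proof.
move=> x y z; rewrite -[x]qreprK -[y]qreprK -[z]qreprK.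
by rewrite -raddfD !qmul_pi mulrDr raddfD.
Qed.
HB.instance Definition _ :=
  GRing.Zmodule_isPzRing.Build Q qmulA qmul1 qmulr1 qmulDl qmulDr.

Lemma qpi_is_monoid : monoid_morphism qpi.
Proof. by split=> // x y; rewrite -qmul_pi. Qed.
HB.instance Definition _ := GRing.isMonoidMorphism.Build A Q qpi qpi_is_monoid.

End QuotientRing.

Section QuotientModule.
Variables (k : comNzRingType) (A : algType k) (I : ideal A).
Local Notation Q := (quotient_alg I).

Definition qscale (c : k) (x : Q) : Q := qpi I (c *: qrepr x).

Lemma idealZ c x : I x -> I (c *: x).
Proof. by move=> Ix; rewrite -[x]mul1r scalerAl; apply: idealMl. Qed.

Lemma qscale_pi c x : qscale c (qpi I x) = qpi I (c *: x).
Proof. by apply/qpiP; rewrite -scalerBr; apply/idealZ/qrepr_pi. Qed.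

Lemma qscaleA a b x : qscale a (qscale b x) = qscale (a * b) x.
Proof. by rewrite -[x]qreprK !qscale_pi scalerA. Qed.
Lemma qscale1 : left_id 1 qscale.
Proof. by move=> x; rewrite -[x]qreprK qscale_pi scale1r. Qed.
Lemma qscaleDr : right_distributive qscale +%R.
Proof.
move=> c x y; rewrite -[x]qreprK -[y]qreprK.
by rewrite -raddfD !qscale_pi scalerDr raddfD.
Qed.
Lemma qscaleDl x : {morph qscale^~ x : a b / a + b}.
Proof.
by move=> a b; rewrite -[x]qreprK !qscale_pi scalerDl raddfD.
Qed.
HB.instance Definition _ :=
  GRing.Zmodule_isLmodule.Build k Q qscaleA qscale1 qscaleDr qscaleDl.

Lemma qpi_is_scalable : scalable (qpi I).
Proof. by move=> c x; rewrite -qscale_pi. Qed.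
HB.instance Definition _ :=
  GRing.isScalable.Build k A Q *:%R (qpi I) qpi_is_scalable.

Lemma qscalerAl (c : k) (x y : Q) : c *: (x * y) = (c *: x) * y.
Proof.
rewrite -[x]qreprK -[y]qreprK -[c *: qpi I (qrepr x)]linearZ -!rmorphM.
by rewrite -linearZ scalerAl.
Qed.
Lemma qscalerAr (c : k) (x y : Q) : c *: (x * y) = x * (c *: y).
Proof.
rewrite -[x]qreprK -[y]qreprK -[c *: qpi I (qrepr y)]linearZ -!rmorphM.
by rewrite -linearZ scalerAr.
Qed.

End QuotientModule.

HB.mixin Record isAugmented (k : comNzRingType) A of GRing.Algebra k A := {
  aug : A -> k;
  aug_is_scalar : scalar aug;
  aug_is_monoid_morphism : monoid_morphism aug
}.

#[short(type="augAlgType")]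
HB.structure Definition AugAlgebra (k : comNzRingType) :=
  {A of isAugmented k A & GRing.Algebra k A}.

Section AugmentationIdeal.
Variables (k : comNzRingType) (A : augAlgType k).

HB.instance Definition _ :=
  GRing.isLinear.Build k A k *%R (@aug k A) (@aug_is_scalar k A).
HB.instance Definition _ :=
  GRing.isMonoidMorphism.Build A k (@aug k A) (@aug_is_monoid_morphism k A).

Lemma aug_ideal_subproof : ideal_axiom [set x : A | aug x = 0].
Proof.
split=> /= [|x y x0 y0|a x x0|a x x0]; first exact: raddf0.
- by rewrite raddfB /= x0 y0 subrr.
- by rewrite rmorphM /= x0 mulr0.
- by rewrite rmorphM /= x0 mul0r.
Qed.

Definition aug_ideal : ideal A := Ideal aug_ideal_subproof.

End AugmentationIdeal.

Section Completion.
Variables (k : comNzRingType) (A : augAlgType k).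
Local Notation "'Q' n" := (quotient_alg (ideal_pow (aug_ideal A) n))
  (at level 10, n at level 9).

Definition transition m n (x : Q n) : Q m := qpi _ (qrepr x).

(* The inverse limit of the A / I^n, I the augmentation ideal, as the compatible
   families in the product. The factor n = 0 is the zero ring. *)
Record completion := Completion {
  component :> forall n, Q n;
  componentP : forall m n, (m <= n)%N -> transition m (component n) = component m
}.

HB.instance Definition _ := gen_eqMixin completion.
HB.instance Definition _ := gen_choiceMixin completion.

Lemma completionP (x y : completion) : (forall n, x n = y n) -> x = y.
Proof.
case: x y => [x xP] [y yP] /= xy.
have E : x = y by apply: functional_extensionality_dep.
by subst y; congr Completion; apply: Prop_irrelevance.
Qed.

Lemma transition_pi m n a : (m <= n)%N ->
  transition m (qpi _ a : Q n) = qpi _ a.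
Proof.
by move=> mn; apply/qpiP/(ideal_pow_leq mn)/qrepr_pi.
Qed.

Lemma completion_repr (x : completion) m n : (m <= n)%N ->
  qpi _ (qrepr (x n)) = x m.
Proof. exact: componentP. Qed.

Definition compl_of (a : A) : completion :=
  Completion (fun m n mn => transition_pi a mn).

Fact compl_opp_subproof (x : completion) m n : (m <= n)%N ->
  transition m (- x n) = - x m.
Proof.
move=> mn; rewrite -[x n]qreprK -raddfN transition_pi // raddfN /=.
by rewrite (completion_repr x mn).
Qed.
Definition compl_opp x := Completion (@compl_opp_subproof x).

Fact compl_add_subproof (x y : completion) m n : (m <= n)%N ->
  transition m (x n + y n) = x m + y m.
Proof.
move=> mn; rewrite -[x n]qreprK -[y n]qreprK -raddfD transition_pi // raddfD /=.
by rewrite !(completion_repr _ mn).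
Qed.
Definition compl_add x y := Completion (@compl_add_subproof x y).

Fact compl_mul_subproof (x y : completion) m n : (m <= n)%N ->
  transition m (x n * y n) = x m * y m.
Proof.
move=> mn; rewrite -[x n]qreprK -[y n]qreprK -rmorphM transition_pi // rmorphM /=.
by rewrite !(completion_repr _ mn).
Qed.
Definition compl_mul x y := Completion (@compl_mul_subproof x y).

Fact compl_scale_subproof (c : k) (x : completion) m n : (m <= n)%N ->
  transition m (c *: x n) = c *: x m.
Proof.
move=> mn; rewrite -[x n]qreprK -linearZ transition_pi // linearZ /=.
by rewrite (completion_repr x mn).
Qed.
Definition compl_scale c x := Completion (@compl_scale_subproof c x).

Definition compl_zero := compl_of 0.
Definition compl_one := compl_of 1.

Fact compl_addA : associative compl_add.
Proof. by move=> x y z; apply: completionP => n /=; rewrite addrA. Qed.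
Fact compl_addC : commutative compl_add.
Proof. by move=> x y; apply: completionP => n /=; rewrite addrC. Qed.
Fact compl_add0 : left_id compl_zero compl_add.
Proof. by move=> x; apply: completionP => n /=; rewrite raddf0 add0r. Qed.
Fact compl_addN : left_inverse compl_zero compl_opp compl_add.
Proof. by move=> x; apply: completionP => n /=; rewrite raddf0 addNr. Qed.
HB.instance Definition _ := GRing.isZmodule.Build completion
  compl_addA compl_addC compl_add0 compl_addN.

Fact compl_mulA : associative compl_mul.
Proof. by move=> x y z; apply: completionP => n /=; rewrite mulrA. Qed.
Fact compl_mul1 : left_id compl_one compl_mul.
Proof. by move=> x; apply: completionP => n /=; rewrite rmorph1 mul1r. Qed.
Fact compl_mulr1 : right_id compl_one compl_mul.
Proof. by move=> x; apply: completionP => n /=; rewrite rmorph1 mulr1. Qed.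
Fact compl_mulDl : left_distributive compl_mul +%R.
Proof. by move=> x y z; apply: completionP => n /=; rewrite mulrDl. Qed.
Fact compl_mulDr : right_distributive compl_mul +%R.
Proof. by move=> x y z; apply: completionP => n /=; rewrite mulrDr. Qed.

Lemma aug_qrepr_pi n (a : A) : (0 < n)%N ->
  aug (qrepr (qpi (ideal_pow (aug_ideal A) n) a)) = aug a.
Proof.
move=> n0; have := ideal_pow1_sub (@ideal_pow_leq _ (aug_ideal A) _ _ n0 _ (qrepr_pi _ a)).
by rewrite /= /mkset raddfB => /eqP; rewrite subr_eq0 => /eqP.
Qed.

Fact compl_one_neq0 : compl_one != compl_zero.
Proof.
apply/eqP => /(congr1 (fun x : completion => aug (qrepr (x 1%N)))) /=.
by rewrite /compl_one /compl_zero /= !aug_qrepr_pi // rmorph1 raddf0 => /eqP; rewrite oner_eq0.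
Qed.
HB.instance Definition _ := GRing.Zmodule_isNzRing.Build completion
  compl_mulA compl_mul1 compl_mulr1 compl_mulDl compl_mulDr compl_one_neq0.

Fact compl_scaleA a b x : compl_scale a (compl_scale b x) = compl_scale (a * b) x.
Proof. by apply: completionP => n /=; rewrite scalerA. Qed.
Fact compl_scale1 : left_id 1 compl_scale.
Proof. by move=> x; apply: completionP => n /=; rewrite scale1r. Qed.
Fact compl_scaleDr : right_distributive compl_scale +%R.
Proof. by move=> c x y; apply: completionP => n /=; rewrite scalerDr. Qed.
Fact compl_scaleDl x : {morph compl_scale^~ x : a b / a + b}.
Proof. by move=> a b; apply: completionP => n /=; rewrite scalerDl. Qed.
HB.instance Definition _ := GRing.Zmodule_isLmodule.Build k completion
  compl_scaleA compl_scale1 compl_scaleDr compl_scaleDl.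

Fact compl_scalerAl (c : k) (x y : completion) : c *: (x * y) = (c *: x) * y.
Proof. by apply: completionP => n; apply: qscalerAl. Qed.
HB.instance Definition _ :=
  GRing.Lmodule_isLalgebra.Build k completion compl_scalerAl.
Fact compl_scalerAr (c : k) (x y : completion) : c *: (x * y) = x * (c *: y).
Proof. by apply: completionP => n; apply: qscalerAr. Qed.
HB.instance Definition _ :=
  GRing.Lalgebra_isAlgebra.Build k completion compl_scalerAr.

Definition compl_aug (x : completion) : k := aug (qrepr (x 1%N)).

Fact compl_aug_scalar : scalar compl_aug.
Proof.
move=> c x y; rewrite /compl_aug /= -[x 1%N]qreprK -[y 1%N]qreprK.
by rewrite -linearP !aug_qrepr_pi // linearP.
Qed.
Fact compl_aug_monoid_morphism : monoid_morphism compl_aug.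
Proof.
split=> [|x y]; rewrite /compl_aug /=; first by rewrite aug_qrepr_pi ?rmorph1.
rewrite -[x 1%N]qreprK -[y 1%N]qreprK -rmorphM !aug_qrepr_pi //.
by rewrite rmorphM.
Qed.
HB.instance Definition _ := isAugmented.Build k completion
  compl_aug_scalar compl_aug_monoid_morphism.

(* Closure for the inverse limit topology, the factors A / I^m being discrete. *)
Definition compl_closure (S : set completion) : set completion :=
  [set x | forall m, exists2 s, S s & s m = x m].

Definition compl_filtration n : set completion :=
  compl_closure (ideal_pow (aug_ideal completion) n).

Lemma compl_aug1 (x : completion) : aug x = 0 -> x 1%N = 0.
Proof.
move=> x0; rewrite -[x 1%N]qreprK -[0](raddf0 (qpi _)); apply/qpiP.
rewrite subr0; apply: sub_gen_smallest; exists 1 => //.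
by exists (qrepr (x 1%N)); rewrite ?mul1r.
Qed.

Lemma ideal_pow_compl n (x : completion) :
  ideal_pow (aug_ideal completion) n x -> x n = 0.
Proof.
have zeroP m (y : completion) : y m = 0 <-> ideal_pow (aug_ideal A) m (qrepr (y m)).
  rewrite -{1}[y m]qreprK -[0](raddf0 (qpi _)).
  by split=> [/qpiP|h]; [|apply/qpiP]; rewrite subr0.
have reprI m l (y : completion) : (m <= l)%N -> y m = 0 ->
    ideal_pow (aug_ideal A) m (qrepr (y l)).
  move=> ml; rewrite -(completion_repr y ml) -[0](raddf0 (qpi _)) => /qpiP.
  by rewrite subr0.
elim: n x => [|n IH] x; first by move=> _; apply/zeroP.
have hK : ideal_axiom [set z : completion | z n.+1 = 0].
  split=> /= [|y z y0 z0|a z z0|a z z0]; first exact: raddf0.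
  - by rewrite y0 z0 subr0.
  - by rewrite z0 mulr0.
  - by rewrite z0 mul0r.
apply: (ideal_gen_sub (I := Ideal hK)) => _ [y yI [z z0 <-]] /=.
rewrite -[y n.+1]qreprK -[z n.+1]qreprK -rmorphM -[0](raddf0 (qpi _)).
apply/qpiP; rewrite subr0; apply: sub_gen_smallest.
exists (qrepr (y n.+1)); first exact/reprI/IH.
exists (qrepr (z n.+1)) => //.
apply: (@ideal_pow1_sub _ (aug_ideal A)); apply: (reprI 1%N) => //.
exact: compl_aug1.
Qed.

Lemma compl_of_ideal_pow n a :
  ideal_pow (aug_ideal A) n a -> ideal_pow (aug_ideal completion) n (compl_of a).
Proof.
elim: n a => [//|n IH] a.
have hK : ideal_axiom
    [set b : A | ideal_pow (aug_ideal completion) n.+1 (compl_of b)].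
  have add b c : compl_of (b - c) = compl_of b - compl_of c.
    by apply: completionP => m; apply: raddfB.
  have mul b c : compl_of (b * c) = compl_of b * compl_of c.
    by apply: completionP => m; apply: rmorphM.
  split=> /= [|b c hb hc|b c hc|b c hc]; rewrite /mkset.
  - exact: (ideal0 (ideal_pow (aug_ideal completion) n.+1)).
  - rewrite add; exact: (idealB (I := ideal_pow (aug_ideal completion) n.+1)).
  - rewrite mul; exact: (idealMl (I := ideal_pow (aug_ideal completion) n.+1)).
  - rewrite mul; exact: (idealMr (I := ideal_pow (aug_ideal completion) n.+1)).
apply: (ideal_gen_sub (I := Ideal hK)) => _ [b bI [c c0 <-]] /=.
apply: sub_gen_smallest; exists (compl_of b); first exact: IH.
exists (compl_of c); last by apply: completionP => m; rewrite /= rmorphM.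
by rewrite /= /mkset /aug /= /compl_aug /= aug_qrepr_pi.
Qed.

Lemma compl_filtrationE n (x : completion) : compl_filtration n x <-> x n = 0.
Proof.
split=> [/(_ n) [s /ideal_pow_compl sn <- //]|xn m].
exists (compl_of (qrepr (x (maxn m n)))).
  apply: compl_of_ideal_pow.
  move: xn; rewrite -(completion_repr x (leq_maxr m n)) -[0](raddf0 (qpi _)).
  by move=> /qpiP; rewrite subr0.
by rewrite /= (completion_repr x (leq_maxl m n)).
Qed.

End Completion.

Section Units.
Variable R : nzRingType.

Record units := Units {
  uval :> R;
  uinv : R;
  uvalV : uval * uinv = 1;
  uVval : uinv * uval = 1
}.

HB.instance Definition _ := gen_eqMixin units.
HB.instance Definition _ := gen_choiceMixin units.

Lemma uval_inj : injective uval.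
Proof.
case=> [x x' xx' x'x] [y y' yy' y'y] /= E; subst y.
have E : x' = y' by rewrite -[y']mul1r -x'x -mulrA yy' mulr1.
by subst y'; congr Units; apply: Prop_irrelevance.
Qed.

Definition units_one := @Units 1 1 (mulr1 1) (mulr1 1).
Definition units_inv x := Units (uVval x) (uvalV x).

Fact units_mulV x y : uval x * uval y * (uinv y * uinv x) = 1.
Proof. by rewrite mulrA -[_ * uinv y]mulrA uvalV mulr1 uvalV. Qed.
Fact units_Vmul x y : uinv y * uinv x * (uval x * uval y) = 1.
Proof. by rewrite mulrA -[_ * uval x]mulrA uVval mulr1 uVval. Qed.
Definition units_mul x y := Units (units_mulV x y) (units_Vmul x y).

Fact units_mulA : associative units_mul.
Proof. by move=> x y z; apply: uval_inj; rewrite /= mulrA. Qed.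
Fact units_mul1 : left_id units_one units_mul.
Proof. by move=> x; apply: uval_inj; rewrite /= mul1r. Qed.
Fact units_mulr1 : right_id units_one units_mul.
Proof. by move=> x; apply: uval_inj; rewrite /= mulr1. Qed.
Fact units_mulVr : left_inverse units_one units_inv units_mul.
Proof. by move=> x; apply: uval_inj; rewrite /= uVval. Qed.
Fact units_mulrV : right_inverse units_one units_inv units_mul.
Proof. by move=> x; apply: uval_inj; rewrite /= uvalV. Qed.
HB.instance Definition _ := isGroup.Build units
  units_mulA units_mul1 units_mulr1 units_mulVr units_mulrV.

End Units.

Section SubgroupSeries.
Variable G : groupType.
Local Open Scope group_scope.
Implicit Types (H K : set G) (S : set G).

Definition subgroup_axiom (H : set G) : Prop :=
  H 1 /\ forall x y, H x -> H y -> H (x * y^-1).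

Definition subgroup_gen S : set G := smallest subgroup_axiom S.

Definition commutator H K : set G :=
  subgroup_gen [set [~ x, y] | x in H & y in K].

Definition subgroup_pow H q : set G := subgroup_gen [set x ^+ q | x in H].

(* [monoid] only provides powers with exponent in [nat]. *)
Definition expgz (g : G) (z : int) : G :=
  match z with Posz n => g ^+ n | Negz n => g ^- n.+1 end.

(* The series below are indexed from 1; the value at 0 is a junk value. *)
Fixpoint gamma n : set G :=
  match n with
  | 0 | 1 => [set: G]
  | m.+1 => commutator (gamma m) [set: G]
  end.

Definition gamma0 n : set G :=
  [set g | exists2 z : int, z != 0%R & gamma n (expgz g z)].

(* [gammap p n] is the recursion
     gamma_{1,p} = G,
     gamma_{n,p} = [gamma_{n-1,p}, G] gamma_{ceil(n/p),p}^p
   with n as fuel: both indices on the right-hand side are smaller than n. The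
   recurrence is [gammapE]. *)
Fixpoint gammap_rec p fuel n : set G :=
  if fuel is fuel'.+1 then
    if (n <= 1)%N then [set: G] else
    [set x * y | x in commutator (gammap_rec p fuel' n.-1) [set: G]
               & y in subgroup_pow (gammap_rec p fuel' ((n + p.-1) %/ p)%N) p]
  else [set: G].

Definition gammap p n : set G := gammap_rec p n n.

Lemma gammap_rec_fuel p f1 f2 n : (1 < p)%N -> (n <= f1)%N -> (n <= f2)%N ->
  gammap_rec p f1 n = gammap_rec p f2 n.
Proof.
move=> p1; elim: f1 f2 n => [|f1 IH] [|f2] n //=.
- by rewrite leqn0 => /eqP ->.
- by move=> _; rewrite leqn0 => /eqP ->.
move=> n1 n2; case: leqP => // n_gt1.
have le_ceil f : (n <= f.+1)%N -> ((n + p.-1) %/ p <= f)%N.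
  by move=> nf; rewrite -ltnS ltn_divLR; nia.
by rewrite (IH f2 n.-1) ?(IH f2 ((n + p.-1) %/ p)%N) ?le_ceil //; lia.
Qed.

Lemma gammapE p n : (1 < p)%N -> (1 < n)%N ->
  gammap p n =
  [set x * y | x in commutator (gammap p n.-1) [set: G]
             & y in subgroup_pow (gammap p ((n + p.-1) %/ p)%N) p].
Proof.
case: n => [|[|n]] // p1 _; set m := (_ %/ _)%N.
have mn : (m <= n.+1)%N by rewrite -ltnS ltn_divLR; nia.
by rewrite [gammap p m](gammap_rec_fuel p1 (leqnn m) mn).
Qed.

End SubgroupSeries.

Section PresentedGroup.
Variables (X : choiceType).

(* The letter [(x, true)] is the generator x, and [(x, false)] its inverse. *)
Definition word := seq (X * bool).

Definition word_inv (w : word) : word := rev [seq (a.1, ~~ a.2) | a <- w].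

Variable rel : word -> word -> Prop.

Inductive word_eq : word -> word -> Prop :=
| word_eq_refl u : word_eq u u
| word_eq_sym u v : word_eq u v -> word_eq v u
| word_eq_trans u v w : word_eq u v -> word_eq v w -> word_eq u w
| word_eq_cat u u' v v' :
    word_eq u u' -> word_eq v v' -> word_eq (u ++ v) (u' ++ v')
| word_eq_cancel x b : word_eq [:: (x, b); (x, ~~ b)] [::]
| word_eq_rel u v : rel u v -> word_eq u v.

Definition word_eqb (u v : word) : bool := `[<word_eq u v>].

Fact word_eqb_equiv : equiv_class_of word_eqb.
Proof.
split=> [u|u v|v u w].
- exact/asboolP/word_eq_refl.
- by apply/asboolP/asboolP; apply: word_eq_sym.
- by move=> /asboolP uv /asboolP vw; apply/asboolP; apply: word_eq_trans vw.
Qed.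
Canonical word_eqb_equivRel := EquivRelPack word_eqb_equiv.
Canonical word_eqb_encModRel := defaultEncModRel word_eqb.

Definition presented_group : Type := {eq_quot word_eqb}.
HB.instance Definition _ := Choice.on presented_group.

Definition word_class (u : word) : presented_group :=
  (\pi_{eq_quot word_eqb} u)%qT.
Definition word_repr (g : presented_group) : word :=
  repr (g : {eq_quot word_eqb}).

Definition presented_gen (x : X) : presented_group := word_class [:: (x, true)].

Lemma word_reprK g : word_class (word_repr g) = g.
Proof. exact: reprK. Qed.

Lemma word_classP u v : word_class u = word_class v <-> word_eq u v.
Proof.
split=> [/eqmodP/asboolP //|uv].
by apply/eqmodP/asboolP.
Qed.

Lemma word_invK : involutive word_inv.
Proof.
move=> u; rewrite /word_inv map_rev revK -map_comp -[RHS]map_id.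
by apply: eq_map => -[x b] /=; rewrite negbK.
Qed.

Lemma word_eq_invl u : word_eq (word_inv u ++ u) [::].
Proof.
elim: u => [|[x b] u IH]; first exact: word_eq_refl.
rewrite /word_inv /= rev_cons cat_rcons -/(word_inv u).
apply: word_eq_trans IH; apply: word_eq_cat; first exact: word_eq_refl.
rewrite -[(x, ~~ b) :: _]/([:: (x, ~~ b); (x, b)] ++ u) -[X in word_eq _ X]cat0s.
apply: word_eq_cat; last exact: word_eq_refl.
by have := word_eq_cancel x (~~ b); rewrite negbK.
Qed.

Lemma word_inv_cat u v : word_inv (u ++ v) = word_inv v ++ word_inv u.
Proof. by rewrite /word_inv map_cat rev_cat. Qed.

Lemma word_eq_inv u v : word_eq u v -> word_eq (word_inv u) (word_inv v).
Proof.
move=> uv.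
apply: (@word_eq_trans _ (word_inv u ++ v ++ word_inv v)).
  rewrite -[X in word_eq X _]cats0; apply: word_eq_cat; first exact: word_eq_refl.
  by apply: word_eq_sym; have := word_eq_invl (word_inv v); rewrite word_invK.
rewrite catA -[X in word_eq _ X]cat0s; apply: word_eq_cat; last exact: word_eq_refl.
apply: word_eq_trans (word_eq_invl u).
by apply: word_eq_cat; [exact: word_eq_refl|exact: word_eq_sym].
Qed.

Definition presented_mul (g h : presented_group) : presented_group :=
  word_class (word_repr g ++ word_repr h).
Definition presented_inv (g : presented_group) : presented_group :=
  word_class (word_inv (word_repr g)).
Definition presented_one : presented_group := word_class [::].

Lemma presented_mul_class u v :
  presented_mul (word_class u) (word_class v) = word_class (u ++ v).
Proof.
by apply/word_classP/word_eq_cat; apply/word_classP; rewrite word_reprK.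
Qed.

Lemma presented_inv_class u :
  presented_inv (word_class u) = word_class (word_inv u).
Proof. by apply/word_classP/word_eq_inv/word_classP; rewrite word_reprK. Qed.

Fact presented_mulA : associative presented_mul.
Proof.
move=> f g h; rewrite -[f]word_reprK -[g]word_reprK -[h]word_reprK.
by rewrite !presented_mul_class catA.
Qed.
Fact presented_mul1 : left_id presented_one presented_mul.
Proof. by move=> g; rewrite -[g]word_reprK presented_mul_class. Qed.
Fact presented_mulr1 : right_id presented_one presented_mul.
Proof. by move=> g; rewrite -[g]word_reprK presented_mul_class cats0. Qed.
Fact presented_mulV : left_inverse presented_one presented_inv presented_mul.
Proof.
move=> g; rewrite -[g]word_reprK presented_inv_class presented_mul_class.
exact/word_classP/word_eq_invl.
Qed.
Fact presented_mulrV : right_inverse presented_one presented_inv presented_mul.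
Proof.
move=> g; rewrite -[g]word_reprK presented_inv_class presented_mul_class.
by apply/word_classP; have := word_eq_invl (word_inv (word_repr g));
  rewrite word_invK.
Qed.
HB.instance Definition _ := isGroup.Build presented_group
  presented_mulA presented_mul1 presented_mulr1 presented_mulV presented_mulrV.

End PresentedGroup.

Section GroupRing.
Variables (k : comNzRingType) (G : groupType).

(* The ring structure of [monalg] on [{malg k[M]}] requires M to have no
   non-trivial invertible element; only its additive structure is reused. *)
Definition group_ring : Type := {malg k[G]}.
HB.instance Definition _ := GRing.Lmodule.on group_ring.

Implicit Types f g : group_ring.

Definition gr_gen (x : G) : group_ring := mkmalgU x 1.

Definition gr_one : group_ring := gr_gen 1%g.

Definition gr_mul f g : group_ring :=
  \sum_(x <- msupp f) \sum_(y <- msupp g) mkmalgU (x * y)%g (f@_x * g@_y).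

Lemma gr_mulw (d1 d2 : {fset G}) f g :
  (msupp f `<=` d1)%fset -> (msupp g `<=` d2)%fset ->
  gr_mul f g = \sum_(x <- d1) \sum_(y <- d2) mkmalgU (x * y)%g (f@_x * g@_y).
Proof.
move=> le_d1 le_d2; rewrite /gr_mul (big_fset_incl _ le_d1) /=.
  apply/eq_bigr=> x _; apply/big_fset_incl => // y _ /mcoeff_outdom ->.
  by rewrite mulr0 monalgU0.
move=> x _ /mcoeff_outdom fx.
by rewrite big1 // => y _; rewrite fx mul0r monalgU0.
Qed.

Fact gr_mulDl : left_distributive gr_mul +%R.
Proof.
move=> f1 f2 g.
rewrite (gr_mulw (msuppD_le f1 f2) (fsubset_refl _)).
rewrite [gr_mul f1 g](gr_mulw (fsubsetUl _ (msupp f2)) (fsubset_refl _)).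
rewrite [gr_mul f2 g](gr_mulw (fsubsetUr (msupp f1) _) (fsubset_refl _)).
rewrite -big_split /=; apply/eq_bigr=> x _.
rewrite -big_split /=; apply/eq_bigr=> y _.
by rewrite mcoeffD mulrDl monalgUD.
Qed.

Fact gr_mulDr : right_distributive gr_mul +%R.
Proof.
move=> f g1 g2.
rewrite (gr_mulw (fsubset_refl _) (msuppD_le g1 g2)).
rewrite [gr_mul f g1](gr_mulw (fsubset_refl _) (fsubsetUl _ (msupp g2))).
rewrite [gr_mul f g2](gr_mulw (fsubset_refl _) (fsubsetUr (msupp g1) _)).
rewrite -big_split /=; apply/eq_bigr=> x _.
rewrite -big_split /=; apply/eq_bigr=> y _.
by rewrite mcoeffD mulrDr monalgUD.
Qed.

Fact gr_mul0l : left_zero 0 gr_mul.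
Proof. by move=> f; rewrite /gr_mul msupp0 big_seq_fset0. Qed.
Fact gr_mul0r : right_zero 0 gr_mul.
Proof.
by move=> f; rewrite /gr_mul big1 // => x _; rewrite msupp0 big_seq_fset0.
Qed.

Lemma gr_mulUU (a b : k) (x y : G) :
  gr_mul (mkmalgU x a) (mkmalgU y b) = mkmalgU (x * y)%g (a * b).
Proof. by rewrite (gr_mulw msuppU_le msuppU_le) !big_seq_fset1 !mcoeffUU. Qed.

Lemma gr_mul_suml I (r : seq I) (F : I -> group_ring) g :
  gr_mul (\sum_(i <- r) F i) g = \sum_(i <- r) gr_mul (F i) g.
Proof.
exact: (big_morph (gr_mul^~ g) (fun _ _ => gr_mulDl _ _ _) (gr_mul0l _)).
Qed.
Lemma gr_mul_sumr I (r : seq I) (F : I -> group_ring) f :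
  gr_mul f (\sum_(i <- r) F i) = \sum_(i <- r) gr_mul f (F i).
Proof. exact: (big_morph (gr_mul f) (fun _ _ => gr_mulDr _ _ _) (gr_mul0r _)). Qed.

Lemma grE f : f = \sum_(x <- msupp f) mkmalgU x f@_x.
Proof. exact: monalgE. Qed.

Fact gr_mulA : associative gr_mul.
Proof.
move=> f g h; rewrite [f]grE [g]grE [h]grE.
rewrite !(gr_mul_suml (msupp f)) (gr_mul_suml (msupp g)).
apply: eq_bigr => x _; rewrite !(gr_mul_sumr (msupp g)) gr_mul_suml.
apply: eq_bigr => y _; rewrite !(gr_mul_sumr (msupp h)); apply: eq_bigr => z _.
by rewrite !gr_mulUU mulrA mulgA.
Qed.

Fact gr_mul1 : left_id gr_one gr_mul.
Proof.
move=> f; rewrite {1}[f]grE gr_mul_sumr [RHS]grE; apply: eq_bigr => x _.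
by rewrite gr_mulUU mul1r mul1g.
Qed.
Fact gr_mulr1 : right_id gr_one gr_mul.
Proof.
move=> f; rewrite {1}[f]grE gr_mul_suml [RHS]grE; apply: eq_bigr => x _.
by rewrite gr_mulUU mulr1 mulg1.
Qed.
Fact gr_one_neq0 : gr_one != 0.
Proof.
apply/eqP=> /malgP /(_ 1%g) /eqP.
by rewrite mcoeffUU mcoeff0 oner_eq0.
Qed.
HB.instance Definition _ := GRing.Zmodule_isNzRing.Build group_ring
  gr_mulA gr_mul1 gr_mulr1 gr_mulDl gr_mulDr gr_one_neq0.

Lemma gr_scaleU (c a : k) x : c *: (mkmalgU x a : group_ring) = mkmalgU x (c * a).
Proof. by apply/malgP => y; rewrite mcoeffZ !mcoeffU mulrnAr. Qed.

Fact gr_scalerAl (c : k) f g : c *: (f * g) = (c *: f) * g.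
Proof.
rewrite -[f * g]/(gr_mul f g) -[_ * g]/(gr_mul _ g) [f]grE [g]grE.
rewrite (scaler_sumr c (msupp f)) !(gr_mul_suml (msupp f)).
rewrite (scaler_sumr c (msupp f)).
apply: eq_bigr => x _; rewrite !(gr_mul_sumr (msupp g)).
rewrite (scaler_sumr c (msupp g)).
by apply: eq_bigr => y _; rewrite gr_scaleU !gr_mulUU gr_scaleU mulrA.
Qed.
HB.instance Definition _ :=
  GRing.Lmodule_isLalgebra.Build k group_ring gr_scalerAl.
Fact gr_scalerAr (c : k) f g : c *: (f * g) = f * (c *: g).
Proof.
rewrite -[f * g]/(gr_mul f g) -[f * _]/(gr_mul f _) [f]grE [g]grE.
rewrite !(gr_mul_suml (msupp f)) (scaler_sumr c (msupp f)); apply: eq_bigr => x _.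
rewrite (scaler_sumr c (msupp g)) !(gr_mul_sumr (msupp g)).
rewrite (scaler_sumr c (msupp g)).
by apply: eq_bigr => y _; rewrite gr_scaleU !gr_mulUU gr_scaleU mulrCA.
Qed.
HB.instance Definition _ :=
  GRing.Lalgebra_isAlgebra.Build k group_ring gr_scalerAr.

Definition gr_aug (f : group_ring) : k := \sum_(x <- msupp f) f@_x.

Lemma gr_augw (d : {fset G}) f : (msupp f `<=` d)%fset ->
  gr_aug f = \sum_(x <- d) f@_x.
Proof.
by move=> le_d; apply: big_fset_incl => // x _ /mcoeff_outdom.
Qed.

Fact gr_augD : {morph gr_aug : f g / f + g}.
Proof.
move=> f g; rewrite (gr_augw (msuppD_le f g)).
rewrite (gr_augw (fsubsetUl _ (msupp g))) (gr_augw (fsubsetUr (msupp f) _)).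
by rewrite -big_split; apply: eq_bigr => x _; rewrite /= mcoeffD.
Qed.
Lemma gr_augU a x : gr_aug (mkmalgU x a) = a.
Proof. by rewrite (gr_augw msuppU_le) big_seq_fset1 mcoeffUU. Qed.
Lemma gr_aug_sum I (r : seq I) (F : I -> group_ring) :
  gr_aug (\sum_(i <- r) F i) = \sum_(i <- r) gr_aug (F i).
Proof.
apply: (big_morph gr_aug gr_augD).
by rewrite /gr_aug msupp0 big_seq_fset0.
Qed.

Fact gr_aug_scalar : scalar gr_aug.
Proof.
move=> c f g; rewrite gr_augD; congr (_ + _).
rewrite [f]grE scaler_sumr !gr_aug_sum mulr_sumr; apply: eq_bigr => x _.
by rewrite gr_scaleU !gr_augU.
Qed.
Fact gr_aug_monoid_morphism : monoid_morphism gr_aug.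
Proof.
split=> [|f g]; first exact: gr_augU.
rewrite -[f * g]/(gr_mul f g) [f]grE [g]grE (gr_mul_suml (msupp f)).
rewrite !gr_aug_sum mulr_suml; apply: eq_bigr => x _.
rewrite (gr_mul_sumr (msupp g)) !gr_aug_sum mulr_sumr.
by apply: eq_bigr => y _; rewrite gr_mulUU !gr_augU.
Qed.
HB.instance Definition _ := isAugmented.Build k group_ring
  gr_aug_scalar gr_aug_monoid_morphism.

Lemma gr_genM x y : gr_gen (x * y)%g = gr_gen x * gr_gen y.
Proof. by rewrite -[RHS]/(gr_mul _ _) gr_mulUU mulr1. Qed.

Fact gr_genV x : gr_gen x * gr_gen x^-1%g = 1.
Proof. by rewrite -gr_genM mulgV. Qed.
Fact gr_genVl x : gr_gen x^-1%g * gr_gen x = 1.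
Proof. by rewrite -gr_genM mulVg. Qed.

Definition regular_rep (x : G) : units group_ring :=
  Units (gr_genV x) (gr_genVl x).

Fact regular_repM : {morph regular_rep : x y / (x * y)%g}.
Proof. by move=> x y; apply: uval_inj; rewrite /= gr_genM. Qed.
HB.instance Definition _ :=
  monoid.isMultiplicative.Build G (units group_ring) regular_rep regular_repM.

End GroupRing.

Section FreeAlgebra.
Variables (k : comNzRingType) (V : choiceType).

Definition free_alg : Type := {malg k[{fmonom V}]}.
HB.instance Definition _ := GRing.Lalgebra.on free_alg.

Definition free_gen (v : V) : free_alg := mkmalgU (fmu v) 1.

Fact free_scalerAr (c : k) (f g : free_alg) : c *: (f * g) = f * (c *: g).
Proof.
have comm (h : free_alg) : c%:MP * h = h * c%:MP.
  rewrite mul_malgC malgZ_def [RHS]fgmulgU; apply: eq_bigr => m _.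
  by rewrite mulm1 mulrC.
by rewrite -!mul_malgC mulrA comm mulrA.
Qed.
HB.instance Definition _ :=
  GRing.Lalgebra_isAlgebra.Build k free_alg free_scalerAr.

Definition free_aug (f : free_alg) : k := mcoeff mone f.

Fact free_aug_scalar : scalar free_aug.
Proof. by move=> c f g; rewrite /free_aug mcoeffD mcoeffZ. Qed.
Fact free_aug_monoid_morphism : monoid_morphism free_aug.
Proof. 
split=> [|f g]; rewrite /free_aug; last exact: rmorphM.
exact: (rmorph1 (mcoeff mone : {malg k[{fmonom V}]} -> k)).
Qed.
HB.instance Definition _ := isAugmented.Build k free_alg
  free_aug_scalar free_aug_monoid_morphism.

End FreeAlgebra.

Section Graph.
Variables (V : choiceType) (E : rel V).

Variant raag_rel : word V -> word V -> Prop :=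
| RaagRel v w of E v w :
    raag_rel [:: (v, true); (w, true)] [:: (w, true); (v, true)].

Definition raag : Type := presented_group raag_rel.
HB.instance Definition _ := monoid.Group.on raag.

Definition raag_gen (v : V) : raag := presented_gen raag_rel v.

Variable k : comNzRingType.

(* [pc_alg] is the algebra of polynomials in partially commuting variables. *)
Definition pc_ideal : ideal (free_alg k V) :=
  ideal_gen [set x | exists v w, E v w /\
    x = free_gen k v * free_gen k w - free_gen k w * free_gen k v].

Definition pc_alg : Type := quotient_alg pc_ideal.
HB.instance Definition _ := GRing.PzRing.on pc_alg.
HB.instance Definition _ := GRing.Lmodule.on pc_alg.

Lemma pc_ideal_aug : pc_ideal `<=` aug_ideal (free_alg k V).
Proof.
apply: ideal_gen_sub => _ [v [w [_ ->]]]; rewrite /= /mkset raddfB /= !rmorphM /=.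
by rewrite mulrC subrr.
Qed.

Lemma aug_pc_repr (f : free_alg k V) : aug (qrepr (qpi pc_ideal f)) = aug f.
Proof.
have := pc_ideal_aug (qrepr_pi pc_ideal f).
by rewrite /= /mkset raddfB => /eqP; rewrite subr_eq0 => /eqP.
Qed.

Fact pc_one_neq0 : (1 : pc_alg) != 0.
Proof.
apply/eqP => /(congr1 (fun x => aug (qrepr x))).
rewrite -[1]/(qpi pc_ideal 1) -[0](raddf0 (qpi pc_ideal)) !aug_pc_repr.
by rewrite rmorph1 raddf0 => /eqP; rewrite oner_eq0.
Qed.
HB.instance Definition _ := GRing.PzSemiRing_isNonZero.Build pc_alg pc_one_neq0.
HB.instance Definition _ :=
  GRing.Lmodule_isLalgebra.Build k pc_alg (@qscalerAl k _ pc_ideal).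
HB.instance Definition _ :=
  GRing.Lalgebra_isAlgebra.Build k pc_alg (@qscalerAr k _ pc_ideal).

Definition pc_aug (x : pc_alg) : k := aug (qrepr x).

Fact pc_aug_scalar : scalar pc_aug.
Proof.
move=> c x y; rewrite /pc_aug -[x]qreprK -[y]qreprK.
by rewrite -[_ *: _ + _]linearP !aug_pc_repr linearP.
Qed.
Fact pc_aug_monoid_morphism : monoid_morphism pc_aug.
Proof.
split=> [|x y]; rewrite /pc_aug; first by rewrite aug_pc_repr rmorph1.
rewrite -[x]qreprK -[y]qreprK -[_ * _](rmorphM (qpi pc_ideal)).
by rewrite !aug_pc_repr rmorphM.
Qed.
HB.instance Definition _ := isAugmented.Build k pc_alg
  pc_aug_scalar pc_aug_monoid_morphism.

Definition pc_gen (v : V) : pc_alg := qpi pc_ideal (free_gen k v).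

Lemma aug_pc_gen v : aug (pc_gen v) = 0.
Proof.
rewrite -[LHS]/(aug (qrepr (qpi pc_ideal (free_gen k v)))) aug_pc_repr.
rewrite -[LHS]/(mcoeff mone (free_gen k v)) mcoeffU.
case: eqP => // vE; have := congr1 (fun m => size (fmonom_val m)) (vE : fmu v = fmone V).
by rewrite fmoneE fmuE.
Qed.

End Graph.

(* The subgroup rho^-1 (1 + J); J stands for the n-th power of the augmentation
   ideal of R, or for its closure. *)
Definition dimension_subgroup (G : groupType) (R : nzRingType) (J : set R)
    (rho : G -> units R) : set G :=
  [set g | J (uval (rho g) - 1)].

(* For rings that are not integral domains, [[pchar k] =i pred0] is weaker: it
   holds for instance in Z/4. *)
Definition char_zero (k : nzRingType) : Prop :=
  forall n : nat, n%:R = 0 :> k -> n = 0%N.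

(* Main.v *)
Require Import Defs.
From HB Require Import structures.
From mathcomp Require Import all_boot all_order all_algebra.
From mathcomp Require Import finmap monalg.
From mathcomp Require Import boolp classical_sets.
From mathcomp Require Import zify.
Require Import Defs.

(* Sending v to gr(v) - 1 defines a homomorphism R -> kA that inverts the Magnus map
   v |-> 1 + v modulo all powers of the augmentation ideals; hence the isomorphism of
   completions, and the dimension subgroups of mu are those of kA. They only depend
   on which integers vanish in k, because the coefficients of mu(g) are images of
   integers; so k may be replaced by Z, or by F_p.

   Over F_p, the Jennings-Lazard theorem identifies them for a finitely generated
   group G, and an element of A involves finitely many letters. Group elements
   spanning a restricted Lie algebra that contains I/I^2 yield a PBW basis of the
   I^m/I^(m+1), whence delta_m <= gamma_(m,p) delta_(m+1); finally delta_N <= gamma_(n,p)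
   for large N, as G / gamma_(n,p) is reached by finitely many central extensions by
   groups of exponent p.

   Over Z, an element g of gamma_n has as leading term a Lie polynomial of degree n, on
   which Dynkin's left-normed bracketing with values in gamma_n/gamma_(n+1) is n times
   the class of g. If g lies in delta_(n+1) this leading term vanishes in R, and
   g^n is in gamma_(n+1).

   Injectivity is checked over F_p: for a shortest expression
   g = v_1^(e_1) ... v_s^(e_s) and q_i the p-part of e_i, the coefficient of mu(g) at the
   monomial v_1^(q_1) ... v_s^(q_s) is nonzero, because the number of syllables of a
   word is invariant under the commutation relations once letters that can be brought
   together are counted as one syllable. *)

Set Implicit Arguments.
Unset Strict Implicit.
Unset Printing Implicit Defensive.

Import GRing.Theory.

Local Open Scope classical_set_scope.
Local Open Scope ring_scope.

(** * Lifting maps from generators *)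

(** The hard inclusions are those of the dimension subgroups in the central series. In
    characteristic p the coproduct of kG decides: for g in delta_m, Delta(g - 1) differs from (g -
    1) (x) 1 + 1 (x) (g - 1) by a term of I^m (x) I^m, so g - 1 is nearly primitive. A linear form
    dual to a letter acts on standard monomials like a partial derivative and multiplies a
    coefficient by a multiplicity between 1 and p - 1, which is invertible; hence only single
    letters occur in g - 1. The same derivatives prove that standard monomials are independent, so
    no enveloping algebra is built. Coefficients in F_p can serve as exponents of group elements,
    and this is why the argument is made over the prime field.

    In characteristic zero no such exponents are available for rational coefficients. Dynkin's
    operator stays integral at the price of a factor n, which gamma_(n,0) absorbs. It descends to R
    because the adjoint operators of commuting letters commute.

    When k has positive nonprime characteristic d, an integer that vanishes in k also vanishes
    modulo every prime divisor of d; this is enough for injectivity. *)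

Section LinearExtension.
Variables (k : comNzRingType) (K : choiceType).

Lemma malg_ind (P : {malg k[K]} -> Prop) :
  P 0 -> (forall x y, P x -> P y -> P (x + y)) ->
  (forall c w, P (mkmalgU w c)) -> forall x, P x.
Proof.
move=> P0 PD PU x; rewrite [x]monalgE; elim: (enum_fset _) => [|w s IH].
  by rewrite big_nil.
by rewrite big_cons; apply: PD.
Qed.

Lemma mkmalgUZ (c : k) (w : K) : mkmalgU w c = c *: (mkmalgU w 1 : {malg k[K]}).
Proof. by apply/malgP => y; rewrite mcoeffZ !mcoeffU mulrnAr mulr1. Qed.

Variables (M : lmodType k) (h : K -> M).

Definition lext (x : {malg k[K]}) : M := \sum_(w <- msupp x) x@_w *: h w.

Lemma lextEw (d : {fset K}) x : (msupp x `<=` d)%fset ->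
  lext x = \sum_(w <- d) x@_w *: h w.
Proof.
by move=> le_d; apply: big_fset_incl => // w _ /mcoeff_outdom ->; rewrite scale0r.
Qed.

Lemma lextU c w : lext (mkmalgU w c) = c *: h w.
Proof. by rewrite (lextEw msuppU_le) big_seq_fset1 mcoeffUU. Qed.

Lemma lextD x y : lext (x + y) = lext x + lext y.
Proof.
rewrite (lextEw (msuppD_le x y)) (lextEw (fsubsetUl _ (msupp y))).
rewrite (lextEw (fsubsetUr (msupp x) _)) -big_split /=.
by apply: eq_bigr => w _; rewrite mcoeffD scalerDl.
Qed.

Lemma lext0 : lext 0 = 0.
Proof. by rewrite /lext msupp0 big_seq_fset0. Qed.

Lemma lextZ c x : lext (c *: x) = c *: lext x.
Proof.
rewrite (lextEw (msuppZ_le c x)) /lext scaler_sumr.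
by apply: eq_bigr => w _; rewrite mcoeffZ scalerA.
Qed.

Lemma lext_linear : linear lext.
Proof. by move=> c x y; rewrite lextD lextZ. Qed.

Lemma lextN x : lext (- x) = - lext x.
Proof. by apply/eqP; rewrite -addr_eq0 -lextD addNr lext0. Qed.

End LinearExtension.

Lemma gr_indU (k : comNzRingType) (G : groupType) (P : group_ring k G -> Prop) :
  P 0 -> (forall x y, P x -> P y -> P (x + y)) ->
  (forall c g, P (mkmalgU g c)) -> forall x, P x.
Proof. exact: malg_ind. Qed.

Lemma free_indU (k : comNzRingType) (V : choiceType) (P : free_alg k V -> Prop) :
  P 0 -> (forall x y, P x -> P y -> P (x + y)) ->
  (forall c w, P (mkmalgU w c)) -> forall x, P x.
Proof. exact: malg_ind. Qed.

Section FreeInduction.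
Variables (k : comNzRingType).

Lemma gr_ind (G : groupType) (P : group_ring k G -> Prop) :
  P 0 -> (forall x y, P x -> P y -> P (x + y)) -> (forall c x, P x -> P (c *: x)) ->
  (forall g, P (gr_gen k g)) -> forall x, P x.
Proof.
move=> P0 PD PZ PU; elim/gr_indU => [//|//|c w].
by rewrite mkmalgUZ; apply: (PZ c (gr_gen k w)); apply: PU.
Qed.

Lemma free_ind (V : choiceType) (P : free_alg k V -> Prop) :
  P 0 -> (forall x y, P x -> P y -> P (x + y)) -> (forall c x, P x -> P (c *: x)) ->
  P 1 -> (forall v x, P x -> P (free_gen k v * x)) -> forall x, P x.
Proof.
move=> P0 PD PZ P1 PM; elim/free_indU => [//|//|c w].
rewrite mkmalgUZ; apply: (PZ c (mkmalgU w 1 : free_alg k V)); rewrite -[w]fmK; elim: (fmonom_val w) => [|v s IH].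
  by rewrite -fmoneE; exact: P1.
have -> : mkmalgU (FMonom (v :: s)) 1 = free_gen k v * mkmalgU (FMonom s) 1.
  rewrite -[RHS]/(fgmul _ _) fgmulUU mulr1; congr mkmalgU.
  by rewrite -[mmul _ _]/(fmmul _ _) fmmulE fmuE.
exact: PM.
Qed.

Lemma free_lrmorphism_eq (V : choiceType) (B : algType k)
  (f g : {lrmorphism free_alg k V -> B}) :
  (forall v, f (free_gen k v) = g (free_gen k v)) -> forall x, f x = g x.
Proof.
move=> fg; elim/free_ind => [|x y IHx IHy|c x IH||v x IH].
- by rewrite !raddf0.
- by rewrite (raddfD f) (raddfD g) /= IHx IHy.
- by rewrite !linearZ /= IH.
- by rewrite !rmorph1.
- by rewrite !rmorphM /= fg IH.
Qed.
End FreeInduction.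

Section AlgebraLifts.
Variables (k : comNzRingType) (B : algType k).

Section GroupRingLift.
Variables (G : groupType) (f : UMagmaMorphism.type G (units B)).

Definition gr_lift (x : group_ring k G) : B := lext (fun g => uval (f g)) x.

Fact gr_liftD (x y : group_ring k G) : gr_lift (x + y) = gr_lift x + gr_lift y.
Proof. exact: lextD. Qed.
Fact gr_lift0 : gr_lift 0 = 0.
Proof. exact: lext0. Qed.
Fact gr_lift_linear : linear gr_lift.
Proof. exact: lext_linear. Qed.
HB.instance Definition _ := GRing.isLinear.Build k (group_ring k G) B *:%R gr_lift gr_lift_linear.

Lemma gr_liftU c g : gr_lift (mkmalgU g c) = c *: uval (f g).
Proof. exact: lextU. Qed.

Lemma gr_lift_gen g : gr_lift (gr_gen k g) = uval (f g).
Proof. by rewrite gr_liftU scale1r. Qed.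

Fact gr_lift_monoid : monoid_morphism gr_lift.
Proof.
split; first by rewrite gr_lift_gen gmulf1.
move=> x y; elim/gr_indU: x => [|x x' IH IH'|c g].
- by rewrite !(mul0r, gr_lift0).
- by rewrite mulrDl !gr_liftD mulrDl IH IH'.
elim/gr_indU: y => [|y y' IH IH'|d h].
- by rewrite !(mulr0, gr_lift0).
- by rewrite mulrDr !gr_liftD mulrDr IH IH'.
rewrite -[_ * _]/(gr_mul _ _) gr_mulUU !gr_liftU gmulfM /=.
by rewrite -scalerAl -scalerAr scalerA.
Qed.
HB.instance Definition _ := GRing.isMonoidMorphism.Build (group_ring k G) B gr_lift gr_lift_monoid.

(* Stated as a [Qed]-opaque existence: unfolding [gr_lift] makes failing
   unifications very slow. *)
Lemma gr_lift_exists : {F : {lrmorphism group_ring k G -> B} |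
  forall g, F (gr_gen k g) = uval (f g)}.
Proof. by exists gr_lift; apply: gr_lift_gen. Qed.
End GroupRingLift.

Section FreeLift.
Variables (V : choiceType) (f : V -> B).

Definition free_lift (x : free_alg k V) : B :=
  lext (fun w : {fmonom V} => \prod_(v <- fmonom_val w) f v) x.

Fact free_liftD (x y : free_alg k V) : free_lift (x + y) = free_lift x + free_lift y.
Proof. exact: lextD. Qed.
Fact free_lift0 : free_lift 0 = 0.
Proof. exact: lext0. Qed.
Fact free_lift_linear : linear free_lift.
Proof. exact: lext_linear. Qed.
HB.instance Definition _ := GRing.isLinear.Build k (free_alg k V) B *:%R free_lift free_lift_linear.

Lemma free_liftU c w : free_lift (mkmalgU w c) = c *: \prod_(v <- fmonom_val w) f v.
Proof. exact: lextU. Qed.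

Lemma free_lift_gen v : free_lift (free_gen k v) = f v.
Proof. by rewrite free_liftU scale1r fmuE big_seq1. Qed.

Fact free_lift_monoid : monoid_morphism free_lift.
Proof.
split; first by rewrite -[1]/(mkmalgU (fmone V) 1) free_liftU scale1r fmoneE big_nil.
move=> x y; elim/free_indU: x => [|x x' IH IH'|c u].
- by rewrite !(mul0r, free_lift0).
- rewrite (mulrDl x x' y) free_liftD free_liftD (mulrDl (free_lift x)).
  by congr (_ + _); [exact: IH|exact: IH'].
elim/free_indU: y => [|y y' IH IH'|d w].
- by rewrite !(mulr0, free_lift0).
- rewrite (mulrDr _ y y') (free_liftD (_ * _)) (free_liftD y y') (mulrDr _ (free_lift y)).
  by congr (_ + _); [exact: IH|exact: IH'].
rewrite -[_ * _]/(fgmul _ _) fgmulUU !free_liftU -[mmul _ _]/(fmmul _ _) fmmulE big_cat /=.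
by rewrite -scalerAl -scalerAr scalerA.
Qed.
HB.instance Definition _ := GRing.isMonoidMorphism.Build (free_alg k V) B free_lift free_lift_monoid.

Lemma free_liftM x y : free_lift (x * y) = free_lift x * free_lift y.
Proof. exact: (rmorphM free_lift). Qed.
Lemma free_liftB x y : free_lift (x - y) = free_lift x - free_lift y.
Proof. exact: (raddfB free_lift). Qed.

Lemma free_lift_exists : {F : {lrmorphism free_alg k V -> B} |
  forall v, F (free_gen k v) = f v}.
Proof. by exists free_lift; apply: free_lift_gen. Qed.
End FreeLift.

Section PcLift.
Variables (V : choiceType) (E : rel V) (f : V -> B).
Hypothesis fC : forall v w, E v w -> f v * f w = f w * f v.

(** The vacuous [let] makes [fC] a parameter of [pc_lift]: the morphism instances below depend on it
    and could not be inferred otherwise. [raag_lift] has the same form. *)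
Definition pc_lift (x : pc_alg E k) : B := let _ := fC in free_lift f (qrepr x).

Lemma pc_lift_pi x : pc_lift (qpi (pc_ideal E k) x) = free_lift f x.
Proof.
have hK : ideal_axiom [set y : free_alg k V | free_lift f y = 0].
  split=> [|y z y0 z0|a z z0|a z z0]; rewrite /= /mkset.
  - exact: free_lift0.
  - by rewrite free_liftB y0 z0 subrr.
  - by rewrite free_liftM z0 mulr0.
  - by rewrite free_liftM z0 mul0r.
have /(_ _ (qrepr_pi (pc_ideal E k) x)) : pc_ideal E k `<=` Ideal hK.
  apply: ideal_gen_sub => _ [v [w [vw ->]]]; rewrite /= /mkset free_liftB.
  apply/eqP; rewrite subr_eq0; apply/eqP.
  transitivity (f v * f w); first by rewrite free_liftM 2!free_lift_gen.
  by rewrite fC // free_liftM 2!free_lift_gen.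
by rewrite /= /mkset free_liftB => /eqP; rewrite subr_eq0 => /eqP.
Qed.

Fact pc_lift_linear : linear pc_lift.
Proof.
move=> c x y; rewrite -[x]qreprK -[y]qreprK -[_ + _](linearP (qpi (pc_ideal E k))).
by rewrite !pc_lift_pi linearP.
Qed.
HB.instance Definition _ := GRing.isLinear.Build k (pc_alg E k) B *:%R pc_lift pc_lift_linear.

Fact pc_lift_monoid : monoid_morphism pc_lift.
Proof.
split=> [|x y]; first by rewrite -[1]/(qpi (pc_ideal E k) 1) pc_lift_pi rmorph1.
rewrite -[x]qreprK -[y]qreprK -[_ * _](rmorphM (qpi (pc_ideal E k))).
by rewrite !pc_lift_pi rmorphM.
Qed.
HB.instance Definition _ := GRing.isMonoidMorphism.Build (pc_alg E k) B pc_lift pc_lift_monoid.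

Lemma pc_lift_gen v : pc_lift (pc_gen E k v) = f v.
Proof. by rewrite pc_lift_pi free_lift_gen. Qed.

Lemma pc_lift_exists : {F : {lrmorphism pc_alg E k -> B} |
  (forall v, F (pc_gen E k v) = f v) /\
  forall x, F (qpi (pc_ideal E k) x) = sval (free_lift_exists f) x}.
Proof.
exists pc_lift; split=> [|x]; first exact: pc_lift_gen.
transitivity (free_lift f x); first exact: pc_lift_pi.
apply: (free_lrmorphism_eq (f := free_lift f)) => v.
by rewrite (svalP (free_lift_exists f)); apply: free_lift_gen.
Qed.
End PcLift.
End AlgebraLifts.

Section Induction.
Variables (k : comNzRingType).

Lemma pc_ind (V : choiceType) (E : rel V) (P : pc_alg E k -> Prop) :
  P 0 -> (forall x y, P x -> P y -> P (x + y)) -> (forall c x, P x -> P (c *: x)) ->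
  P 1 -> (forall v x, P x -> P (pc_gen E k v * x)) -> forall x, P x.
Proof.
move=> P0 PD PZ P1 PM x; rewrite -[x]qreprK; elim/free_ind: (qrepr x) => [|y z|c y||v y].
- by rewrite raddf0.
- by rewrite raddfD; apply: PD.
- by move=> Py; rewrite linearZ; apply: PZ.
- by rewrite rmorph1.
- by rewrite rmorphM; apply: PM.
Qed.
End Induction.

Section RaagLift.
Variables (V : choiceType) (E : rel V).

Lemma word_class_cons a u :
  word_class (raag_rel E) (a :: u) = (word_class (raag_rel E) [:: a] * word_class (raag_rel E) u)%g.
Proof. by rewrite -[RHS]/(presented_mul _ _) presented_mul_class. Qed.

Lemma word_class_false v :
  word_class (raag_rel E) [:: (v, false)] = (raag_gen E v)^-1%g.
Proof. by rewrite -[RHS]/(presented_inv _) presented_inv_class. Qed.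

Lemma raag_ind (P : raag E -> Prop) :
  P 1%g -> (forall v x, P x -> P (raag_gen E v * x)%g) ->
  (forall v x, P x -> P ((raag_gen E v)^-1 * x)%g) -> forall x, P x.
Proof.
move=> P1 PM PV x; rewrite -[x]word_reprK; elim: (word_repr x) => // -[v b] u IH.
rewrite word_class_cons; case: b; last rewrite word_class_false; auto.
exact: PM.
Qed.

Variables (H : groupType) (f : V -> H).
Hypothesis fC : forall v w, E v w -> (f v * f w = f w * f v)%g.

Definition word_eval (u : word V) : H :=
  (\prod_(a <- u) (if a.2 then f a.1 else (f a.1)^-1))%g.

Lemma word_eval_eq u v : word_eq (raag_rel E) u v -> word_eval u = word_eval v.
Proof.
elim=> {u v} [//|u v _ -> //|u v w _ -> _ -> //|u u' v v' _ IHu _ IHv|x b|_ _ [v w vw]].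
- by rewrite /word_eval !big_cat /= -!/(word_eval _) IHu IHv.
- by rewrite /word_eval big_cons big_seq1 big_nil; case: b; rewrite /= ?mulgV ?mulVg.
- by rewrite /word_eval !big_cons !big_nil !mulg1 /= fC.
Qed.

Definition raag_lift (x : raag E) : H := let _ := fC in word_eval (word_repr x).

Lemma raag_lift_class u : raag_lift (word_class (raag_rel E) u) = word_eval u.
Proof. by apply/word_eval_eq/word_classP; rewrite word_reprK. Qed.

Fact raag_liftM : {morph raag_lift : x y / (x * y)%g}.
Proof.
move=> x y; rewrite -[x]word_reprK -[y]word_reprK.
rewrite -[(_ * _)%g in LHS]/(presented_mul _ _) presented_mul_class !raag_lift_class.
by rewrite /word_eval big_cat.
Qed.
Fact raag_lift1 : raag_lift 1%g = 1%g.
Proof. by rewrite -[1%g]/(word_class (raag_rel E) [::]) raag_lift_class /word_eval big_nil. Qed.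
HB.instance Definition _ := monoid.isMultiplicative.Build (raag E) H raag_lift raag_liftM.
HB.instance Definition _ := monoid.Multiplicative_isUMagmaMorphism.Build (raag E) H raag_lift raag_lift1.

Lemma raag_lift_gen v : raag_lift (raag_gen E v) = f v.
Proof. by rewrite raag_lift_class /word_eval big_seq1. Qed.
End RaagLift.

(** * The Magnus map and the isomorphism of completions *)

Lemma commr_1D (A : pzRingType) (a b : A) : a * b = b * a -> (1 + a) * (1 + b) = (1 + b) * (1 + a).
Proof.
move=> ab; have h c d : c * d = d * c -> GRing.comm c (1 + d).
  by move=> cd; apply: commrD; [apply: commr1|].
by apply: (h); apply: commr_sym; apply: (h).
Qed.

Lemma commr_B1 (A : pzRingType) (a b : A) : a * b = b * a -> (a - 1) * (b - 1) = (b - 1) * (a - 1).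
Proof.
move=> ab; have h c d : c * d = d * c -> GRing.comm c (d - 1).
  by move=> cd; apply: commrB; [|apply: commr1].
by apply: (h); apply: commr_sym; apply: (h).
Qed.

Lemma ideal_powM (A : pzRingType) (I : ideal A) m n x y :
  ideal_pow I m x -> ideal_pow I n y -> ideal_pow I (m + n)%N (x * y).
Proof.
elim: n x y => [|n IH] x y xI; first by rewrite addn0 => _; apply: idealMr.
(* The quantifier over [x] serves closure under left multiplication, where x * (a * u) is read as (x
   * a) * u. *)
have hK : ideal_axiom [set y | forall x, ideal_pow I m x -> ideal_pow I (m + n.+1)%N (x * y)].
  split=> [x' _|u v uI vI x' xI'|a u uI x' xI'|a u uI x' xI'].
  - by rewrite mulr0; apply: ideal0.
  - by rewrite mulrBr; apply: idealB; [apply: uI|apply: vI].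
  - by rewrite mulrA; apply: uI; apply: idealMr.
  - by rewrite mulrA; apply: idealMr; apply: uI.
suff : ideal_pow I n.+1 `<=` Ideal hK by move=> h yI; apply: (h y yI).
apply: ideal_gen_sub => _ [u uI [v vI <-]] z zI.
rewrite addnS mulrA; apply: sub_gen_smallest; exists (z * u); last by exists v.
exact: IH.
Qed.

Lemma ideal_subKA (A : pzRingType) (I : ideal A) (y x z : A) : I (x - y) -> I (y - z) -> I (x - z).
Proof. by move=> xy yz; have := idealD xy yz; rewrite subrKA. Qed.

Lemma ideal_pow1 (A : pzRingType) (I : ideal A) x : I x -> ideal_pow I 1 x.
Proof. by move=> xI; apply: sub_gen_smallest; exists 1 => //; exists x; rewrite ?mul1r. Qed.

Lemma ideal_pow_exp (A : pzRingType) (I : ideal A) m n x :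
  ideal_pow I m x -> ideal_pow I (m * n)%N (x ^+ n).
Proof.
by move=> xI; elim: n => [|n IH]; rewrite ?muln0 // mulnS exprS; apply: ideal_powM.
Qed.

Lemma ideal_pow_map (A B : pzRingType) (I : ideal A) (J : ideal B) (f : {rmorphism A -> B}) :
  (forall x, I x -> J (f x)) -> forall n x, ideal_pow I n x -> ideal_pow J n (f x).
Proof.
move=> fIJ; elim=> [//|n IH].
have hK : ideal_axiom [set x | ideal_pow J n.+1 (f x)].
  split=> [|u v uI vI|a u uI|a u uI]; rewrite /mkset.
  - by rewrite rmorph0; apply: ideal0.
  - by rewrite rmorphB; apply: idealB.
  - by rewrite rmorphM; apply: idealMl.
  - by rewrite rmorphM; apply: idealMr.
apply: (ideal_gen_sub (I := Ideal hK)) => _ [u uI [v vI <-]]; rewrite /= /mkset rmorphM.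
by apply: sub_gen_smallest; exists (f u); [exact: IH|exists (f v); [exact: fIJ|]].
Qed.

Section QuotientTheory.
Variables (A : pzRingType) (I : ideal A).
Lemma qpiD x y : qpi I (x + y) = qpi I x + qpi I y. Proof. exact: (raddfD (qpi I)). Qed.
Lemma qpiB x y : qpi I (x - y) = qpi I x - qpi I y. Proof. exact: (raddfB (qpi I)). Qed.
Lemma qpiM x y : qpi I (x * y) = qpi I x * qpi I y. Proof. exact: (rmorphM (qpi I)). Qed.
Lemma qpi0 : qpi I 0 = 0. Proof. exact: (raddf0 (qpi I)). Qed.
Lemma qpi1 : qpi I 1 = 1. Proof. exact: (rmorph1 (qpi I)). Qed.
End QuotientTheory.

Lemma qpiZ (k : comNzRingType) (A : algType k) (I : ideal A) (c : k) (x : A) :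
  qpi I (c *: x) = c *: qpi I x.
Proof. exact: linearZ. Qed.

Section AugTheory.
Variables (k : comNzRingType) (A : augAlgType k).
Implicit Types x y : A.
Lemma augD x y : aug (x + y) = aug x + aug y. Proof. exact: raddfD. Qed.
Lemma augB x y : aug (x - y) = aug x - aug y. Proof. exact: raddfB. Qed.
Lemma augM x y : aug (x * y) = aug x * aug y. Proof. exact: rmorphM. Qed.
Lemma augZ c x : aug (c *: x) = c * aug x. Proof. exact: linearZ. Qed.
Lemma aug0 : aug (0 : A) = 0. Proof. exact: raddf0. Qed.
Lemma aug1 : aug (1 : A) = 1. Proof. exact: rmorph1. Qed.
End AugTheory.

Lemma aug_compl_of (k : comNzRingType) (A : augAlgType k) (a : A) : aug (compl_of a) = aug a.
Proof. by rewrite {1}/aug /= /compl_aug /= aug_qrepr_pi. Qed.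

Section CompletionUnits.
Variables (k : comNzRingType) (A : augAlgType k).
Local Notation I := (aug_ideal A).

Lemma compl_ofD (a b : A) : compl_of (a + b) = compl_of a + compl_of b.
Proof. by apply: completionP => m; apply: raddfD. Qed.
Lemma compl_ofM (a b : A) : compl_of (a * b) = compl_of a * compl_of b.
Proof. by apply: completionP => m; apply: rmorphM. Qed.
Lemma compl_of1 : compl_of (1 : A) = 1.
Proof. by []. Qed.
Lemma compl_ofZ (c : k) (a : A) : compl_of (c *: a) = c *: compl_of a.
Proof. by apply: completionP => m; apply: linearZ. Qed.
Lemma compl_of0 : compl_of (0 : A) = 0.
Proof. by []. Qed.

(** The truncated geometric series, inverse to [1 + a] up to the error [(- a) ^+ n]. For [a] of
    augmentation 0 its values form the inverse in the completion. *)
Definition geo (a : A) n : A := \sum_(i < n) (- a) ^+ i.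

Lemma geoMl a n : (1 + a) * geo a n = 1 - (- a) ^+ n.
Proof.
rewrite -opprB subrX1 -mulNr; congr (_ * _).
by rewrite opprB opprK.
Qed.
Lemma geoMr a n : geo a n * (1 + a) = 1 - (- a) ^+ n.
Proof.
rewrite -geoMl; apply: commr_sym; apply: commr_sum => i _; apply: commrX.
by apply/commrN/commr_sym/commrD; [apply: commr1|apply: commr_refl].
Qed.

Variables (a : A) (a0 : aug a = 0).

Lemma geo_transition m n : (m <= n)%N ->
  transition m (qpi (ideal_pow I n) (geo a n)) = qpi (ideal_pow I m) (geo a m).
Proof.
move=> mn; rewrite transition_pi //; apply/qpiP.
rewrite /geo -!(big_mkord xpredT (fun i => (- a) ^+ i)) (big_cat_nat (leq0n m) mn) //= addrAC subrr add0r.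
rewrite big_nat; apply: (big_ind (ideal_pow I m)) => [|x y|i /andP [mi _]].
- exact: ideal0.
- exact: idealD.
apply: (ideal_pow_leq mi); rewrite -[X in ideal_pow _ X]mul1n; apply: ideal_pow_exp.
by apply: ideal_pow1; rewrite /= /mkset raddfN /= a0 oppr0.
Qed.

Lemma ideal_pow_aug_exp i : ideal_pow I i ((- a) ^+ i).
Proof.
rewrite -[X in ideal_pow _ X]mul1n; apply: ideal_pow_exp.
by apply: ideal_pow1; rewrite /= /mkset raddfN /= a0 oppr0.
Qed.

Definition geo_compl : completion A := Completion geo_transition.

Fact aug_unitMl : (1 + compl_of a) * geo_compl = 1.
Proof.
apply: completionP => n.
rewrite -[LHS]/((qpi (ideal_pow I n) 1 + qpi _ a) * qpi _ (geo a n)).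
rewrite -raddfD -rmorphM /= geoMl; apply/qpiP; rewrite addrAC subrr add0r.
exact/idealN/ideal_pow_aug_exp.
Qed.

Fact aug_unitMr : geo_compl * (1 + compl_of a) = 1.
Proof.
apply: completionP => n.
rewrite -[LHS]/(qpi _ (geo a n) * (qpi (ideal_pow I n) 1 + qpi _ a)).
rewrite -raddfD -rmorphM /= geoMr; apply/qpiP; rewrite addrAC subrr add0r.
exact/idealN/ideal_pow_aug_exp.
Qed.

Definition aug_unit : units (completion A) := Units aug_unitMl aug_unitMr.

End CompletionUnits.

Lemma aug_gen (k : comNzRingType) (G : groupType) (g : G) : aug (gr_gen k g) = 1.
Proof. exact: gr_augU. Qed.

Section MagnusMap.
Variables (V : choiceType) (E : rel V) (k : comNzRingType).
Local Notation A := (raag E).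
Local Notation kA := (group_ring k A).
Local Notation R := (pc_alg E k).
Local Notation Rbar := (completion R).

Lemma pc_genC v w : E v w -> pc_gen E k v * pc_gen E k w = pc_gen E k w * pc_gen E k v.
Proof.
move=> vw; rewrite -[LHS]qpiM -[RHS]qpiM; apply/qpiP.
by apply: sub_gen_smallest; exists v, w.
Qed.

Definition magnus_gen v : units Rbar := aug_unit (aug_pc_gen E k v).

Lemma magnus_genC v w : E v w ->
  (magnus_gen v * magnus_gen w = magnus_gen w * magnus_gen v)%g.
Proof.
move=> vw; apply: uval_inj; apply: commr_1D.
by rewrite -!compl_ofM (pc_genC vw).
Qed.

Definition magnus : A -> units Rbar := raag_lift magnus_genC.
HB.instance Definition _ := UMagmaMorphism.copy magnus (raag_lift magnus_genC).

Lemma magnus_raag_gen v : uval (magnus (raag_gen E v)) = 1 + compl_of (pc_gen E k v).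
Proof. by rewrite /magnus raag_lift_gen. Qed.

Definition Magnus : {lrmorphism kA -> Rbar} := sval (gr_lift_exists magnus).

Lemma MagnusD x y : Magnus (x + y) = Magnus x + Magnus y. Proof. exact: (raddfD Magnus). Qed.
Lemma MagnusB x y : Magnus (x - y) = Magnus x - Magnus y. Proof. exact: (raddfB Magnus). Qed.
Lemma MagnusM x y : Magnus (x * y) = Magnus x * Magnus y. Proof. exact: (rmorphM Magnus). Qed.
Lemma MagnusZ c x : Magnus (c *: x) = c *: Magnus x. Proof. exact: linearZ. Qed.
Lemma Magnus0 : Magnus 0 = 0. Proof. exact: (raddf0 Magnus). Qed.
Lemma Magnus1 : Magnus 1 = 1. Proof. exact: (rmorph1 Magnus). Qed.

Lemma Magnus_gen g : Magnus (gr_gen k g) = uval (magnus g).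
Proof. exact: (svalP (gr_lift_exists magnus)). Qed.

Lemma aug_magnus g : aug (uval (magnus g)) = 1.
Proof.
elim/raag_ind: g => [|v x IH|v x IH]; first by rewrite gmulf1 aug1.
- rewrite gmulfM /= augM IH mulr1 magnus_raag_gen augD aug1.
  by rewrite aug_compl_of aug_pc_gen addr0.
- have := congr1 aug (uvalV (magnus (raag_gen E v))).
  rewrite gmulfM gmulfV /= !augM IH mulr1 aug1 => <-.
  by rewrite magnus_raag_gen augD aug1 aug_compl_of aug_pc_gen addr0 mul1r.
Qed.

Lemma aug_Magnus x : aug (Magnus x) = aug x.
Proof.
elim/gr_ind: x => [|x y IHx IHy|c x IH|g].
- by rewrite Magnus0 !aug0.
- by rewrite MagnusD !augD IHx IHy.
- by rewrite MagnusZ !augZ IH.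
- by rewrite Magnus_gen aug_magnus aug_gen.
Qed.

Lemma Magnus_ideal_pow n x : ideal_pow (aug_ideal kA) n x ->
  ideal_pow (aug_ideal Rbar) n (Magnus x).
Proof. by apply: ideal_pow_map => y; rewrite /= /mkset aug_Magnus. Qed.

Lemma Magnus_ideal_pow0 n x : ideal_pow (aug_ideal kA) n x -> Magnus x n = 0.
Proof. by move/Magnus_ideal_pow/ideal_pow_compl. Qed.

Definition unmag_gen v : kA := gr_gen k (raag_gen E v) - 1.

Lemma raag_genC v w : E v w ->
  (raag_gen E v * raag_gen E w = raag_gen E w * raag_gen E v)%g.
Proof.
move=> vw; rewrite -[LHS]/(presented_mul _ _) -[RHS]/(presented_mul _ _) !presented_mul_class.
by apply/word_classP; apply: word_eq_rel; constructor.
Qed.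

Lemma unmag_genC v w : E v w -> unmag_gen v * unmag_gen w = unmag_gen w * unmag_gen v.
Proof.
by move=> vw; apply: commr_B1; rewrite -!gr_genM raag_genC.
Qed.

Definition unmag : {lrmorphism R -> kA} := sval (pc_lift_exists unmag_genC).

Lemma unmagD x y : unmag (x + y) = unmag x + unmag y. Proof. exact: (raddfD unmag). Qed.
Lemma unmagB x y : unmag (x - y) = unmag x - unmag y. Proof. exact: (raddfB unmag). Qed.
Lemma unmagM x y : unmag (x * y) = unmag x * unmag y. Proof. exact: (rmorphM unmag). Qed.
Lemma unmagZ c x : unmag (c *: x) = c *: unmag x. Proof. exact: linearZ. Qed.
Lemma unmag0 : unmag 0 = 0. Proof. exact: (raddf0 unmag). Qed.
Lemma unmag1 : unmag 1 = 1. Proof. exact: (rmorph1 unmag). Qed.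

Lemma unmag_pc_gen v : unmag (pc_gen E k v) = gr_gen k (raag_gen E v) - 1.
Proof. exact: (svalP (pc_lift_exists unmag_genC)).1. Qed.

Lemma aug_unmag x : aug (unmag x) = aug x.
Proof.
elim/pc_ind: x => [|x y IHx IHy|c x IH||v x IH].
- by rewrite unmag0 !aug0.
- by rewrite unmagD !augD IHx IHy.
- by rewrite unmagZ !augZ IH.
- by rewrite unmag1 !aug1.
- by rewrite unmagM !augM unmag_pc_gen augB aug1 aug_gen subrr mul0r aug_pc_gen mul0r.
Qed.

Lemma unmag_ideal_pow n x : ideal_pow (aug_ideal R) n x -> ideal_pow (aug_ideal kA) n (unmag x).
Proof. by apply: ideal_pow_map => y; rewrite /= /mkset aug_unmag. Qed.

(** On a generator the composite is v |-> v - 1 |-> (1 + v) - 1. The opposite composite cannot be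
    formed, since [unmag] is defined on polynomials only; [MagnusK] is its substitute. *)
Lemma unmagK x : Magnus (unmag x) = compl_of x.
Proof.
elim/pc_ind: x => [|x y IHx IHy|c x IH||v x IH].
- by rewrite unmag0 Magnus0 compl_of0.
- by rewrite unmagD MagnusD IHx IHy compl_ofD.
- by rewrite unmagZ MagnusZ IH compl_ofZ.
- by rewrite unmag1 Magnus1 compl_of1.
- rewrite unmagM MagnusM IH compl_ofM unmag_pc_gen MagnusB Magnus1 Magnus_gen.
  by rewrite magnus_raag_gen (addrC 1) addrK.
Qed.

Lemma unmag_unique n r r' : qpi (ideal_pow (aug_ideal R) n) r = qpi _ r' ->
  ideal_pow (aug_ideal kA) n (unmag r - unmag r').
Proof. by move=> /qpiP rr'; rewrite -unmagB; apply: unmag_ideal_pow. Qed.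

(** A left inverse modulo I^n, for an arbitrary lift [r] of the n-th component. The elements with
    this property [P] are closed under sums, scalars and products, so that only the generators, for
    which 1 + v is a lift, and their inverses have to be treated. *)
Lemma MagnusK n x r : qpi (ideal_pow (aug_ideal R) n) r = Magnus x n ->
  ideal_pow (aug_ideal kA) n (unmag r - x).
Proof.
pose P x := ideal_pow (aug_ideal kA) n (unmag (qrepr (Magnus x n)) - x).
suff : P x.
  move=> Px rx; apply: (ideal_subKA _ Px).
  by apply: unmag_unique; rewrite qreprK.
have PM y z : P y -> P z -> P (y * z).
  rewrite /P => Py Pz.
  have h : ideal_pow (aug_ideal kA) n
      (unmag (qrepr (Magnus (y * z) n)) - unmag (qrepr (Magnus y n) * qrepr (Magnus z n))).
    by apply: unmag_unique; rewrite qreprK qpiM !qreprK MagnusM.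
  rewrite /P; apply: (ideal_subKA h); rewrite unmagM; set b := unmag _ in Pz *.
  apply: (@ideal_subKA _ _ (y * b)); first by rewrite -mulrBl; apply: idealMr.
  by rewrite -mulrBr; apply: idealMl.
elim/gr_ind: x => [|x y IHx IHy|c x IH|g].
- have := @unmag_unique n (qrepr (Magnus 0 n)) 0; rewrite unmag0 subr0 /P subr0; apply.
  by rewrite qreprK Magnus0.
- have h : ideal_pow (aug_ideal kA) n
      (unmag (qrepr (Magnus (x + y) n)) - unmag (qrepr (Magnus x n) + qrepr (Magnus y n))).
    by apply: unmag_unique; rewrite qreprK qpiD !qreprK MagnusD.
  by rewrite /P; apply: (ideal_subKA h); rewrite unmagD opprD addrACA; apply: idealD.
- have h : ideal_pow (aug_ideal kA) n
      (unmag (qrepr (Magnus (c *: x) n)) - unmag (c *: qrepr (Magnus x n))).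
    by apply: unmag_unique; rewrite qreprK qpiZ !qreprK MagnusZ.
  by rewrite /P; apply: (ideal_subKA h); rewrite unmagZ -scalerBr; apply: idealZ.
have P1 : P 1.
  have := @unmag_unique n (qrepr (Magnus 1 n)) 1; rewrite unmag1; apply.
  by rewrite qreprK Magnus1.
have Pv v : P (gr_gen k (raag_gen E v)).
  have := @unmag_unique n (qrepr (Magnus (gr_gen k (raag_gen E v)) n)) (1 + pc_gen E k v).
  rewrite unmagD unmag1 unmag_pc_gen (addrC 1 (_ - 1)) subrK; apply.
  by rewrite qreprK Magnus_gen magnus_raag_gen qpiD.
(* Modulo I^n the lift [b'] is a left inverse of [a'], hence of [a], and so agrees with the inverse
   [b] of [a]. *)
have Pi v : P (gr_gen k (raag_gen E v)^-1%g).
  move: (Pv v); rewrite /P.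
  set a := gr_gen k (raag_gen E v); set b := gr_gen k _ => Pa.
  have ab : a * b = 1 by rewrite /a /b -gr_genM mulgV.
  have ba : b * a = 1 by rewrite /a /b -gr_genM mulVg.
  have h : ideal_pow (aug_ideal kA) n (unmag (qrepr (Magnus b n) * qrepr (Magnus a n)) - 1).
    rewrite -[X in _ - X]unmag1; apply: unmag_unique.
    by rewrite qpiM !qreprK -[_ * _]/((Magnus b * Magnus a) n) -MagnusM ba Magnus1 qpi1.
  rewrite unmagM in h; move: (unmag _) (unmag _) Pa h => b' a' Pa h.
  have -> : b' - b = ((b' * a' - 1) - b' * (a' - a)) * b.
    by rewrite mulrBr opprB [in RHS]addrC subrKA mulrBl mul1r -mulrA ab mulr1.
  apply: idealMr; apply: idealB; first exact: h.
  by apply: idealMl; exact: Pa.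
move: (P) P1 PM Pv Pi => {}P P1 PM Pv Pi.
elim/raag_ind: g => [|v x IH|v x IH]; first exact: P1.
  by rewrite gr_genM; apply: PM; [exact: Pv|].
by rewrite gr_genM; apply: PM; [exact: Pi|].
Qed.

Lemma Magnus_eq0 n x : Magnus x n = 0 <-> ideal_pow (aug_ideal kA) n x.
Proof.
split=> [x0|]; last exact: Magnus_ideal_pow0.
have /MagnusK : qpi (ideal_pow (aug_ideal R) n) 0 = Magnus x n by rewrite x0 qpi0.
by rewrite unmag0 sub0r => /idealN; rewrite opprK.
Qed.

(** [Magnus] turns [unmag r] back into [r], which gives the direct implication. It allows powers of
    the augmentation ideal of kA to be tested on polynomials in R. *)
Lemma unmag_ideal_powP n r : ideal_pow (aug_ideal kA) n (unmag r) <-> ideal_pow (aug_ideal R) n r.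
Proof.
split=> [|]; last exact: unmag_ideal_pow.
move/Magnus_ideal_pow0; rewrite unmagK /= -qpi0 => /qpiP.
by rewrite subr0.
Qed.

Lemma dimension_subgroup_magnus n :
  dimension_subgroup (ideal_pow (aug_ideal kA) n) (@regular_rep k A)
    = dimension_subgroup (compl_filtration (A := R) n) magnus.
Proof.
apply/predeqP => g; rewrite /dimension_subgroup /= -Magnus_eq0 MagnusB Magnus1 Magnus_gen.
by split=> [|/compl_filtrationE]; [move=> h; apply/compl_filtrationE|].
Qed.

(** A priori the power of the ideal is smaller than its closure. But mu(g) - 1 is the image of g -
    1, and once g - 1 lies in the n-th power in kA its image lies in the power itself. *)
Lemma dimension_subgroup_magnus_pow n :
  dimension_subgroup (ideal_pow (aug_ideal Rbar) n) magnus
    = dimension_subgroup (compl_filtration (A := R) n) magnus.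
Proof.
apply/predeqP => g; split=> [/ideal_pow_compl|].
  by move=> h; apply/compl_filtrationE.
rewrite -dimension_subgroup_magnus => /Magnus_ideal_pow.
by rewrite MagnusB Magnus1 Magnus_gen.
Qed.

Fact compl_Magnus_transition (x : completion kA) m n : (m <= n)%N ->
  transition m (Magnus (qrepr (x n)) n) = Magnus (qrepr (x m)) m.
Proof.
move=> mn; rewrite componentP //; apply/eqP; rewrite -subr_eq0.
have -> : Magnus (qrepr (x n)) m - Magnus (qrepr (x m)) m
    = Magnus (qrepr (x n) - qrepr (x m)) m by rewrite MagnusB.
by apply/eqP/Magnus_ideal_pow0/qpiP; rewrite qreprK completion_repr.
Qed.

Definition compl_Magnus (x : completion kA) : Rbar := Completion (compl_Magnus_transition x).

Lemma compl_MagnusE (x : completion kA) n a : qpi _ a = x n -> compl_Magnus x n = Magnus a n.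
Proof.
move=> ax; apply/eqP; rewrite -subr_eq0 /=.
have -> : Magnus (qrepr (x n)) n - Magnus a n = Magnus (qrepr (x n) - a) n by rewrite MagnusB.
by apply/eqP/Magnus_ideal_pow0/qpiP; rewrite qreprK.
Qed.

Fact compl_Magnus_linear : linear compl_Magnus.
Proof.
move=> c x y; apply: completionP => n.
rewrite (@compl_MagnusE _ _ (c *: qrepr (x n) + qrepr (y n))) ;
  last by rewrite qpiD qpiZ !qreprK.
by rewrite MagnusD MagnusZ.
Qed.
HB.instance Definition _ :=
  GRing.isLinear.Build k (completion kA) Rbar *:%R compl_Magnus compl_Magnus_linear.

Fact compl_Magnus_monoid : monoid_morphism compl_Magnus.
Proof.
split=> [|x y]; apply: completionP => n.
  by rewrite (@compl_MagnusE _ _ 1) ?Magnus1.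
rewrite (@compl_MagnusE _ _ (qrepr (x n) * qrepr (y n))) ;
  last by rewrite qpiM !qreprK.
by rewrite MagnusM.
Qed.
HB.instance Definition _ :=
  GRing.isMonoidMorphism.Build (completion kA) Rbar compl_Magnus compl_Magnus_monoid.

Lemma compl_Magnus_eq0 (x : completion kA) n : compl_Magnus x n = 0 <-> x n = 0.
Proof.
rewrite /= Magnus_eq0 -{2}[x n]qreprK -qpi0.
by split=> [h|/qpiP]; [apply/qpiP|]; rewrite subr0.
Qed.

Fact compl_unmag_transition (y : Rbar) m n : (m <= n)%N ->
  transition m (qpi (ideal_pow (aug_ideal kA) n) (unmag (qrepr (y n)))) =
  qpi (ideal_pow (aug_ideal kA) m) (unmag (qrepr (y m))).
Proof.
move=> mn; rewrite transition_pi //; apply/qpiP; apply: unmag_unique.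
by rewrite qreprK completion_repr.
Qed.
Definition compl_unmag (y : Rbar) : completion kA := Completion (compl_unmag_transition y).

Lemma compl_unmagK : cancel compl_unmag compl_Magnus.
Proof.
move=> y; apply: completionP => n.
by rewrite (@compl_MagnusE _ _ (unmag (qrepr (y n)))) // unmagK /= qreprK.
Qed.

Lemma compl_Magnus_bij : bijective compl_Magnus.
Proof.
exists compl_unmag; last exact: compl_unmagK.
move=> x; apply/eqP; rewrite -subr_eq0; apply/eqP/completionP => n.
(* The right inverse is also a left inverse, because the kernel is trivial in each degree by
   [compl_Magnus_eq0]. *)
have h : compl_Magnus (compl_unmag (compl_Magnus x) - x) = 0.
  rewrite (raddfB compl_Magnus); apply/eqP; rewrite subr_eq0; apply/eqP.
  exact: compl_unmagK.
transitivity (0 : quotient_alg (ideal_pow (aug_ideal kA) n)); last by rewrite -qpi0.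
by apply/compl_Magnus_eq0; rewrite h; exact: qpi0.
Qed.

Lemma compl_Magnus_filtration n :
  compl_Magnus @` compl_filtration (A := kA) n = compl_filtration (A := R) n.
Proof.
apply/predeqP => y; split=> [[x /compl_filtrationE x0 <-]|/compl_filtrationE y0].
  by apply/compl_filtrationE/compl_Magnus_eq0.
exists (compl_unmag y); last exact: compl_unmagK.
by apply/compl_filtrationE/compl_Magnus_eq0; rewrite compl_unmagK.
Qed.

End MagnusMap.

(** * Central series and dimension subgroups *)

Section Subgroups.
Variable G : groupType.
Local Open Scope group_scope.
Implicit Types (H K S : set G) (x y : G).

Definition conj_closed H := forall x y, H x -> H (x ^ y).

Lemma subgroup1 H : subgroup_axiom H -> H 1.
Proof. by case. Qed.
Lemma subgroupV H x : subgroup_axiom H -> H x -> H x^-1.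
Proof. by case=> H1 HF Hx; rewrite -[x^-1]mul1g; apply: HF. Qed.
Lemma subgroupM H x y : subgroup_axiom H -> H x -> H y -> H (x * y).
Proof. by move=> sH Hx Hy; rewrite -[y]invgK; apply: sH.2 => //; apply: subgroupV. Qed.
Lemma subgroupX H x n : subgroup_axiom H -> H x -> H (x ^+ n).
Proof.
move=> sH Hx; elim: n => [|n IH]; first exact: subgroup1.
by rewrite expgS; apply: subgroupM.
Qed.
Lemma subgroup_gen_axiom S : subgroup_axiom (subgroup_gen S).
Proof.
split=> [H [[H1 _] _] //|x y Sx Sy H [sH SH]].
by apply: sH.2; [apply: Sx|apply: Sy].
Qed.

Lemma subgroup_gen_min S H : subgroup_axiom H -> S `<=` H -> subgroup_gen S `<=` H.
Proof. by move=> sH SH; apply: smallest_sub. Qed.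

Lemma subgroup_gen_incl S : S `<=` subgroup_gen S.
Proof. exact: sub_gen_smallest. Qed.

Lemma subgroup_gen_mono S1 S2 : S1 `<=` S2 -> subgroup_gen S1 `<=` subgroup_gen S2.
Proof.
move=> S12; apply: subgroup_gen_min; first exact: subgroup_gen_axiom.
exact: subset_trans (@subgroup_gen_incl _).
Qed.

Lemma subgroup_gen_conj S : conj_closed S -> conj_closed (subgroup_gen S).
Proof.
move=> cS x y Sx; have : subgroup_gen S `<=` [set z | subgroup_gen S (z ^ y)].
  apply: subgroup_gen_min; last by move=> z Sz; apply: subgroup_gen_incl; apply: cS.
  split=> [|u v Hu Hv]; rewrite /mkset.
    by rewrite conj1g; exact: (subgroup1 (subgroup_gen_axiom _)).
  rewrite conjMg conjVg; apply: (subgroupM (subgroup_gen_axiom S) Hu).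
  exact: (subgroupV (subgroup_gen_axiom S) Hv).
exact.
Qed.

Lemma commutator_axiom H K : subgroup_axiom (commutator H K).
Proof. exact: subgroup_gen_axiom. Qed.

Lemma commutator_incl H x y : H x -> commutator H [set: G] [~ x, y].
Proof. by move=> Hx; apply: subgroup_gen_incl; exists x => //; exists y. Qed.

Lemma commutator_conj H : conj_closed H -> conj_closed (commutator H [set: G]).
Proof.
move=> cH; apply: subgroup_gen_conj => _ z [x Hx [y _ <-]].
by rewrite conjRg; exists (x ^ z); [exact: cH|exists (y ^ z)].
Qed.

Lemma commutator_mono H K : H `<=` K -> commutator H [set: G] `<=` commutator K [set: G].
Proof.
move=> HK; apply: subgroup_gen_mono => _ [x Hx [y _ <-]].
by exists x; [exact: HK|exists y].
Qed.

Lemma subgroup_pow_conj H q : conj_closed H -> conj_closed (subgroup_pow H q).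
Proof.
move=> cH; apply: subgroup_gen_conj => _ z [x Hx <-].
by rewrite conjXg; exists (x ^ z) => //; apply: cH.
Qed.

Lemma subgroup_pow_mono H K q : H `<=` K -> subgroup_pow H q `<=` subgroup_pow K q.
Proof. by move=> HK; apply: subgroup_gen_mono => _ [x Hx <-]; exists x => //; apply: HK. Qed.

Lemma subgroup_mul H K : subgroup_axiom H -> subgroup_axiom K -> conj_closed K ->
  subgroup_axiom [set x * y | x in H & y in K].
Proof.
move=> sH sK cK; split.
  by exists 1; [exact: subgroup1|exists 1; [exact: subgroup1|rewrite mulg1]].
move=> _ _ [x Hx [y Ky <-]] [x' Hx' [y' Ky' <-]].
exists (x * x'^-1); first exact: sH.2.
exists ((y * y'^-1) ^ x'^-1); first by apply: cK; apply: sK.2.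
by rewrite /conjg invgK invgM !mulgA mulgVK.
Qed.

Lemma conj_closed_mul H K : conj_closed H -> conj_closed K ->
  conj_closed [set x * y | x in H & y in K].
Proof.
move=> cH cK _ z [x Hx [y Ky <-]]; rewrite conjMg.
by exists (x ^ z); [exact: cH|exists (y ^ z) => //; exact: cK].
Qed.

Lemma gamma_subgroup n : subgroup_axiom (@gamma G n).
Proof. by case: n => [|[|n]] //; apply: commutator_axiom. Qed.

Lemma gamma_conj n : conj_closed (@gamma G n).
Proof. by elim: n => [|[|n] IH] //; apply: commutator_conj. Qed.

Lemma gamma_commg n x y : gamma n x -> @gamma G n.+1 [~ x, y].
Proof. by case: n => [|n] // xn; apply: commutator_incl. Qed.

Section GammaP.
Variables (p : nat) (p_gt1 : (1 < p)%N).

(** Both are proved together: the set product in [gammapE] is a subgroup because its second factor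
    is normal, which needs normality at a smaller index. *)
Lemma gammap_normal n : subgroup_axiom (@gammap G p n) /\ conj_closed (@gammap G p n).
Proof.
elim/ltn_ind: n => n IH; have [n1|n1] := leqP n 1; first by case: n n1 {IH} => [|[|]].
rewrite gammapE //; set m := (_ %/ _)%N.
have mn : (m < n)%N by rewrite ltn_divLR; nia.
have nn : (n.-1 < n)%N by lia.
have [s1 c1] := IH _ nn; have [s2 c2] := IH _ mn; split.
  apply: subgroup_mul; [exact: commutator_axiom|exact: subgroup_gen_axiom|].
  exact: subgroup_pow_conj.
by apply: conj_closed_mul; [exact: commutator_conj|exact: subgroup_pow_conj].
Qed.

Lemma gammap_subgroup n : subgroup_axiom (@gammap G p n).
Proof. by have [] := gammap_normal n. Qed.
Lemma gammap_conj n : conj_closed (@gammap G p n).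
Proof. by have [] := gammap_normal n. Qed.

Lemma gammap_leq m n : (m <= n)%N -> gammap p n `<=` @gammap G p m.
Proof.
elim/ltn_ind: n m => n IH m mn; have [m1|m1] := leqP m 1; first by case: m m1 {mn} => [|[|]].
have n1 : (1 < n)%N by apply: leq_trans mn.
rewrite (gammapE _ p_gt1 m1) (gammapE _ p_gt1 n1) => _ [x xn [y yn <-]].
exists x; first by apply: commutator_mono xn; apply: IH; lia.
exists y => //; apply: subgroup_pow_mono yn; apply: IH; last by apply: leq_div2r; lia.
by rewrite ltn_divLR; nia.
Qed.

Lemma gammap_commg n x y : gammap p n x -> @gammap G p n.+1 [~ x, y].
Proof.
case: n => [|n] // xn; rewrite gammapE //; exists [~ x, y]; first exact: commutator_incl.
by exists 1; [exact: (subgroup1 (subgroup_gen_axiom _))|rewrite mulg1].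
Qed.

Lemma gammap_expg m n x : (n <= p * m)%N -> gammap p m x -> @gammap G p n (x ^+ p).
Proof.
move=> nm xm; have [n1|n1] := leqP n 1; first by case: n n1 {nm} => [|[|]].
rewrite gammapE //; exists 1; first exact: (subgroup1 (commutator_axiom _ _)).
exists (x ^+ p); last by rewrite mul1g.
apply: subgroup_gen_incl; exists x => //; apply: gammap_leq xm.
rewrite -ltnS ltn_divLR; nia.
Qed.

(** An induction principle in which the rounded index is replaced by all [m] with n <= p m; the
    bound m < n is there for strong induction. *)
Lemma gammap_min n H : subgroup_axiom H -> (1 < n)%N ->
  (forall x y, gammap p n.-1 x -> H [~ x, y]) ->
  (forall m x, (n <= p * m)%N -> (m < n)%N -> gammap p m x -> H (x ^+ p)) ->
  @gammap G p n `<=` H.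
Proof.
move=> sH n1 HC HX; rewrite gammapE // => _ [x xC [y yX <-]].
apply: subgroupM => //.
  by apply: (subgroup_gen_min sH) xC => _ [u un [v _ <-]]; apply: HC.
apply: (subgroup_gen_min sH) yX => _ [u un <-]; apply: HX un.
  have := leq_divM (n + p.-1) p. have := ltn_ceil (n + p.-1) (ltnW p_gt1); nia.
by rewrite ltn_divLR; nia.
Qed.
End GammaP.
End Subgroups.

Section Morphisms.
Variables (G H : groupType) (f : UMagmaMorphism.type G H).
Local Open Scope group_scope.

Lemma subgroup_preim (K : set H) : subgroup_axiom K -> subgroup_axiom [set x | K (f x)].
Proof.
move=> sK; split=> [|x y Kx Ky]; rewrite /mkset; first by rewrite gmulf1; apply: subgroup1.
by rewrite gmulfF; apply: sK.2.
Qed.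

Lemma gammap_morph p n x : (1 < p)%N -> gammap p n x -> gammap p n (f x).
Proof.
move=> p1; elim/ltn_ind: n x => n IH; have [n1|n1] := leqP n 1; first by case: n n1 {IH} => [|[|]].
apply: (gammap_min p1) => //=.
- exact/subgroup_preim/gammap_subgroup.
- move=> x y xn; rewrite /mkset gmulfR; have nn : (n.-1 < n)%N by lia.
  by have := gammap_commg p1 (f y) (IH _ nn x xn); rewrite prednK //; lia.
- move=> m x nm mn xm; rewrite /mkset gmulfXn; apply: (gammap_expg p1 nm).
  exact: IH.
Qed.
End Morphisms.

Lemma commrB1_sub (A : pzRingType) (x y : A) :
  (x - 1) * (y - 1) - (y - 1) * (x - 1) = x * y - y * x.
Proof.
have E (u v : A) : (u - 1) * (v - 1) = u * v - (u + v) + 1.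
  by rewrite mulrBl mul1r mulrBr mulr1 opprB opprD !addrA (addrAC (_ - u)).
by rewrite !E (addrC y x); move: (x + y) => s; rewrite [- (_ + 1)]opprD addrACA subrr addr0 opprB addrA subrK.
Qed.

(** * Differences g - 1 in a group ring *)

Section GroupRingDifferences.
Variables (k : comNzRingType) (G : groupType).
Local Notation kG := (group_ring k G).
Local Notation I := (ideal_pow (aug_ideal kG)).

Definition gdif (g : G) : kG := gr_gen k g - 1.

Definition gdelta n : set G := [set g | I n (gdif g)].

Lemma gdeltaE n : gdelta n = dimension_subgroup (I n) (@regular_rep k G).
Proof. by []. Qed.

Lemma gr_gdif g : gr_gen k g = 1 + gdif g.
Proof. by rewrite /gdif addrC subrK. Qed.

Lemma gdif1 : gdif 1%g = 0.
Proof. by rewrite /gdif subrr. Qed.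

Lemma gdifM g h : gdif (g * h)%g = gdif g + gdif h + gdif g * gdif h.
Proof.
rewrite {1}/gdif gr_genM !gr_gdif; move: (gdif g) (gdif h) => x y.
by rewrite mulrDl mul1r mulrDr mulr1 addrAC (addrC 1 y) addrK addrA (addrC y).
Qed.

Lemma aug_gdif g : aug (gdif g) = 0.
Proof. by rewrite augB aug_gen aug1 subrr. Qed.

Lemma gdif_pow1 g : I 1 (gdif g).
Proof. by apply: ideal_pow1; apply: aug_gdif. Qed.

Lemma gdifV g : gdif g^-1%g = - (gdif g * gr_gen k g^-1%g).
Proof. by rewrite /gdif mulrBl mul1r -gr_genM mulgV opprB. Qed.

Lemma gdelta_subgroup n : subgroup_axiom (gdelta n).
Proof.
split=> [|g h gn hn]; rewrite /gdelta /mkset; first by rewrite gdif1; apply: ideal0.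
rewrite gdifM gdifV mulrN; apply: idealB; last by apply: idealMr.
by apply: idealB => //; apply: idealMr.
Qed.

Lemma gdelta_leq m n : (m <= n)%N -> gdelta n `<=` gdelta m.
Proof. by move=> mn g; apply: ideal_pow_leq. Qed.

Lemma gdifM_congr m n g h : gdelta m g -> gdelta n h ->
  I (m + n)%N (gdif (g * h)%g - (gdif g + gdif h)).
Proof. by move=> gm hn; rewrite gdifM addrAC subrr add0r; apply: ideal_powM. Qed.

(** This is gh = hg[g, h], for the convention [g, h] = g^-1 h^-1 g h. *)
Lemma gdif_comm g h :
  gdif g * gdif h - gdif h * gdif g = gr_gen k (h * g)%g * gdif [~ g, h]%g.
Proof.
rewrite /gdif [RHS]mulrBr mulr1 -gr_genM -commgC !gr_genM; exact: commrB1_sub.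
Qed.

(** The leading term of a group commutator is the ring commutator of the leading terms: the factor
    hg in [gdif_comm] is congruent to 1 modulo I. *)
Lemma gdif_commg m n g h : gdelta m g -> gdelta n h ->
  I (m + n).+1 (gdif [~ g, h]%g - (gdif g * gdif h - gdif h * gdif g)).
Proof.
move=> gm hn; set c := gdif [~ g, h]%g; set u := gr_gen k (h * g)%g.
have uc : I (m + n)%N (u * c).
  by rewrite -gdif_comm; apply: idealB; [|rewrite addnC]; apply: ideal_powM.
have cI : I (m + n)%N c.
  have -> : c = gr_gen k (h * g)^-1%g * (u * c) by rewrite mulrA -gr_genM mulVg mul1r.
  exact: idealMl.
rewrite gdif_comm -/c /u gr_gdif mulrDl mul1r opprD addrA subrr add0r.
by apply: idealN; rewrite -addn1 addnC; apply: ideal_powM => //; apply: gdif_pow1.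
Qed.

Lemma gdelta_commg m n g h : gdelta m g -> gdelta n h -> gdelta (m + n)%N [~ g, h]%g.
Proof.
move=> gm hn; have /(ideal_pow_leq (leqnSn _)) c := gdif_commg gm hn.
rewrite /gdelta /mkset -[gdif _](subrK (gdif g * gdif h - gdif h * gdif g)).
by apply: idealD => //; apply: idealB; [|rewrite addnC]; apply: ideal_powM.
Qed.

Lemma gdelta1 g : gdelta 1 g.
Proof. exact: gdif_pow1. Qed.

Lemma gamma_gdelta n : gamma n `<=` gdelta n.
Proof.
elim: n => [//|[|n] IH]; first by move=> g _; apply: gdelta1.
apply: subgroup_gen_min; first exact: gdelta_subgroup.
by move=> _ [x xn [y _ <-]]; rewrite -addn1; apply: gdelta_commg (gdelta1 y); apply: IH.
Qed.

Section CharP.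
Variables (p : nat) (charkp : p \in [pchar k]).

Lemma pchar_group_ring : p \in [pchar kG].
Proof.
rewrite !inE (pcharf_prime charkp) /=.
have -> : p%:R = (p%:R : k) *: (1 : kG) by rewrite scaler_nat.
by rewrite (pcharf0 charkp) scale0r.
Qed.

Lemma gdifX g : gdif (g ^+ p)%g = gdif g ^+ p.
Proof.
have E n : gr_gen k (g ^+ n)%g = gr_gen k g ^+ n.
  by elim: n => [|n IH]; rewrite ?expr0 // expgS gr_genM IH exprS.
rewrite /gdif E; have := pFrobenius_autB_comm pchar_group_ring (commr1 (gr_gen k g)).
by rewrite !pFrobenius_autE expr1n.
Qed.

Lemma gammap_gdelta n : gammap p n `<=` gdelta n.
Proof.
have p1 : (1 < p)%N by apply/prime_gt1/pcharf_prime/charkp.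
elim/ltn_ind: n => n IH; have [n1|n1] := leqP n 1.
  by move=> g _; apply: (gdelta_leq n1); apply: gdelta1.
apply: (gammap_min p1) => //; first exact: gdelta_subgroup.
  move=> x y xn; rewrite -[n]prednK; last by lia.
  by rewrite -addn1; apply: gdelta_commg (gdelta1 y); apply: IH xn; lia.
move=> m x nm mn xm; rewrite /gdelta /mkset gdifX mulnC in nm *.
by apply: (ideal_pow_leq nm); apply: ideal_pow_exp; apply: IH.
Qed.
End CharP.
End GroupRingDifferences.

Section GroupRingMap.
Variables (k : comNzRingType) (G H : groupType) (f : UMagmaMorphism.type G H).

Fact rep_comp_mul : {morph (fun g => regular_rep k (f g)) : x y / (x * y)%g}.
Proof. by move=> x y; rewrite gmulfM regular_repM. Qed.
Fact rep_comp1 : regular_rep k (f 1%g) = 1%g.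
Proof. by rewrite gmulf1; apply: uval_inj. Qed.

Definition rep_comp := fun g => regular_rep k (f g).
HB.instance Definition _ := monoid.isMultiplicative.Build G (units (group_ring k H)) rep_comp rep_comp_mul.
HB.instance Definition _ :=
  monoid.Multiplicative_isUMagmaMorphism.Build G (units (group_ring k H)) rep_comp rep_comp1.

Lemma gdelta_morph n g : gdelta k n g -> gdelta k n (f g).
Proof.
have [F FE] := gr_lift_exists rep_comp.
have Faug x : aug (F x) = aug x.
  elim/gr_ind: x => [|x y IHx IHy|c x IH|h].
  - by rewrite (raddf0 F) !aug0.
  - by rewrite (raddfD F) /= !augD IHx IHy.
  - by rewrite linearZ /= !augZ IH.
  - by rewrite FE !aug_gen.
rewrite /gdelta /mkset; have -> : gdif k (f g) = F (gdif k g).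
  by rewrite /gdif (raddfB F) /= FE rmorph1.
by apply: ideal_pow_map => x; rewrite /= /mkset Faug.
Qed.
End GroupRingMap.

(** * Jennings' theorem for finitely generated groups *)

Definition subspace_axiom (k : pzRingType) (X : lmodType k) (U : set X) : Prop :=
  [/\ U 0, forall x y, U x -> U y -> U (x + y) & forall c x, U x -> U (c *: x)].

(** By Zorn's lemma some subspace M containing U is maximal among those avoiding u. Then each x has
    a unique c with x - c u in M, and phi x is this c. *)
Lemma separating_form (k : fieldType) (X : lmodType k) (U : set X) (u : X) :
  subspace_axiom U -> ~ U u ->
  exists phi : X -> k, [/\ scalar phi, forall x, U x -> phi x = 0 & phi u = 1].
Proof.
move=> [U0 UD UZ] Uu.
(* The subspace is the union of W and U rather than W itself, so that the empty set, the union of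
   the empty chain, satisfies [P]. *)
pose P (W : set X) := subspace_axiom (W `|` U) /\ ~ W u.
have [F FP totF|W [[[W0 WD WZ] Wu] Wmax]] := @Zorn_bigcup X P.
  split; last by move=> [Y FY Yu]; have [_] := FP _ FY; apply.
  split; first by right.
    move=> x y [[Y FY Yx]|Ux] [[Z FZ Zy]|Uy].
    - have [YZ|ZY] := totF _ _ FY FZ.
        have [[_ h _] _] := FP _ FZ.
        by case: (h x y (or_introl (YZ _ Yx)) (or_introl Zy)) => ?; [left; exists Z|right].
      have [[_ h _] _] := FP _ FY.
      by case: (h x y (or_introl Yx) (or_introl (ZY _ Zy))) => ?; [left; exists Y|right].
    - have [[_ h _] _] := FP _ FY.
      by case: (h x y (or_introl Yx) (or_intror Uy)) => ?; [left; exists Y|right].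
    - have [[_ h _] _] := FP _ FZ.
      by case: (h x y (or_intror Ux) (or_introl Zy)) => ?; [left; exists Z|right].
    - by right; apply: UD.
  move=> c x [[Y FY Yx]|Ux]; last by right; apply: UZ.
  have [[_ _ h] _] := FP _ FY.
  by case: (h c x (or_introl Yx)) => ?; [left; exists Y|right].
set M := W `|` U in W0 WD WZ.
have Mu : ~ M u by case.
have MB x y : M x -> M y -> M (x - y).
  by move=> Mx My; apply: WD => //; rewrite -scaleN1r; apply: WZ.
have ex x : exists c, M (x - c *: u).
  case: (pselect (M x)) => [Mx|Mx]; first by exists 0; rewrite scale0r subr0.
  pose B := [set y | exists2 m, M m & exists c, y = m + c *: x].
  have MB' : M `<=` B by move=> m Mm; exists m => //; exists 0; rewrite scale0r addr0.
  have WB : W `<` B.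
    split; first by move=> y Wy; apply: MB'; left.
    move=> BW; apply: Mx; left; apply: BW; exists 0 => //.
    by exists 1; rewrite scale1r add0r.
  have BU : B `|` U = B.
    by apply/predeqP => y; split=> [[//|Uy]|]; [apply: MB'; right|left].
  (* [B] is the subspace spanned by M and x. It violates [P] by maximality, and can do so only by
     containing u. *)
  case: (pselect (B u)) => [[m Mm [c uE]]|Bu]; last first.
    case: (Wmax _ WB); split=> //; rewrite BU; split.
    - exact: MB'.
    - move=> _ _ [m Mm [c ->]] [m' Mm' [c' ->]]; exists (m + m'); first exact: WD.
      by exists (c + c'); rewrite scalerDl addrACA.
    - move=> d _ [m Mm [c ->]]; exists (d *: m); first exact: WZ.
      by exists (d * c); rewrite scalerDr scalerA.
  have [c0|c0] := eqVneq c 0; first by case: Mu; rewrite uE c0 scale0r addr0.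
  exists c^-1; rewrite {1}uE scalerDr scalerA mulVf // scale1r opprD addrC subrK.
  by rewrite -scaleN1r; apply/WZ/WZ.
pose phi x := projT1 (cid (ex x)).
have phiP x : M (x - phi x *: u) by rewrite /phi; case: (cid _).
have phiE x c : M (x - c *: u) -> phi x = c.
  move=> Mc; have := MB _ _ Mc (phiP x); rewrite opprB addrC subrKA -scalerBl => Md.
  apply/eqP; rewrite -subr_eq0; apply/negPn/negP => d0; case: Mu.
  by rewrite -[u]scale1r -(mulVf d0) -scalerA; apply: WZ.
exists phi; split.
- move=> c x y; apply: phiE.
  have -> : c *: x + y - (c * phi x + phi y) *: u
      = c *: (x - phi x *: u) + (y - phi y *: u).
    by rewrite scalerDl -scalerA scalerBr opprD addrACA.
  by apply: WD; [apply: WZ|].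
- by move=> x Ux; apply: phiE; rewrite scale0r subr0; right.
- by apply: phiE; rewrite scale1r subrr.
Qed.

Lemma linear_add (k : comNzRingType) (X Y : lmodType k) (f g : X -> Y) :
  linear f -> linear g -> linear (fun x => f x + g x).
Proof. by move=> lf lg c x y; rewrite lf lg scalerDr addrACA. Qed.

Lemma linear_mulr (k : comNzRingType) (X : lmodType k) (Y : algType k) (f : X -> Y) b :
  linear f -> linear (fun x => f x * b).
Proof. by move=> lf c x y; rewrite lf mulrDl -scalerAl. Qed.

Lemma gr_linear_ext (k : comNzRingType) (G : groupType) (X : lmodType k)
  (F1 F2 : group_ring k G -> X) : linear F1 -> linear F2 ->
  (forall g, F1 (gr_gen k g) = F2 (gr_gen k g)) -> forall x, F1 x = F2 x.
Proof.
move=> l1 l2 E; have h0 (F : group_ring k G -> X) : linear F -> F 0 = 0.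
  by move=> lF; have := lF (- 1) 0 0; rewrite scaler0 add0r scaleN1r addNr.
elim/gr_ind => [|x y IHx IHy|c x IH|//]; first by rewrite !h0.
- by rewrite -[x]scale1r l1 l2 IHx IHy.
- by rewrite -[c *: x]addr0 l1 l2 IH !h0.
Qed.

Lemma scaler_telescope (k : pzRingType) (X : lmodType k) (c d : k) (u v : X) :
  c *: u - d *: v = d *: (u - v) + (c - d) *: u.
Proof. by rewrite scalerBr scalerBl [RHS]addrC subrKA. Qed.

(** * Contractions of the coproduct of a group ring *)

Section CoproductOperator.
Variables (k : comNzRingType) (G : groupType).
Local Notation kG := (group_ring k G).
Local Notation I := (ideal_pow (aug_ideal kG)).
Local Notation dif := (@gdif k G).

(** The elements y (g - 1) with y in I^n generate I^(n+1) additively. Their additive span, encoded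
    by [Z] as an intersection, is a right ideal because y (g - 1) h = y (gh - 1) - y (h - 1). *)
Lemma ideal_pow_aug_ind n (P : kG -> Prop) :
  P 0 -> (forall x y, P x -> P y -> P (x + y)) ->
  (forall y g, I n y -> P (y * dif g)) -> forall x, I n.+1 x -> P x.
Proof.
move=> P0 PD PM.
pose Z x := forall Q : kG -> Prop, Q 0 -> (forall x y, Q x -> Q y -> Q (x + y)) ->
  (forall y g, I n y -> Q (y * dif g)) -> Q x.
have Zi x : Z x -> forall Q : kG -> Prop, Q 0 -> (forall x y, Q x -> Q y -> Q (x + y)) ->
  (forall y g, I n y -> Q (y * dif g)) -> Q x by move=> h; exact: h.
have Z0 : Z 0 by [].
have ZD x y : Z x -> Z y -> Z (x + y) by move=> Zx Zy Q Q0 QD QM; exact: (QD _ _ (Zx Q Q0 QD QM) (Zy Q Q0 QD QM)).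
have ZM y g : I n y -> Z (y * dif g) by move=> yI Q Q0 QD QM; apply: QM.
have ZMl a x : Z x -> Z (a * x).
  move=> /Zi /(_ (fun x => Z (a * x))); apply => [|u v Zu Zv|y g yI]; first by rewrite mulr0.
    by rewrite mulrDr; apply: ZD.
  by rewrite mulrA; apply: ZM; apply: idealMl.
have ZZ c x : Z x -> Z (c *: x) by move=> /(ZMl c%:A); rewrite -scalerAl mul1r.
have ZN x : Z x -> Z (- x) by move=> /(ZZ (- 1)); rewrite scaleN1r.
have ZMr x a : Z x -> Z (x * a).
  move=> /Zi /(_ (fun x => Z (x * a))); apply => [|u v Zu Zv|y g yI]; first by rewrite mul0r.
    by rewrite mulrDl; apply: ZD.
  elim/gr_ind: a => [|a b Za Zb|c a Za|h]; first by rewrite mulr0.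
  - by rewrite mulrDr; apply: ZD.
  - by rewrite -scalerAr; apply: ZZ.
  have -> : y * dif g * gr_gen k h = y * dif (g * h)%g - y * dif h.
    rewrite -mulrA -mulrBr /gdif gr_genM opprB addrA subrK.
    by rewrite mulrBl mul1r.
  exact: (ZD _ _ (ZM _ _ yI) (ZN _ (ZM _ _ yI))).
have Zax : ideal_axiom (Z : set kG).
  split=> [|x y Zx Zy|a x|a x]; [exact: Z0| |exact: ZMl|exact: ZMr].
  exact: (ZD _ _ Zx (ZN _ Zy)).
move=> x xI; suff Zx : Z x by exact: (Zx P P0 PD PM).
suff h : I n.+1 `<=` Ideal Zax by exact: (h x xI).
apply: ideal_gen_sub => _ [u uI [v v0 <-]]; change (Z (u * v)).
(* The new form is linear in [v] and equals h - 1 at a group element h, so that induction on [v]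
   becomes possible. *)
have {v0} -> : v = v - aug v *: 1 by rewrite v0 scale0r subr0.
elim/gr_ind: v => [|a b Za Zb|c a Za|h].
- by rewrite aug0 scale0r subr0 mulr0.
- rewrite (augD a b) (scalerDl (1 : kG)) opprD addrACA (mulrDr u).
  exact: (ZD _ _ Za Zb).
- by rewrite augZ -scalerA -scalerBr -scalerAr; apply: ZZ.
- by rewrite aug_gen scale1r; apply: ZM.
Qed.

Implicit Types (phi : kG -> k).

(* For the coproduct [g |-> g (x) g] of kG, this is [(phi (x) id) o Delta]. *)
Definition contract (phi : kG -> k) : kG -> kG :=
  fun x => lext (fun g => phi (gr_gen k g) *: gr_gen k g) x.

Lemma contract_gen phi g : contract phi (gr_gen k g) = phi (gr_gen k g) *: gr_gen k g.
Proof. by rewrite /contract lextU scale1r. Qed.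
Lemma contractD phi x y : contract phi (x + y) = contract phi x + contract phi y.
Proof. exact: lextD. Qed.
Lemma contractZ phi c x : contract phi (c *: x) = c *: contract phi x.
Proof. exact: lextZ. Qed.
Lemma contract0 phi : contract phi 0 = 0.
Proof. exact: lext0. Qed.
Lemma contractN phi x : contract phi (- x) = - contract phi x.
Proof. exact: lextN. Qed.
Lemma contractB phi x y : contract phi (x - y) = contract phi x - contract phi y.
Proof. by rewrite contractD contractN. Qed.
Lemma contract_zero phi x : (forall y, phi y = 0) -> contract phi x = 0.
Proof.
move=> phi0; elim/gr_ind: x => [|x y IHx IHy|c x IH|g].
- exact: contract0.
- by rewrite contractD IHx IHy addr0.
- by rewrite contractZ IH scaler0.
- by rewrite contract_gen phi0 scale0r.
Qed.

Definition translate (phi : kG -> k) (a : kG) : kG -> k := fun y => phi (y * a).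

Lemma translate_scalar phi a : scalar phi -> scalar (translate phi a).
Proof. by move=> sphi c x y; rewrite /translate mulrDl -scalerAl sphi. Qed.

Lemma scalar0 phi : scalar phi -> phi 0 = 0 :> k.
Proof. by move=> sphi; have := sphi (- 1) 0 0; rewrite scaler0 add0r mulN1r addNr. Qed.
Lemma scalarD phi : scalar phi -> forall x y : kG, phi (x + y) = phi x + phi y :> k.
Proof. by move=> sphi x y; have := sphi 1 x y; rewrite scale1r mul1r. Qed.
Lemma scalarZ phi : scalar phi -> forall c (x : kG), phi (c *: x) = c * phi x :> k.
Proof. by move=> sphi c x; have := sphi c x 0; rewrite !addr0 (scalar0 sphi) addr0. Qed.
Lemma scalarB phi : scalar phi -> forall x y : kG, phi (x - y) = phi x - phi y :> k.
Proof. by move=> sphi x y; rewrite (scalarD sphi) -scaleN1r (scalarZ sphi) mulN1r. Qed.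

(** The three terms come from Delta(g - 1) = 1 (x) (g - 1) + (g - 1) (x) 1 + (g - 1) (x) (g - 1),
    with phi applied to the first tensor factor. *)
Lemma contract_rec phi y g : scalar phi ->
  contract phi (y * dif g) = contract phi y * dif g + contract (translate phi (dif g)) y
    + contract (translate phi (dif g)) y * dif g.
Proof.
move=> sphi.
have lc psi : linear (contract psi) by apply: lext_linear.
apply: (gr_linear_ext (F1 := fun y => contract phi (y * dif g)) (F2 := fun y =>
  contract phi y * dif g + contract (translate phi (dif g)) y
    + contract (translate phi (dif g)) y * dif g)) => [||{}y].
- by move=> c u v; rewrite mulrDl -scalerAl; apply: lc.
- by apply: linear_add; [apply: linear_add|]; rewrite //; apply: linear_mulr.
have -> : contract phi (gr_gen k y) * dif g + contract (translate phi (dif g)) (gr_gen k y)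
    + contract (translate phi (dif g)) (gr_gen k y) * dif g =
  contract phi (gr_gen k y) * dif g + contract (translate phi (dif g)) (gr_gen k y) * gr_gen k g.
  have E3 (a b e h : kG) : h = 1 + e -> a * e + b + b * e = a * e + b * h.
    by move=> ->; rewrite mulrDr mulr1 addrA.
  by apply: E3; apply: gr_gdif.
have E : gr_gen k y * dif g = gr_gen k (y * g)%g - gr_gen k y.
  by rewrite /gdif mulrBr mulr1 gr_genM.
rewrite E contractB !contract_gen /translate E (scalarB sphi) -!scalerAl E -gr_genM.
exact: scaler_telescope.
Qed.

Definition kills (phi : kG -> k) n := forall x, I n x -> phi x = 0.

Lemma kills_translate phi m n a : kills phi m -> I n a -> kills (translate phi a) (m - n).
Proof.
move=> kphi aI x xI; apply: kphi; apply: (@ideal_pow_leq _ _ _ ((m - n) + n)%N); first by lia.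
exact: ideal_powM.
Qed.

(** Delta maps I^m into the sum of the I^a (x) I^(m-a), and phi annihilates the terms with a > i. *)
Lemma contract_ideal_pow m i phi y : scalar phi -> kills phi i.+1 -> I m y -> I (m - i)%N (contract phi y).
Proof.
elim: m i phi y => [//|m IH] i phi y sphi kphi.
move: y; apply: ideal_pow_aug_ind => [|x y IHx IHy|y g yI].
- by rewrite contract0; apply: ideal0.
- by rewrite contractD; apply: idealD.
rewrite contract_rec //.
have h : I (m.+1 - i)%N (contract (translate phi (dif g)) y).
  case: i kphi => [|i] kphi.
    rewrite contract_zero; first exact: ideal0.
    move=> z; apply: kphi; apply: (@ideal_powM _ _ 0 1) => //.
    exact: gdif_pow1.
  apply: (IH i) => //; first exact: translate_scalar.
  by have := kills_translate kphi (gdif_pow1 g); rewrite subn1.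
apply: idealD; last exact: idealMr.
apply: idealD => //; apply: (@ideal_pow_leq _ _ _ ((m - i) + 1)%N); first by lia.
by apply: ideal_powM; [apply: (IH i)|apply: gdif_pow1].
Qed.
End CoproductOperator.

Lemma count_filter_leq (a : pred nat) j (l : seq nat) :
  count a [seq i <- l | (j <= i)%N] = (a j * count_mem j l + count a [seq i <- l | (j < i)%N])%N.
Proof.
rewrite !count_filter; elim: l => [|y t IH] /=; first by rewrite muln0.
by rewrite IH; case: (ltngtP j y) => [_|_|->] /=; rewrite ?eqxx ?andbF ?andbT ?addn0 ?add0n //; lia.
Qed.

Lemma uniq_map_inj (T1 T2 : eqType) (f : T1 -> T2) (s : seq T1) :
  uniq (map f s) -> {in s &, injective f}.
Proof.
elim: s => //= x s IH /andP [xs us] y z; rewrite !inE.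
case/predU1P => [->|ys]; case/predU1P => [->|zs] E //; last exact: IH.
  by case/negP: xs; rewrite E map_f.
by case/negP: xs; rewrite -E map_f.
Qed.

(* The combinatorial core of Jennings' theorem. The family [b] lists pairs of a weight
   [m] and a group element [g] with [g - 1] in the [m]-th power of the augmentation ideal
   [I], forming for each [m <= n] a basis of a subspace [L_m] of [I^m / I^(m+1)]
   such that the direct sum of the [L_m] is a restricted Lie algebra containing
   [I / I^2]. *)
Section Jennings.
Variables (k : fieldType) (p : nat) (charkp : p \in [pchar k]) (G : groupType).
Local Notation kG := (group_ring k G).
Local Notation I := (ideal_pow (aug_ideal kG)).
Variables (n : nat) (b : seq (nat * G)).
Local Notation r := (size b).
Local Notation x0 := (0%N, 1%g : G).
Definition jw i := (nth x0 b i).1.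
Definition je i : kG := gdif k (nth x0 b i).2.
Local Notation w := jw.
Local Notation e := je.

Definition inL m (x : kG) := exists c : nat -> k,
  I m.+1 (x - \sum_(i < r | w i == m) c i *: e i).

Hypothesis w_gt0 : forall i, (i < r)%N -> (0 < w i)%N.
Hypothesis e_pow : forall i, (i < r)%N -> I (w i) (e i).
Hypothesis e_comm : forall i j, (i < r)%N -> (j < r)%N -> (w i + w j <= n)%N ->
  inL (w i + w j)%N (e i * e j - e j * e i).
Hypothesis e_exp : forall i, (i < r)%N -> (p * w i <= n)%N -> inL (p * w i)%N (e i ^+ p).
Hypothesis e_gen : forall g, inL 1 (gdif k g).
Hypothesis e_free : forall m (c : nat -> k), (m <= n)%N ->
  I m.+1 (\sum_(i < r | w i == m) c i *: e i) -> forall i, (i < r)%N -> w i = m -> c i = 0.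

(** The head of the list is the last factor, because [contract_rec] peels factors off on the
    right. *)
Fixpoint mon (l : seq nat) : kG := if l is i :: l' then mon l' * e i else 1.
Definition wt (l : seq nat) : nat := \sum_(i <- l) w i.

Lemma mon_cat u v : mon (u ++ v) = mon v * mon u.
Proof. by elim: u => [|i u IH] /=; rewrite ?mulr1 // IH mulrA. Qed.

Lemma wt_cons i l : wt (i :: l) = (w i + wt l)%N.
Proof. by rewrite /wt big_cons. Qed.
Lemma wt_cat u v : wt (u ++ v) = (wt u + wt v)%N.
Proof. by rewrite /wt big_cat. Qed.
Lemma wt_perm u v : perm_eq u v -> wt u = wt v.
Proof. by move=> uv; rewrite /wt; apply: perm_big. Qed.

Local Notation vld := (all (fun i => i < r)%N).

Lemma mon_pow l : vld l -> I (wt l) (mon l).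
Proof.
elim: l => [_|i l IH] /=; first by rewrite /wt big_nil.
move=> /andP [ir vl]; rewrite wt_cons addnC.
by apply: ideal_powM; [apply: IH|apply: e_pow].
Qed.

(** The value that [contract phi (mon l)] would have if each [e i] were primitive: a sum over the
    sublists l' of [l], with phi applied to [mon l'] and the remaining letters kept as factors. *)
Fixpoint cosum (l : seq nat) (phi : kG -> k) : kG :=
  if l is i :: l' then cosum l' phi * e i + cosum l' (translate phi (e i)) else phi 1 *: 1.

Lemma cosum_zero l phi : (forall y, phi y = 0) -> cosum l phi = 0.
Proof.
elim: l phi => [|i l IH] phi phi0 /=; first by rewrite phi0 scale0r.
by rewrite !IH ?mul0r ?addr0 // => y; apply: phi0.
Qed.

Lemma kills_zero phi j (i : nat) : kills phi i.+1 -> (j < r)%N -> (i < w j)%N ->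
  forall y, translate phi (e j) y = 0.
Proof.
move=> kphi jr ij y; apply: kphi; apply: idealMl.
exact: (ideal_pow_leq ij (e_pow jr)).
Qed.

(** The term of [contract_rec] absent from [cosum] uses [e j] twice, once inside phi and once as a
    factor, and lies [w j] > 0 degrees deeper. *)
Lemma contract_mon l phi i : vld l -> scalar phi -> kills phi i.+1 ->
  I ((wt l).+1 - i)%N (contract phi (mon l) - cosum l phi).
Proof.
elim: l i phi => [|j l IH] i phi /=.
  move=> _ _ _; rewrite -[1]/(gr_gen k (1%g : G)) contract_gen subrr.
  exact: ideal0.
move=> /andP [jr vl] sphi kphi; rewrite wt_cons /je contract_rec // -/(je j).
have wj := w_gt0 jr; have ej := e_pow jr.
have [ij|ij] := leqP (w j) i; last first.
  have z := kills_zero kphi jr ij.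
  rewrite (contract_zero _ z) (cosum_zero _ z) mul0r !addr0 -mulrBl.
  by apply: (ideal_pow_leq _ (ideal_powM (IH i phi vl sphi kphi) ej)); lia.
set psi := translate phi (e j).
have spsi : scalar psi by apply: translate_scalar.
have kpsi : kills psi (i - w j).+1.
  by have := kills_translate kphi ej; rewrite subSn.
set a := contract phi (mon l); set c := contract psi (mon l).
have -> : a * e j + c + c * e j - (cosum l phi * e j + cosum l psi) =
    (a - cosum l phi) * e j + (c - cosum l psi) + c * e j.
  by rewrite mulrBl opprD [in RHS]addrACA -!addrA; congr (_ + (_ + _)); rewrite addrC -addrA.
apply: idealD; first apply: idealD.
- by apply: (ideal_pow_leq _ (ideal_powM (IH i phi vl sphi kphi) ej)); lia.
- by apply: (ideal_pow_leq _ (IH _ psi vl spsi kpsi)); lia.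
- apply: (ideal_pow_leq _ (ideal_powM (contract_ideal_pow spsi kpsi (mon_pow vl)) ej)); lia.
Qed.

(** Only sublists of weight below [i] contribute, and their complements have weight above wt l -
    i. *)
Lemma cosum_vanish l psi i : vld l -> scalar psi -> kills psi i.+1 ->
  (forall l', subseq l' l -> wt l' = i -> psi (mon l') = 0) ->
  I ((wt l).+1 - i)%N (cosum l psi).
Proof.
elim: l i psi => [|j l IH] i psi /=.
  move=> _ spsi kpsi h; case: i kpsi h => [|i] kpsi h.
    rewrite (h [::]) ?scale0r //; [exact: ideal0|exact: big_nil].
  by rewrite /wt big_nil.
move=> /andP [jr vl] spsi kpsi h; rewrite wt_cons.
have wj := w_gt0 jr; have ej := e_pow jr.
have h1 : I (w j + wt l - i).+1 (cosum l psi * e j).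
  apply: (ideal_pow_leq _ (ideal_powM (IH i psi vl spsi kpsi _) ej)); first by lia.
  by move=> l' ll'; apply: h; apply: subseq_trans ll' (subseq_cons _ _).
have [ij|ij] := leqP (w j) i; last first.
  rewrite [cosum l (translate _ _)]cosum_zero ?addr0; first by apply: ideal_pow_leq h1; lia.
  exact: kills_zero kpsi jr ij.
apply: idealD; first by apply: ideal_pow_leq h1; lia.
apply: (ideal_pow_leq _ (IH (i - w j)%N _ vl (translate_scalar _ spsi) _ _)); first by lia.
  by have := kills_translate kpsi ej; rewrite subSn.
move=> l' ll' wl'; rewrite /translate; apply: (h (j :: l')); first by rewrite /= eqxx.
by rewrite wt_cons wl' subnKC.
Qed.

Lemma cosum_aug l psi : vld l -> scalar psi -> kills psi 1 -> psi 1 = 1 -> cosum l psi = mon l.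
Proof.
elim: l psi => [|j l IH] psi /=; first by move=> _ _ _ ->; rewrite scale1r.
move=> /andP [jr vl] spsi kpsi psi1; rewrite IH // cosum_zero ?addr0 //.
exact: kills_zero kpsi jr (w_gt0 jr).
Qed.

(** The shape of the Poincare-Birkhoff-Witt basis of a restricted enveloping algebra: multiplicities
    stay below p because p-th powers are again in the Lie algebra. *)
Definition std l := [&& sorted leq l, all (fun i => count_mem i l < p)%N l & vld l].

Lemma p_prime : prime p. Proof. exact: pcharf_prime charkp. Qed.

Lemma std_subseq l l' : subseq l' l -> std l -> std l'.
Proof.
move=> ll' /and3P [sl cl vl]; apply/and3P; split.
- exact: (subseq_sorted leq_trans ll').
- apply/allP => i il'; have /= := allP cl i (mem_subseq ll' il').
  by apply: leq_ltn_trans; apply: leq_count_subseq.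
- by apply/allP => i il'; apply: (allP vl); apply: (mem_subseq ll').
Qed.

(** Among the sublists of weight [w j], phi sees only [[:: j]]. It occurs [count_mem j l] times,
    always with complement [rem j l] since [l] is sorted. Sublists of smaller weight leave
    complements of weight above wt l - w j. *)
Lemma cosum_dual l phi j : std l -> (j < r)%N -> scalar phi -> kills phi (w j).+1 -> phi (e j) = 1 ->
  (forall l', std l' -> wt l' = w j -> l' != [:: j] -> phi (mon l') = 0) ->
  I ((wt l).+1 - w j)%N (cosum l phi - (count_mem j l)%:R *: mon (rem j l)).
Proof.
move=> sl jr sphi kphi phij h; elim: l sl => [|x l IH] sl /=.
  by have := w_gt0 jr; rewrite /wt big_nil; case: (w j).
have sl' : std l by apply: std_subseq sl; apply: subseq_cons.
have vl : vld l by case/and3P: sl'.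
have xr : (x < r)%N by case/and3P: sl => _ _ /= /andP [].
rewrite wt_cons; have [xj|xj] := eqVneq x j; last first.
  rewrite add0n /= addrAC scalerAl -mulrBl; apply: idealD.
    by apply: (ideal_pow_leq _ (ideal_powM (IH sl') (e_pow xr))); have := w_gt0 xr; lia.
  have [ij|ij] := leqP (w x) (w j); last first.
    rewrite cosum_zero; first exact: ideal0.
    exact: kills_zero kphi xr ij.
  apply: (ideal_pow_leq _ (@cosum_vanish l _ (w j - w x) vl (translate_scalar _ sphi) _ _)); first by lia.
    by have := kills_translate kphi (e_pow xr); rewrite subSn.
  move=> l' ll' wl'; rewrite /translate; apply: (h (x :: l')).
  - by apply: std_subseq sl; rewrite /= eqxx.
  - by rewrite wt_cons wl' subnKC.
  - by apply: contraNneq xj => -[->].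
subst x; rewrite (@cosum_aug l (translate phi (e j))) //; first last.
- by rewrite /translate mul1r.
- by have := kills_translate kphi (e_pow jr); rewrite subSnn.
- exact: translate_scalar.
rewrite natrD scalerDl scale1r [X in _ - X]addrC opprD addrACA subrr addr0.
have -> : (count_mem j l)%:R *: mon l = (count_mem j l)%:R *: mon (rem j l) * e j.
  have [jl|jl] := boolP (j \in l); last by rewrite (count_memPn jl) !scale0r mul0r.
  rewrite -scalerAl; congr (_ *: _); case: l {IH sl' vl} sl jl => // y l.
  case/and3P => /= /andP [jy py] _ _; rewrite inE => /orP [/eqP jy'|jl].
    by rewrite -jy' eqxx.
  have yj : (y <= j)%N by have /allP/(_ _ jl) := order_path_min leq_trans py.
  by rewrite (_ : y = j) ?eqxx //; apply/eqP; rewrite eqn_leq yj jy.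
by rewrite -mulrBl; apply: (ideal_pow_leq _ (ideal_powM (IH sl') (e_pow jr))); have := w_gt0 jr; lia.
Qed.
Definition comb (cls : seq (k * seq nat)) : kG := \sum_(x <- cls) x.1 *: mon x.2.

(** The predicate [Q] on lengths is for the collection process, an induction on length: a bracket or
    a p-th power is replaced by single letters, which gives shorter words. *)
Definition inSP (Q : pred nat) m (x : kG) := exists cls,
  all (fun y => [&& std y.2, wt y.2 == m & Q (size y.2)]) cls /\ I m.+1 (x - comb cls).

Lemma inSP_ideal Q m x : I m.+1 x -> inSP Q m x.
Proof. by move=> xI; exists [::]; rewrite /comb big_nil subr0. Qed.

Lemma inSP_D Q m x y : inSP Q m x -> inSP Q m y -> inSP Q m (x + y).
Proof.
move=> [cx [ax xI]] [cy [ay yI]]; exists (cx ++ cy); rewrite all_cat ax ay; split=> //.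
by rewrite /comb big_cat opprD addrACA; apply: idealD.
Qed.

Lemma inSP_Z Q m c x : inSP Q m x -> inSP Q m (c *: x).
Proof.
move=> [cx [ax xI]]; exists [seq (c * y.1, y.2) | y <- cx]; split; first by rewrite all_map.
rewrite /comb big_map; under eq_bigr => y _ do rewrite /= -scalerA.
by rewrite -scaler_sumr -scalerBr; exact: (idealZ c xI).
Qed.

Lemma inSP_mon (Q : pred nat) m l : std l -> wt l = m -> Q (size l) -> inSP Q m (mon l).
Proof.
move=> sl wl ql; exists [:: (1, l)]; split; first by rewrite /= sl wl eqxx ql.
by rewrite /comb big_seq1 scale1r subrr; apply: ideal0.
Qed.

Lemma inSP_sum Q m (J : Type) (s : seq J) (P : pred J) (F : J -> kG) :
  (forall j, P j -> inSP Q m (F j)) -> inSP Q m (\sum_(j <- s | P j) F j).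
Proof.
move=> h; apply: big_ind => //; last by move=> x y; apply: inSP_D.
by apply: inSP_ideal; apply: ideal0.
Qed.

Lemma inSP_sub (Q Q' : pred nat) m x : (forall s, Q s -> Q' s) -> inSP Q m x -> inSP Q' m x.
Proof.
move=> QQ' [cx [ax xI]]; exists cx; split=> //; apply: sub_all ax => y /and3P [-> -> /QQ' ->].
by [].
Qed.

Lemma inSP_subst Q m0 u v z : vld u -> vld v -> inL m0 z ->
  (forall t, (t < r)%N -> w t = m0 -> inSP Q (wt u + (m0 + wt v))%N (mon (u ++ t :: v))) ->
  inSP Q (wt u + (m0 + wt v))%N (mon v * z * mon u).
Proof.
move=> vu vv [c cI] h.
rewrite -[z](subrK (\sum_(i < r | w i == m0) c i *: e i)) mulrDr mulrDl.
apply: inSP_D.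
  apply: inSP_ideal; have := ideal_powM (ideal_powM (mon_pow vv) cI) (mon_pow vu).
  by apply: ideal_pow_leq; lia.
rewrite mulr_sumr mulr_suml; apply: inSP_sum => i /eqP wi.
rewrite -scalerAr -scalerAl; apply: inSP_Z; have := h i (ltn_ord i) wi.
by rewrite mon_cat.
Qed.

(** By [e_comm] the bracket of the two letters is a combination of single letters of weight w i + w
    j, up to deeper terms; the words that result are one letter shorter. *)
Lemma collect_swap s u i j v : (forall l, vld l -> (size l <= s)%N -> (wt l <= n)%N ->
    inSP (leq^~ s) (wt l) (mon l)) ->
  vld (u ++ i :: j :: v) -> (size (u ++ i :: j :: v) <= s.+1)%N -> (wt (u ++ i :: j :: v) <= n)%N ->
  inSP (leq^~ s) (wt (u ++ i :: j :: v)) (mon (u ++ i :: j :: v) - mon (u ++ j :: i :: v)).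
Proof.
move=> IH; rewrite all_cat /= => /and4P [vu ir jr vv].
rewrite size_cat /= wt_cat !wt_cons => sz wn.
rewrite !mon_cat /= -mulrBl -!(mulrA (mon v)) -mulrBr.
rewrite (addnA (w i)); apply: inSP_subst => //.
  by rewrite addnC; apply: e_comm => //; lia.
move=> t tr wtt.
have wE : wt (u ++ t :: v) = (wt u + (w i + w j + wt v))%N by rewrite wt_cat wt_cons wtt.
rewrite -wE.
apply: IH; rewrite ?all_cat /= ?vu ?tr ?size_cat //=; first by lia.
by rewrite wt_cat wt_cons wtt; lia.
Qed.

Lemma collect_move s u j v1 v2 : (forall l, vld l -> (size l <= s)%N -> (wt l <= n)%N ->
    inSP (leq^~ s) (wt l) (mon l)) ->
  vld (u ++ j :: v1 ++ v2) -> (size (u ++ j :: v1 ++ v2) <= s.+1)%N ->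
  (wt (u ++ j :: v1 ++ v2) <= n)%N ->
  inSP (leq^~ s) (wt (u ++ j :: v1 ++ v2)) (mon (u ++ j :: v1 ++ v2) - mon (u ++ v1 ++ j :: v2)).
Proof.
move=> IH; elim: v1 u => [|i v1 IHv] u /= vl sz wn.
  by rewrite subrr; apply: inSP_ideal; apply: ideal0.
rewrite -[X in inSP _ _ X](subrKA (mon (u ++ i :: j :: v1 ++ v2))).
apply: inSP_D; first exact: collect_swap.
have E x : (u ++ i :: x) = (rcons u i ++ x) by rewrite cat_rcons.
have p1 : perm_eq (u ++ j :: i :: v1 ++ v2) (rcons u i ++ j :: v1 ++ v2).
  by rewrite -E perm_cat2l -(cat1s i) -(cat1s j (_ :: _)) -(cat1s i) -(cat1s j) perm_catCA.
rewrite (wt_perm p1) !E; apply: IHv; last by rewrite -(wt_perm p1).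
  by rewrite -(perm_all _ p1).
by rewrite -(perm_size p1).
Qed.

(** The tail is collected first, and its head letter is then inserted into each standard monomial
    obtained. *)
Lemma collect s l : vld l -> (size l <= s)%N -> (wt l <= n)%N -> inSP (leq^~ s) (wt l) (mon l).
Proof.
elim: s l => [|s IH] [|j l] //=.
- by move=> _ _ _; apply: (@inSP_mon _ _ [::]).
- by move=> _ _ _; apply: (@inSP_mon _ _ [::]).
move=> /andP [jr vl] sz wn.
have wl : (wt l <= n)%N by apply: leq_trans wn; rewrite wt_cons leq_addl.
have [cls [acls clsI]] := IH l vl sz wl.
rewrite -[mon l](subrK (comb cls)) mulrDl; apply: inSP_D.
  apply: inSP_ideal; rewrite wt_cons.
  by apply: (ideal_pow_leq _ (ideal_powM clsI (e_pow jr))); lia.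
rewrite /comb mulr_suml big_seq; apply: inSP_sum => -[c l'] /(allP acls) /= /and3P [sl' wl' szl'].
rewrite -scalerAl; apply: inSP_Z.
have -> : wt (j :: l) = wt (j :: l') by rewrite !wt_cons (eqP wl').
have {wn} wn : (wt (j :: l') <= n)%N by rewrite wt_cons (eqP wl') -wt_cons.
move: l' sl' szl' wn {acls clsI wl' vl sz wl cls l c} => l sl sz wn.
have /and3P [srt cl vl] := sl.
(* The place of [j] is between [l1] and [l2], and it is reached by moving [j] past [l1] at the cost
   of shorter words. *)
pose l1 := [seq i <- l | (i < j)%N]; pose l2 := [seq i <- l | (j <= i)%N].
have lE : l = l1 ++ l2.
  rewrite /l1 /l2; elim: (l) srt => //= y t IHt pt.
  have tj : all (leq y) t := order_path_min leq_trans pt.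
  have {}IHt := IHt (path_sorted pt); have [yj|yj] := ltnP y j; first by rewrite /= -IHt.
  rewrite (_ : [seq i <- t | (i < j)%N] = [::]) /=; last first.
    apply/eqP; rewrite -(negbK (_ == _)) -has_filter; apply/hasPn => i /(allP tj) yi.
    by rewrite -leqNgt; apply: leq_trans yi.
  congr (_ :: _); apply/esym/all_filterP/allP => i /(allP tj); exact: leq_trans.
have vjl : vld (j :: l1 ++ l2) by rewrite /= jr -lE.
have szj : (size (j :: l1 ++ l2) <= s.+1)%N by rewrite /= -lE.
have wnj : (wt (j :: l1 ++ l2) <= n)%N by rewrite -lE.
have mv := @collect_move s [::] j l1 l2 IH vjl szj wnj.
rewrite -[mon l * e j]/(mon (j :: l)) lE -[mon (j :: _)](subrK (mon (l1 ++ j :: l2))).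
apply: inSP_D; first by apply: inSP_sub mv => t; apply: leqW.
have pl : perm_eq (j :: l) (l1 ++ j :: l2) by rewrite lE perm_sym -cat1s perm_catCA.
have srt' : sorted leq (l1 ++ j :: l2).
  rewrite sorted_pairwise ?pairwise_cat /=; last exact: leq_trans.
  have := srt; rewrite lE sorted_pairwise ?pairwise_cat; last exact: leq_trans.
  case/and3P => r12 -> ->; rewrite !andbT; apply/andP; split; last first.
    by apply/allP => i; rewrite mem_filter => /andP [].
  rewrite allrel_consr r12 andbT; apply/allP => i; rewrite mem_filter => /andP [ij _].
  exact: ltnW.
have [cj|cj] := ltnP (count_mem j l).+1 p.
  apply: inSP_mon; last by rewrite -(perm_size pl).
    apply/and3P; split=> //; last by rewrite -(perm_all _ pl) /= jr vl.
    have cE i : count_mem i (l1 ++ j :: l2) = ((j == i) + count_mem i l)%N.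
      by have /permP/(_ (pred1 i)) := pl; rewrite /= => ->.
    rewrite -(perm_all _ pl) /= cE eqxx cj /=; apply/allP => i il /=; rewrite cE.
    case: eqVneq => [<- //|_]; rewrite add0n; exact: (allP cl i il).
  by rewrite -(wt_perm pl) lE.
(* Here the insertion completes p adjacent copies of [j]. By [e_exp] they are replaced by a single
   letter of weight p w j, which shortens the word as p > 1. *)
have cjl : count_mem j l = p.-1.
  have := p_prime => /prime_gt0 p0; apply/eqP; rewrite eqn_leq; apply/andP; split; last by lia.
  have [jl|/count_memPn -> //] := boolP (j \in l).
  by have /= := allP cl j jl; case: (p) => [|q].
pose l3 := [seq i <- l | (j < i)%N].
have l2E : j :: l2 = nseq p j ++ l3.
  have p0 := prime_gt0 p_prime.
  rewrite -(prednK p0) /= -cjl; congr (_ :: _).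
  apply: (sorted_eq leq_trans anti_leq); first exact: (sorted_filter leq_trans).
    rewrite sorted_pairwise ?pairwise_cat; last exact: leq_trans.
    rewrite -!sorted_pairwise; try exact: leq_trans.
    rewrite (sorted_filter leq_trans _ srt) andbT; apply/andP; split; last first.
      by elim: (count_mem j l) => //= t; case: t => //= t ->; rewrite leqnn.
    apply/allrelP => x y; rewrite mem_nseq mem_filter => /andP [_ /eqP ->] /andP [jy _].
    exact: ltnW.
  by apply/permP => a; rewrite count_cat count_nseq; apply: count_filter_leq.
have wp : (p * w j + wt l3 + wt l1)%N = wt (j :: l1 ++ l2).
  rewrite -lE (wt_perm pl) l2E !wt_cat addnC; congr (_ + (_ + _))%N.
  by rewrite /wt big_nseq iter_addn addn0 mulnC.
have vl1 : vld l1 by rewrite all_filter; apply: sub_all vl => i /= ->; rewrite implybT.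
have vl3 : vld l3 by rewrite all_filter; apply: sub_all vl => i /= ->; rewrite implybT.
rewrite l2E mon_cat mon_cat.
have -> : mon (nseq p j) = e j ^+ p by elim: (p) => //= t ->; rewrite exprSr.
rewrite -wp addnC; apply: inSP_subst => //; first by apply: e_exp => //; lia.
move=> t tr wtt.
have -> : (wt l1 + (p * w j + wt l3))%N = wt (l1 ++ t :: l3) by rewrite wt_cat wt_cons wtt.
apply: (@inSP_sub (leq^~ s)); first by move=> x; apply: leqW.
apply: IH; first by rewrite all_cat /= vl1 tr vl3.
  have : size (l1 ++ j :: l2) = (size l).+1 by rewrite -(perm_size pl).
  by rewrite l2E !size_cat /= size_nseq; have := prime_gt1 p_prime; lia.
by rewrite wt_cat wt_cons wtt; lia.
Qed.

(** For a product y (g - 1) with y in I^m, the induction hypothesis expands y and [e_gen] expands g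
    - 1; the words obtained are then collected. *)
Lemma span m x : (m <= n)%N -> I m x -> inSP predT m x.
Proof.
elim: m x => [|m IH] x mn.
  move=> _; exists [:: (aug x, [::])]; split; first by rewrite /= /wt big_nil.
  rewrite /comb big_seq1; apply: ideal_pow1; change (aug (x - aug x *: (1 : kG)) = 0).
  by rewrite augB augZ aug1 mulr1 subrr.
move: x; apply: ideal_pow_aug_ind => [|x y|y g yI].
- by apply: inSP_ideal; apply: ideal0.
- exact: inSP_D.
have [cls [acls clsI]] := IH y (ltnW mn) yI.
rewrite -[y](subrK (comb cls)) mulrDl; apply: inSP_D.
  by apply: inSP_ideal; rewrite -addn1; apply: ideal_powM => //; apply: gdif_pow1.
rewrite /comb mulr_suml big_seq; apply: inSP_sum => -[c l] /(allP acls) /= /and3P [sl wl _].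
have vl : vld l by case/and3P: sl.
rewrite -scalerAl; apply: inSP_Z.
have := @inSP_subst predT 1 [::] l _ isT vl (e_gen g).
rewrite /= mulr1 /wt big_nil -/(wt l) add0n add1n (eqP wl); apply.
move=> t tr wtt; have wtl : wt (t :: l) = m.+1 by rewrite wt_cons wtt (eqP wl).
rewrite -wtl; apply: (@inSP_sub (leq^~ (size (t :: l)))) => //; apply: collect.
- by rewrite /= tr.
- by [].
- by rewrite wtl.
Qed.
Lemma comb_cons c l cls : comb ((c, l) :: cls) = c *: mon l + comb cls.
Proof. by rewrite /comb big_cons. Qed.

Lemma comb_uniq (P : pred (seq nat)) cls : all P (map snd cls) ->
  exists cls', [/\ uniq (map snd cls'), all P (map snd cls') & comb cls = comb cls'].
Proof.
elim: cls => [_|[c l] cls IH] /=; first by exists [::].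
move=> /andP [Pl /IH [cls' [u' a' E]]].
have [ll|ll] := boolP (l \in map snd cls'); last first.
  by exists ((c, l) :: cls'); rewrite !comb_cons E /= ll u' Pl a'.
exists [seq (if y.2 == l then y.1 + c else y.1, y.2) | y <- cls'].
rewrite -map_comp (eq_map (g := snd)) //; split=> //.
rewrite comb_cons E; elim: cls' ll u' {IH E a' cls} => [//|[d l'] cls IH] /=.
rewrite inE => /orP [/eqP ->|ll] /andP [nl' u'].
  rewrite !comb_cons eqxx scalerDl addrA [c *: _ + _]addrC -!addrA; congr (_ + _).
  congr (_ + _); rewrite /comb big_map; apply: eq_big_seq => -[d' l''] il /=.
  case: eqP => // l''l'; case/negP: nl'; rewrite -l''l'.
  by apply/mapP; exists (d', l'').
rewrite !comb_cons addrCA; case: eqP => [l'l|_]; first by case/negP: nl'; rewrite l'l.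
by congr (_ + _); exact: IH.
Qed.

Definition free m := forall cls, uniq (map snd cls) ->
  all (fun l => std l && (wt l == m)) (map snd cls) -> I m.+1 (comb cls) ->
  all (fun y => y.1 == 0) cls.

(** [U] is spanned by 1, by the other standard monomials of weight [w j] and by I^(w j + 1).
    Independence in this weight keeps [e j] outside [U]. *)
Lemma dual_form j : (j < r)%N -> (w j <= n)%N -> free (w j) ->
  exists phi : kG -> k, [/\ scalar phi, kills phi (w j).+1, phi 1 = 0, phi (e j) = 1 &
    forall l, std l -> wt l = w j -> l != [:: j] -> phi (mon l) = 0].
Proof.
move=> jr wn fj.
pose Pj l := [&& std l, wt l == w j & l != [:: j]].
pose U (x : kG) := exists c cls, all Pj (map snd cls) /\ I (w j).+1 (x - (c *: 1 + comb cls)).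
have sU : subspace_axiom (U : set kG).
  split.
  - by exists 0, [::]; rewrite /comb big_nil scale0r addr0 subr0; split=> //; apply: ideal0.
  - move=> x y [c [cx [ax xI]]] [d [cy [ay yI]]]; exists (c + d), (cx ++ cy).
    rewrite map_cat all_cat ax ay; split=> //.
    rewrite /comb big_cat scalerDl addrACA opprD addrACA; exact: idealD.
  - move=> d x [c [cx [ax xI]]]; exists (d * c), [seq (d * y.1, y.2) | y <- cx]; split.
      by rewrite -map_comp (eq_map (g := snd)).
    rewrite /comb big_map; under eq_bigr => y _ do rewrite /= -scalerA.
    by rewrite -scaler_sumr -scalerA -scalerDr -scalerBr; exact: (idealZ d xI).
have wj := w_gt0 jr.
have stdj : std [:: j] by rewrite /std /= jr eqxx addn0 prime_gt1 // p_prime.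
have wtj : wt [:: j] = w j by rewrite wt_cons /wt big_nil addn0.
have Ue : ~ U (e j).
  move=> [c [cls [acls clsI]]].
  have aug_pos m x : (0 < m)%N -> I m x -> aug x = 0.
    by move=> m0 xI; apply: (ideal_pow1_sub (ideal_pow_leq m0 xI)).
  (* All other terms of the relation have positive weight and are annihilated by the
     augmentation. *)
  have c0 : c = 0.
    have := aug_pos _ _ (ltn0Sn _) clsI; rewrite (augB (e j)) (augD (c *: 1)) (augZ c) aug1 mulr1.
    rewrite (aug_pos _ _ wj (e_pow jr)) sub0r => /eqP; rewrite oppr_eq0.
    rewrite (aug_pos _ (comb cls) wj) ?addr0; first by move/eqP.
    rewrite /comb big_seq; apply: (big_ind (I (w j))); first exact: ideal0.
      by move=> x y; apply: idealD.
    move=> [d l] dl; apply: idealZ.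
    have /and3P [/and3P [_ _ vl] /eqP <- _] := allP acls l (map_f snd dl).
    exact: mon_pow.
  have [cls' [u' a' E]] := comb_uniq acls.
  have : all (fun y : k * seq nat => y.1 == 0) ((- 1, [:: j]) :: cls').
    apply: fj.
    - rewrite /= u' andbT; apply/negP => /(allP a') /and3P [_ _].
      by rewrite eqxx.
    - by rewrite /= stdj wtj eqxx /=; apply: sub_all a' => l /and3P [-> ->].
    - rewrite comb_cons /= mul1r scaleN1r -E; have := idealN clsI.
      by rewrite c0 scale0r add0r opprB addrC.
  by rewrite /= oppr_eq0 oner_eq0.
have [phi [sphi phiU phi1]] := separating_form sU Ue.
exists phi; split=> //.
- move=> x xI; apply: phiU; exists 0, [::].
  by rewrite /comb big_nil scale0r addr0 subr0.
- apply: phiU; exists 1, [::]; rewrite /comb big_nil scale1r addr0 subrr.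
  by split=> //; apply: ideal0.
- move=> l sl wl lj; apply: phiU; exists 0, [:: (1, l)].
  split; first by rewrite /Pj /= sl wl eqxx lj.
  by rewrite comb_cons /comb big_nil scale0r scale1r addr0 add0r subrr; apply: ideal0.
Qed.

(* Applying [phi (x) id o Delta] with [phi] dual to the basis element [e j] lowers the
   [j]-exponent of a standard monomial by one, as a partial derivative would. *)
Lemma coef_primitive m x cls : (m <= n)%N -> (forall m', (0 < m' < m)%N -> free m') ->
  (forall i phi, (0 < i < m)%N -> scalar phi -> kills phi i.+1 -> phi 1 = 0 ->
    I (m.+1 - i)%N (contract phi x)) ->
  uniq (map snd cls) -> all (fun l => std l && (wt l == m)) (map snd cls) ->
  I m.+1 (x - comb cls) ->
  forall y, y \in cls -> (1 < size y.2)%N -> y.1 = 0.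
Proof.
move=> mn fr hx u_cls a_cls clsI [c l] cl /= sl1.
case: l cl sl1 => [//|j l] cl sl1.
have /andP [sjl /eqP wjl] := allP a_cls _ (map_f snd cl).
have /and3P [_ cjl /andP [jr vl]] := sjl.
have wj := w_gt0 jr.
have wl : (0 < wt l)%N.
  case: l sl1 vl {cl sjl wjl cjl} => // i l _ /= /andP [ir _].
  by rewrite wt_cons addn_gt0 w_gt0.
have wjm : (0 < w j < m)%N by rewrite wj -wjl wt_cons; lia.
have [|phi [sphi kphi phi1 phij phi0]] := dual_form jr _ (fr _ wjm); first by lia.
have TI : I (m.+1 - w j)%N (contract phi (comb cls)).
  rewrite -(subKr x (comb cls)) contractB; apply: idealB; first exact: hx.
  exact: contract_ideal_pow.
(* The derived monomials [cls2] have weight m - w j, which lies strictly between 0 and m, where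
   independence is known. *)
pose d (y : k * seq nat) := (y.1 * (count_mem j y.2)%:R, rem j y.2).
pose cls2 := [seq d y | y <- cls & j \in y.2].
have c2I : I (m.+1 - w j)%N (comb cls2).
  rewrite -(subKr (contract phi (comb cls)) (comb cls2)); apply: idealB => //.
  have -> : contract phi (comb cls) - comb cls2 =
      \sum_(y <- cls) y.1 *: (contract phi (mon y.2) - (count_mem j y.2)%:R *: mon (rem j y.2)).
    rewrite /cls2 /comb big_map big_filter [in X in _ - X]big_mkcond /=.
    rewrite (big_morph _ (contractD phi) (contract0 phi)) -sumrB; apply: eq_bigr => y _.
    rewrite contractZ scalerBr scalerA; congr (_ - _); case: ifPn => // /count_memPn ->.
    by rewrite mulr0 scale0r.
  rewrite big_seq; apply: (big_ind (I (m.+1 - w j)%N)); first exact: ideal0.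
    by move=> u v; apply: idealD.
  move=> y ycls; apply: idealZ.
  have /andP [sy /eqP wy] := allP a_cls _ (map_f snd ycls).
  have vy : vld y.2 by case/and3P: sy.
  have h1 := contract_mon vy sphi kphi; have h2 := cosum_dual sy jr sphi kphi phij phi0.
  by rewrite wy in h1 h2; apply: ideal_subKA h1 h2.
have fm : free (m - w j)%N by apply: fr; lia.
have dE : map snd cls2 = map (rem j) (filter (fun l => j \in l) (map snd cls)).
  by rewrite filter_map -!map_comp.
have : all (fun y => y.1 == 0) cls2.
apply: fm.
(* Removal of [j] is injective on the sorted lists containing [j], so that derivatives of distinct
   monomials do not merge. *)
- rewrite dE map_inj_in_uniq ?filter_uniq // => l1 l2.
  rewrite !mem_filter => /andP [jl1 l1c] /andP [jl2 l2c] E.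
  have /andP [/and3P [s1 _ _] _] := allP a_cls _ l1c.
  have /andP [/and3P [s2 _ _] _] := allP a_cls _ l2c.
  apply: (sorted_eq leq_trans anti_leq s1 s2).
  apply: perm_trans (perm_to_rem jl1) _; rewrite perm_sym.
  by apply: perm_trans (perm_to_rem jl2) _; rewrite E.
- rewrite dE; apply/allP => z /mapP [l1]; rewrite mem_filter => /andP [jl1 l1c] ->.
  have /andP [s1 /eqP w1] := allP a_cls _ l1c.
  rewrite (std_subseq (rem_subseq _ _) s1) /=; apply/eqP.
  have := wt_perm (perm_to_rem jl1); rewrite w1 wt_cons => ->.
  by rewrite addKn.
- by rewrite -subSn //; lia.
have dc : d (c, j :: l) \in cls2 by apply: map_f; rewrite mem_filter /= inE eqxx.
(* The multiplicity of [j] lies between 1 and p - 1 and is therefore nonzero in k. *)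
move/allP/(_ _ dc); rewrite /d /= eqxx mulf_eq0 => /orP [/eqP //|].
rewrite -(dvdn_pcharf charkp) => /dvdn_leq.
have := cjl => /= /andP []; rewrite eqxx => h _; move/(_ isT).
by rewrite leqNgt h.
Qed.

(** [coef_primitive] at x = 0 eliminates the monomials with at least two letters. What remains is a
    relation between single letters, excluded by [e_free]. *)
Lemma free_leq m : (0 < m)%N -> (m <= n)%N -> free m.
Proof.
elim/ltn_ind: m => m IH m0 mn cls u_cls a_cls clsI.
have c2 : forall y, y \in cls -> (1 < size y.2)%N -> y.1 = 0.
  apply: (@coef_primitive m 0 cls) => //.
  - by move=> m' /andP [m'0 m'm]; apply: IH => //; lia.
  - by move=> i phi _ _ _ _; rewrite contract0; apply: ideal0.
  - by rewrite sub0r; apply: idealN.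
pose c i : k := \sum_(y <- cls | y.2 == [:: i]) y.1.
have c1 y i : y \in cls -> y.2 = [:: i] -> c i = y.1.
  move=> ycls yi; rewrite /c big_mkcond (bigD1_seq y) ?(map_uniq u_cls) //= yi eqxx.
  rewrite big1_seq ?addr0 // => z /andP [zy zcls]; case: eqP => // zi; case/eqP: zy.
  by apply: (uniq_map_inj u_cls) => //; rewrite yi zi.
have cE : \sum_(i < r | w i == m) c i *: e i = comb cls.
  have cE i : c i *: e i = \sum_(y <- cls) (if y.2 == [:: i] then y.1 *: e i else 0).
    by rewrite /c scaler_suml big_mkcond.
  under eq_bigr => i _ do rewrite cE.
  rewrite exchange_big /= /comb; apply: eq_big_seq => y ycls.
  have /andP [sy /eqP wy] := allP a_cls _ (map_f snd ycls).
  have := c2 y ycls; case: y ycls sy wy => y1 [|j [|j' l]] /= ycls sy wy y2.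
  - by move: m0; rewrite -wy /wt big_nil.
  - have /and3P [_ _ /andP [jr _]] := sy.
    rewrite (bigD1 (Ordinal jr)) /=; last by rewrite -wy wt_cons /wt big_nil addn0.
    rewrite eqxx big1 ?addr0 ?mul1r // => i /andP [_ ij]; case: eqP => // -[ji].
    by case/eqP: ij; apply: val_inj.
  - by rewrite y2 // scale0r big1 // => i _; case: eqP.
have cI := e_free mn (c := c); rewrite cE in cI.
apply/allP => y ycls; have /andP [sy /eqP wy] := allP a_cls _ (map_f snd ycls).
have := c2 y ycls; have := c1 y _ ycls.
case: y ycls sy wy => y1 [|j [|j' l]] /= ycls sy wy h1 h2.
- by move: m0; rewrite -wy /wt big_nil.
- have /and3P [_ _ /andP [jr _]] := sy.
  by rewrite -(h1 j) // cI // -wy wt_cons /wt big_nil addn0.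
- by rewrite h2.
Qed.

Lemma inL0 m : inL m 0.
Proof.
exists (fun=> 0); rewrite big1 => [|i _]; last by rewrite scale0r.
by rewrite subr0; exact: ideal0.
Qed.

Lemma inL_e c j : (j < r)%N -> inL (w j) (c *: e j).
Proof.
move=> jr; exists (fun i => if i == j then c else 0).
rewrite (bigD1 (Ordinal jr)) ?eqxx //= big1 ?addr0 ?subrr; first exact: (ideal0 (I (w j).+1)).
move=> i /andP [_ ij]; case: eqP => [ji|_]; last by rewrite scale0r.
by case/eqP: ij; apply: val_inj.
Qed.

Lemma inL_sum m (cls : seq (k * seq nat)) :
  (forall y, y \in cls -> inL m (y.1 *: mon y.2)) -> inL m (comb cls).
Proof.
rewrite /comb big_seq => h; apply: (big_ind (inL m)) => [|x y [c cI] [d dI]|//].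
  exact: inL0.
exists (fun i => c i + d i); under eq_bigr => i _ do rewrite scalerDl.
by rewrite big_split opprD addrACA; exact: (idealD cI dI).
Qed.

(** [coef_primitive] applies to x = g - 1, because contract phi (g - 1) = phi(g) g - phi(1) is 0 as
    soon as phi vanishes at 1 and on I^m. Only single letters remain. *)
Lemma gdelta_inL m g : (0 < m)%N -> (m <= n)%N -> gdelta k m g -> inL m (gdif k g).
Proof.
move=> m0 mn gm.
have [cls0 [a0 xI0]] := span mn gm.
have {}a0 : all (fun l => std l && (wt l == m)) (map snd cls0).
  by rewrite all_map; apply: sub_all a0 => y /= /and3P [-> -> _].
have [cls [u_cls a_cls E]] := comb_uniq a0; rewrite E in xI0.
have c2 : forall y, y \in cls -> (1 < size y.2)%N -> y.1 = 0.
  apply: (coef_primitive mn _ _ u_cls a_cls xI0).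
    by move=> m' /andP [m'0 m'm]; apply: free_leq => //; lia.
  move=> i phi /andP [_ im] sphi kphi phi1.
  have c1 : contract phi 1 = 0.
    transitivity (phi 1 *: gr_gen k (1%g : G)); first exact: contract_gen.
    by rewrite phi1 scale0r.
  have g0 : phi (gr_gen k g) = 0.
    by rewrite gr_gdif (scalarD sphi) phi1 add0r; apply: kphi; apply: (ideal_pow_leq im).
  by rewrite /gdif contractB contract_gen g0 c1 scale0r subrr; apply: ideal0.
have [d dI] : inL m (comb cls).
  apply: inL_sum => y ycls; have /andP [sy /eqP wy] := allP a_cls _ (map_f snd ycls).
  have := c2 y ycls; case: y ycls sy wy => y1 [|j [|j' l]] /= ycls sy wy y2.
  - by move: m0; rewrite -wy /wt big_nil.
  - have /and3P [_ _ /andP [jr _]] := sy.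
    have wjm : w j = m by rewrite -wy wt_cons /wt big_nil addn0.
    by rewrite mul1r -wjm; apply: inL_e.
  - by rewrite y2 // scale0r; apply: inL0.
by exists d; exact: ideal_subKA xI0 dI.
Qed.
End Jennings.

(** Left multiplication by [a] is the sum of ad(a) and right multiplication by [a], which commute;
    this is the binomial formula for them. *)
Lemma mulr_adjoint_exp (A : pzRingType) (a y : A) n :
  a ^+ n * y = \sum_(i < n.+1) (iter i (fun z => a * z - z * a) y * a ^+ (n - i)) *+ 'C(n, i).
Proof.
elim: n => [|n IH]; first by rewrite big_ord1 /= expr0 mul1r mulr1.
rewrite exprS -mulrA IH mulr_sumr.
have step (i : 'I_n.+1) : a * ((iter i (fun z => a * z - z * a) y * a ^+ (n - i)) *+ 'C(n, i)) =
   (iter i.+1 (fun z => a * z - z * a) y * a ^+ (n.+1 - i.+1)) *+ 'C(n, i)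
   + (iter i (fun z => a * z - z * a) y * a ^+ (n.+1 - i)) *+ 'C(n, i).
  have E (Y P : A) c : a * ((Y * P) *+ c) = ((a * Y - Y * a) * P) *+ c + (Y * (a * P)) *+ c.
    by rewrite mulrnAr -mulrnDl mulrBl !mulrA subrK.
  have le_in : (i <= n)%N by rewrite -ltnS.
  by rewrite E subSS (subSn le_in) exprS.
under eq_bigr => i _ do rewrite step.
rewrite big_split /=.
rewrite [RHS]big_ord_recl [X in _ + X = _]big_ord_recl /= !bin0 !subn0.
rewrite addrCA; congr (_ + _).
rewrite [in RHS](eq_bigr (fun i : 'I_n.+1 =>
  (iter i.+1 (fun z => a * z - z * a) y * a ^+ (n.+1 - i.+1)) *+ 'C(n, i.+1) +
  (iter i.+1 (fun z => a * z - z * a) y * a ^+ (n.+1 - i.+1)) *+ 'C(n, i))); last first.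
  by move=> i _; rewrite binS mulrnDr.
rewrite big_split /= addrC; congr (_ + _).
by rewrite [RHS]big_ord_recr /= bin_small // mulr0n addr0; apply: eq_bigr.
Qed.

(** The identity ad(a^p) = ad(a)^p: only the two extreme binomial coefficients survive modulo p. *)
Lemma adjoint_pchar (A : nzRingType) p (a y : A) : p \in [pchar A] ->
  a ^+ p * y - y * a ^+ p = iter p (fun z => a * z - z * a) y.
Proof.
move=> charAp; have pp := pcharf_prime charAp.
case: p charAp pp => // p charAp pp.
rewrite mulr_adjoint_exp big_ord_recl big_ord_recr /= bin0 binn subn0 subnn expr0 mulr1.
rewrite big1 ?add0r; first by rewrite addrAC subrr add0r.
move=> i _; have : (p.+1 %| 'C(p.+1, bump 0 i))%N by rewrite prime_dvd_bin // /bump /= ltnS ltn_ord.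
rewrite (dvdn_pcharf charAp) => /eqP c0.
by rewrite -[X in X *+ _]mulr1 -mulrnAr c0 mulr0.
Qed.

Section Brackets.
Variable A : pzRingType.
Implicit Types a d h s x y : A.

Lemma bracketDr a y s : a * y - y * a = (a * (y - s) - (y - s) * a) + (a * s - s * a).
Proof.
have E (P Q S T : A) : P - T = (P - Q) + (S - T) + (Q - S).
  by rewrite -[RHS]addrA [X in _ = _ + X]addrC !subrKA.
by rewrite mulrBr mulrBl opprB; apply: E.
Qed.

Lemma bracketDl d d' y : d * y - y * d = ((d - d') * y - y * (d - d')) + (d' * y - y * d').
Proof.
by rewrite -[LHS]opprB (bracketDr y d d') opprD !opprB.
Qed.

Lemma jacobi a h y : (a * h - h * a) * y - y * (a * h - h * a) =
  (a * (h * y - y * h) - (h * y - y * h) * a) - (h * (a * y - y * a) - (a * y - y * a) * h).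
Proof.
rewrite !mulrBl !mulrBr !mulrA.
move: (a * h * y) (h * a * y) (y * a * h) (y * h * a) (a * y * h) (h * y * a) => P Q C D X Y.
rewrite !opprB [RHS]addrACA subrKA subrKA addrACA [RHS]addrACA.
by rewrite (addrC (- Q)).
Qed.
End Brackets.

Section SpanBySequence.
Variables (k : fieldType) (G : groupType).
Local Notation kG := (group_ring k G).
Local Notation I := (ideal_pow (aug_ideal kG)).
Implicit Types b : seq (nat * G).

(** Same notion as [inL], with coefficients indexed by entries instead of positions, so that entries
    can be removed from [b]. *)
Definition inspan b m (x : kG) := exists c : nat * G -> k,
  I m.+1 (x - \sum_(y <- b | y.1 == m) c y *: gdif k y.2).

Lemma inspanP b m x : uniq b -> inspan b m x <-> inL b m x.
Proof.
move=> ub; split=> -[c cI].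
  exists (fun i => c (nth (0%N, 1%g) b i)).
  by rewrite (big_nth (0%N, 1%g : G)) big_mkord in cI.
exists (fun y => c (index y b)); rewrite (big_nth (0%N, 1%g : G)) big_mkord.
rewrite (eq_bigr (fun i : 'I_(size b) => c i *: je k b i)) // => i _.
by rewrite index_uniq.
Qed.

Lemma inspan_ideal b m x : I m.+1 x -> inspan b m x.
Proof.
move=> xI; exists (fun=> 0); rewrite big1 ?subr0 // => y _.
by rewrite scale0r.
Qed.

Lemma inspanD b m x y : inspan b m x -> inspan b m y -> inspan b m (x + y).
Proof.
move=> [c cI] [d dI]; exists (fun z => c z + d z); under eq_bigr => i _ do rewrite scalerDl.
by rewrite big_split opprD addrACA; exact: (idealD cI dI).
Qed.

Lemma inspanZ b m a x : inspan b m x -> inspan b m (a *: x).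
Proof.
move=> [c cI]; exists (fun z => a * c z); under eq_bigr => i _ do rewrite -scalerA.
by rewrite -scaler_sumr -scalerBr; exact: (idealZ a cI).
Qed.

Lemma inspanN b m x : inspan b m x -> inspan b m (- x).
Proof. by rewrite -scaleN1r; apply: inspanZ. Qed.

Lemma inspanB b m x y : inspan b m x -> inspan b m y -> inspan b m (x - y).
Proof. by move=> xb yb; apply: inspanD => //; apply: inspanN. Qed.

Lemma inspan_mem b y : uniq b -> y \in b -> inspan b y.1 (gdif k y.2).
Proof.
move=> ub yb; exists (fun z => (z == y)%:R).
rewrite big_mkcond (bigD1_seq y) //= !eqxx scale1r big1_seq ?addr0 ?subrr; first exact: (ideal0 (I y.1.+1)).
by move=> z /andP [/negbTE -> _]; rewrite scale0r if_same.
Qed.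

Lemma inspan_sum b m (J : Type) (s : seq J) (P : pred J) (F : J -> kG) :
  (forall j, P j -> inspan b m (F j)) -> inspan b m (\sum_(j <- s | P j) F j).
Proof.
move=> h; apply: (big_ind (inspan b m)) => //; last by move=> x y; apply: inspanD.
by apply: inspan_ideal; apply: ideal0.
Qed.

Lemma inspan_trans b b' m x : inspan b m x ->
  (forall y, y \in b -> inspan b' y.1 (gdif k y.2)) -> inspan b' m x.
Proof.
move=> [c cI] bb'; rewrite -[x](subrK (\sum_(y <- b | y.1 == m) c y *: gdif k y.2)).
apply: inspanD; first exact: inspan_ideal.
rewrite big_seq_cond; apply: inspan_sum => y /andP [yb /eqP <-].
by apply: inspanZ; apply: bb'.
Qed.

Lemma inspan_pow b m x : (forall y, y \in b -> gdelta k y.1 y.2) -> inspan b m x -> I m x.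
Proof.
move=> hb [c cI]; rewrite -[x](subrK (\sum_(y <- b | y.1 == m) c y *: gdif k y.2)).
apply: idealD; first exact: ideal_pow_leq cI.
rewrite big_seq_cond; apply: (big_ind (I m)); [exact: ideal0|exact: idealD|].
by move=> y /andP [yb /eqP <-]; apply: idealZ; apply: hb.
Qed.

Definition free_seq b := forall m (c : nat * G -> k),
  I m.+1 (\sum_(y <- b | y.1 == m) c y *: gdif k y.2) -> forall y, y \in b -> y.1 = m -> c y = 0.

(** An entry with nonzero coefficient in a relation lies in the span of the others of its weight and
    can be discarded. *)
Lemma free_subseq b : uniq b -> exists b', [/\ uniq b', {subset b' <= b}, free_seq b' &
  forall y, y \in b -> inspan b' y.1 (gdif k y.2)].
Proof.
have [s] := ubnP (size b); elim: s b => // s IH b; rewrite ltnS => sb ub.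
case: (pselect (free_seq b)) => [fb|].
  by exists b; split=> // y yb; apply: inspan_mem.
move=> /existsNP [m /existsNP [c /not_implyP [cI /existsNP [y /not_implyP [yb /not_implyP [ym cy]]]]]].
have cy0 : c y != 0 by apply/eqP.
have yspan : inspan (rem y b) y.1 (gdif k y.2).
  have -> : gdif k y.2 = (c y)^-1 *: (c y *: gdif k y.2) by rewrite scalerA mulVf // scale1r.
  apply: inspanZ; move: cI; rewrite (big_rem y) //= ym eqxx => cI.
  exists (fun z => - c z); under eq_bigr => i _ do rewrite scaleNr.
  by rewrite sumrN opprK.
have [||b' [ub' bb' fb' sb']] := IH (rem y b); last 1 first.
- exists b'; split=> // [z /bb' /mem_rem //|z zb].
  have [->|zy] := eqVneq z y; last by apply: sb'; rewrite mem_rem_uniq // inE zy.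
  exact: inspan_trans yspan _.
- by rewrite size_rem //; case: (b) yb sb => //= z b0 _; lia.
- exact: rem_uniq.
Qed.
End SpanBySequence.

(** * The restricted Lie algebra of a finitely generated group *)

Section RestrictedLieGenerators.
Variables (p : nat) (p_prime : prime p) (G : groupType) (gens : seq G).
Hypothesis gensP : forall H : set G, subgroup_axiom H -> (forall x, x \in gens -> H x) -> forall g, H g.
Local Notation k := 'F_p.
Local Notation kG := (group_ring k G).
Local Notation I := (ideal_pow (aug_ideal kG)).
Local Notation dif := (@gdif k G).

Let charkp : p \in [pchar k]. Proof. exact: pchar_Fp. Qed.

(** Commutators are formed with generators only, which leaves finitely many elements in each weight;
    [bracket_jset] shows that this yields closure under all the brackets needed. *)
Inductive jset : nat -> G -> Prop :=
| jset_gen x : x \in gens -> jset 1 x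
| jset_comm m x y : jset m x -> y \in gens -> jset m.+1 [~ x, y]%g
| jset_exp m x : jset m x -> jset (p * m) (x ^+ p)%g.

Lemma jset_gt0 m x : jset m x -> (0 < m)%N.
Proof. by elim=> // m' y _ m0; rewrite muln_gt0 prime_gt0. Qed.

Lemma jset_gammap m x : jset m x -> gammap p m x.
Proof.
have p1 := prime_gt1 p_prime; elim=> // [m' y z _ IH _|m' y _ IH].
  exact: gammap_commg.
exact: gammap_expg IH.
Qed.

Lemma jset_gdelta m x : jset m x -> gdelta k m x.
Proof. by move=> /jset_gammap; apply: gammap_gdelta. Qed.

Lemma jset_finite m : exists l : seq G, forall x, jset m x -> x \in l.
Proof.
elim/ltn_ind: m => m IH.
have [m0|m0] := posnP m.
  by exists [::] => x /jset_gt0; rewrite m0.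
have [|l1 h1] := IH m.-1; first by lia.
have [|l2 h2] := IH (m %/ p)%N; first by rewrite ltn_Pdiv // prime_gt1.
exists (gens ++ [seq [~ x, y]%g | x <- l1, y <- gens] ++ [seq (x ^+ p)%g | x <- l2]).
move=> x mx; rewrite !mem_cat; case: mx h1 h2 => {m IH m0 x} [x xg|m x y mx yg|m x mx] h1 h2.
- by rewrite xg.
- by apply/orP; right; apply/orP; left; apply: allpairs_f => //; apply: h1.
- apply/orP; right; apply/orP; right; apply: map_f; apply: h2.
  by rewrite mulKn // prime_gt0.
Qed.

Lemma jset_basis n : exists b : seq (nat * G),
  [/\ uniq b, free_seq k b, (forall y, y \in b -> jset y.1 y.2) &
      forall m x, (m <= n)%N -> jset m x -> inspan b m (dif x)].
Proof.
have [l hl] : exists l : seq (nat * G), forall m x, (m <= n)%N -> jset m x -> (m, x) \in l.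
  elim: n => [|n [l hl]].
    by exists [::] => m x; rewrite leqn0 => /eqP -> /jset_gt0.
  have [l' hl'] := jset_finite n.+1.
  exists (l ++ [seq (n.+1, x) | x <- l']) => m x; rewrite leq_eqVlt mem_cat => /orP [/eqP ->|mn] mx.
    by rewrite map_f ?orbT ?hl'.
  by rewrite hl.
have [b [ub bl fb sb]] := free_subseq k (undup_uniq [seq y <- l | `[<jset y.1 y.2>]]).
exists b; split=> // [y /bl|m x mn mx].
  by rewrite mem_undup mem_filter => /andP [/asboolP].
by apply: (sb (m, x)); rewrite mem_undup mem_filter hl // andbT; apply/asboolP.
Qed.

Section WithBasis.
Variables (n : nat) (b : seq (nat * G)) (ub : uniq b) (fb : free_seq k b).
Hypothesis bJ : forall y, y \in b -> jset y.1 y.2.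
Hypothesis bS : forall m x, (m <= n)%N -> jset m x -> inspan b m (dif x).

Let bdelta y : y \in b -> gdelta k y.1 y.2.
Proof. by move=> /bJ /jset_gdelta. Qed.

Lemma bracket_gen x j y : x \in gens -> (1 + j <= n)%N -> inspan b j y ->
  inspan b (1 + j)%N (dif x * y - y * dif x).
Proof.
move=> xg jn [c cI]; set s := \sum_(_ <- _ | _) _ in cI.
rewrite (bracketDr (dif x) y s); apply: inspanD.
  apply: inspan_ideal; apply: idealB; first by rewrite -add1n; apply: ideal_powM => //; apply: gdif_pow1.
  by rewrite add1n -addn1; apply: ideal_powM => //; apply: gdif_pow1.
rewrite /s mulr_sumr mulr_suml -sumrB big_seq_cond; apply: inspan_sum => z /andP [zb /eqP zj].
rewrite -scalerAr -scalerAl -scalerBr; apply: inspanZ.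
have zJ : jset (1 + j)%N [~ z.2, x]%g by rewrite -zj; apply: jset_comm => //; apply: bJ.
rewrite -[X in inspan _ _ X]opprK opprB; apply: inspanN.
rewrite -[X in inspan _ _ X](subrK (dif [~ z.2, x]%g)); apply: inspanD; last exact: bS.
apply: inspan_ideal; rewrite -opprB; apply: idealN.
have := gdif_commg (bdelta zb) (gdelta1 x).
by rewrite zj addn1 add1n.
Qed.

(** Induction on the construction of x: a commutator is handled by the Jacobi identity, a p-th power
    by ad(a^p) = ad(a)^p. *)
Lemma bracket_jset i x : jset i x -> forall j y, (i + j <= n)%N -> inspan b j y ->
  inspan b (i + j)%N (dif x * y - y * dif x).
Proof.
elim=> {i x} [x xg|m x g mx IH gg|m x mx IH] j y jn yb; first exact: bracket_gen.
- have yI : I j y by apply: inspan_pow yb; apply: bdelta.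
  set a := dif x in IH *; set h := dif g.
  set d := dif [~ x, g]%g; pose d' := a * h - h * a.
  have dd : I m.+2 (d - d').
    by have := gdif_commg (jset_gdelta mx) (gdelta1 g); rewrite addn1.
  rewrite (bracketDl d d' y).
  apply: inspanD.
    apply: inspan_ideal; apply: idealB; first exact: (ideal_powM dd yI).
    by apply: (ideal_pow_leq _ (ideal_powM yI dd)); lia.
  rewrite /d' jacobi; apply: inspanB.
    rewrite addSnnS; apply: IH; first by rewrite -addSnnS.
    by apply: bracket_gen => //; lia.
  by apply: bracket_gen => //; apply: IH => //; lia.
- rewrite (gdifX charkp) adjoint_pchar; last exact: pchar_group_ring.
  suff h q : (q <= p)%N -> inspan b (q * m + j)%N (iter q (fun z => dif x * z - z * dif x) y) by exact: h.
  elim: q => [//|q IHq] qp; rewrite mulSn -addnA iterS; apply: IH; last by apply: IHq; exact: ltnW.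
  by apply: leq_trans jn; rewrite addnA -mulSn leq_add2r leq_mul2r qp orbT.
Qed.
End WithBasis.

(** Modulo I^(m+1), [gdelta_inL] makes g - 1 a combination of basis elements x_i - 1 of weight m,
    and a suitable product h of powers of the x_i has the same leading term. *)
Lemma gdelta_step m (g : G) : (0 < m)%N -> gdelta k m g ->
  exists2 h, gammap p m h & gdelta k m.+1 (g * h^-1)%g.
Proof.
move=> m0 gm; have p1 := prime_gt1 p_prime.
have [b [ub fb bJ bS]] := jset_basis m.
pose x0 := (0%N, 1%g : G).
have bd y : y \in b -> gdelta k y.1 y.2 by move=> /bJ /jset_gdelta.
have wE i : (i < size b)%N -> jset (jw b i) (nth x0 b i).2.
  by move=> ib; apply: bJ; apply: mem_nth.
have [c cI] : inL b m (dif g).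
  apply: (gdelta_inL (n := m) charkp) => //.
  - by move=> i /wE /jset_gt0.
  - by move=> i /wE /jset_gdelta.
  - move=> i j ib jb ij; apply/inspanP => //; 
    have h := inspan_mem 'F_p ub (mem_nth x0 jb).
    exact: (bracket_jset ub bJ bS (wE i ib) ij h).
  - move=> i ib pi; apply/inspanP => //; rewrite /je -(gdifX charkp).
    by apply: bS => //; apply/jset_exp/wE.
  - move=> h; apply/inspanP => //.
    apply: (gensP (H := [set x | inspan b 1 (dif x)])) => [|x xg]; last by apply: bS; [|exact: jset_gen].
    split=> [|x y xb yb]; rewrite /mkset; first by rewrite gdif1; apply/inspan_ideal/ideal0.
    have E z u : inspan b 1 (dif z) -> inspan b 1 u -> I 2 (dif z * u) -> inspan b 1 (dif z + u + dif z * u).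
      by move=> zb ub' zu; apply: inspanD; [apply: inspanD|apply: inspan_ideal].
    have yVb : inspan b 1 (dif y^-1%g).
      have -> : dif y^-1%g = - dif y - dif y * dif y^-1%g.
        by rewrite {1}gdifV gr_gdif mulrDr mulr1 opprD.
      apply: inspanB; first exact: inspanN.
      by apply: inspan_ideal; apply: (@ideal_powM _ _ 1 1); apply: gdif_pow1.
    rewrite gdifM; apply: E => //; apply: (@ideal_powM _ _ 1 1); exact: gdif_pow1.
  - move=> m' c _ cI i ib wi.
    pose c' (y : nat * G) := c (index y b).
    have := @fb m' c'; rewrite (big_nth x0) big_mkord.
    rewrite (eq_bigr (fun i : 'I_(size b) => c i *: je k b i)); last first.
      by move=> j _; rewrite /c' index_uniq.
    move/(_ cI (nth x0 b i) (mem_nth _ ib) wi); by rewrite /c' index_uniq.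
(* The coefficients, being in F_p, are read as exponents. *)
pose h := (\prod_(i < size b | jw b i == m) (nth x0 b i).2 ^+ (c i : nat))%g.
have [hp hI] : gammap p m h /\ I m.+1 (dif h - \sum_(i < size b | jw b i == m) c i *: je k b i).
  rewrite /h; elim/big_rec2: _ => [|i x y /eqP wi [yp yI]].
    by split; [exact: (subgroup1 (@gammap_subgroup G p p1 m))|rewrite gdif1 subrr; apply: ideal0].
  have ip : gammap p m (nth x0 b i).2 by rewrite -wi; apply/jset_gammap/wE/ltn_ord.
  have ipn q : gammap p m ((nth x0 b i).2 ^+ q)%g by apply: subgroupX ip; apply: gammap_subgroup.
  split; first by apply: subgroupM => //; apply: gammap_subgroup.
  have mm : (m.+1 <= m + m)%N by rewrite -addn1 leq_add2l.
  have dI z u : gammap p m z -> gammap p m u -> I m.+1 (dif (z * u)%g - (dif z + dif u)).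
    move=> /(gammap_gdelta charkp) zd /(gammap_gdelta charkp) ud.
    by apply: (ideal_pow_leq mm); apply: gdifM_congr.
  have qI q : I m.+1 (dif ((nth x0 b i).2 ^+ q)%g - q%:R *: je k b i).
    elim: q => [|q IH]; first by rewrite gdif1 scale0r subrr; apply: ideal0.
    rewrite expgS; apply: (ideal_subKA (dI _ _ ip (ipn q))).
    have -> : q.+1%:R *: je k b i = je k b i + q%:R *: je k b i.
      by rewrite -[q.+1]add1n natrD scalerDl scale1r.
    by rewrite opprD addrACA subrr add0r.
  apply: (ideal_subKA (dI _ _ (ipn _) yp)).
  have hq := qI (c i).
  have cE : ((c i : nat)%:R : 'F_p) = c i by exact: natr_Zp.
  rewrite cE in hq.
  have E (z u v t : kG) : z + u - (v + t) = (z - v) + (u - t) by rewrite opprD addrACA.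
  rewrite E; exact: (idealD hq yI).
exists h => //; rewrite /gdelta /mkset.
have -> : dif (g * h^-1)%g = (dif g - dif h) * gr_gen k h^-1%g.
  by rewrite /gdif opprB addrA subrK mulrBl -!gr_genM mulgV.
apply: idealMr; apply: (ideal_subKA cI); rewrite -opprB; exact: (idealN hI).
Qed.

Lemma gdelta_steps n (g : G) N : (0 < n)%N -> gdelta k n g ->
  exists2 h, gammap p n h & gdelta k (n + N)%N (g * h^-1)%g.
Proof.
have p1 := prime_gt1 p_prime; move=> n0 gn; elim: N => [|N [h hn ghN]].
  exists 1%g; first exact: (subgroup1 (@gammap_subgroup G p p1 n)).
  by rewrite addn0 invg1 mulg1.
have [|h' h'n h'N] := gdelta_step _ ghN; first by rewrite addn_gt0 n0.
exists (h' * h)%g.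
  apply: subgroupM => //; first exact: gammap_subgroup.
  by apply: gammap_leq h'n => //; apply: leq_addr.
by rewrite addnS invgM mulgA.
Qed.
End RestrictedLieGenerators.

(** * Nilpotence of the augmentation ideal modulo gamma_(n,p) *)

Lemma ideal_pow_add_sub (A : pzRingType) (I K : ideal A) m n :
  (forall x y, ideal_pow I m x -> ideal_pow I n y -> K (x * y)) -> ideal_pow I (m + n)%N `<=` K.
Proof.
elim: n K => [|n IH] K h.
  by rewrite addn0 => x xI; rewrite -[x]mulr1; apply: h.
(* An ideal quotient: I^(m+n+1) lies in [K] once I^(m+n) lies in [K']. *)
pose K' := [set x | forall y, I y -> K (x * y)].
have K'i : ideal_axiom K'.
  split=> [y _|x y hx hy z zI|a x hx y yI|a x hx y yI].
  - by rewrite mul0r; apply: ideal0.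
  - by rewrite mulrBl; apply: idealB; [apply: hx|apply: hy].
  - by rewrite -mulrA; apply: idealMl; apply: hx.
  - by rewrite -mulrA; apply: hx; apply: idealMl.
rewrite addnS; apply: ideal_gen_sub => _ [x xI [y yI <-]].
suff : ideal_pow I (m + n)%N `<=` Ideal K'i by move/(_ x xI)/(_ y yI).
apply: IH => u v uI vI z zI; rewrite -mulrA; apply: h => //.
by apply: sub_gen_smallest; exists v => //; exists z.
Qed.

(** The largest two-sided ideal inside the kernel of f. It serves to show that an additive but not
    multiplicative map vanishes on an ideal given by generators. *)
Lemma two_sided_kernel (A : pzRingType) (Z : zmodType) (f : A -> Z) :
  (forall x y, f (x - y) = f x - f y) -> ideal_axiom [set y | forall u v, f (u * y * v) = 0].
Proof.
move=> fB; have f0 : f 0 = 0 by rewrite -[X in f X](subrr 0) fB subrr.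
split=> [u v|x' y hx hy u v|a x' hx u v|a x' hx u v].
- by rewrite mulr0 mul0r.
- by rewrite mulrBr mulrBl fB hx hy subr0.
- by rewrite mulrA; apply: hx.
- by rewrite mulrA -mulrA; apply: hx.
Qed.

Section Nilpotence.
Variables (k : comNzRingType) (G : groupType).
Local Notation kG := (group_ring k G).
Local Notation I := (ideal_pow (aug_ideal kG)).
Local Notation dif := (@gdif k G).
Implicit Types (X Y : set G).

Definition rel_aug X : ideal kG := ideal_gen [set dif x | x in X].

Lemma rel_aug_mem X x : X x -> rel_aug X (dif x).
Proof. by move=> Xx; apply: sub_gen_smallest; exists x. Qed.

(* The functional summing the coefficients over [X] detects membership in [X]. *)
Lemma rel_aug_gdif X g : subgroup_axiom X -> conj_closed X -> rel_aug X (dif g) -> X g.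
Proof.
move=> sX cX gX; pose f : kG -> k^o := fun x => lext (fun h => (`[<X h>]%:R : k^o)) x.
have fl : linear f by apply: lext_linear.
have fD x y : f (x + y) = f x + f y by apply: lextD.
have fB x y : f (x - y) = f x - f y by rewrite fD /f lextN.
have fE h : f (gr_gen k h) = `[<X h>]%:R by rewrite /f lextU scale1r.
pose K := [set y : kG | forall u v, f (u * y * v) = 0].
have Ki : ideal_axiom K by apply: (two_sided_kernel (f := f)); exact: fB.
have : rel_aug X `<=` Ideal Ki.
  apply: ideal_gen_sub => _ [x Xx <-] u v.
  apply: (gr_linear_ext (F1 := fun u => f (u * dif x * v)) (F2 := fun u => 0 : k^o)) => [c y z||h].
  - by rewrite !mulrDl -!scalerAl fl.
  - by move=> c y z; rewrite scaler0 addr0.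
  apply: (gr_linear_ext (F1 := fun v => f (gr_gen k h * dif x * v)) (F2 := fun v => 0 : k^o)) => [c y z||h'].
  - by rewrite mulrDr -scalerAr fl.
  - by move=> c y z; rewrite scaler0 addr0.
  rewrite /gdif mulrBr mulr1 mulrBl -!gr_genM fB !fE.
  suff -> : `[<X (h * x * h')%g>] = `[<X (h * h')%g>] by rewrite subrr.
  have -> : (h * x * h' = (h * h') * x ^ h')%g by rewrite /conjg !mulgA mulgK.
  have Xc : X (x ^ h')%g by apply: cX.
  apply/asbool_equiv_eq; split=> [hX|hX]; last exact: subgroupM.
  by rewrite -[(h * h')%g](mulgK (x ^ h')%g); apply: sX.2.
move=> /(_ _ gX) /(_ 1 1); rewrite mul1r mulr1 /gdif fB fE.
have -> : f 1 = 1.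
  transitivity (`[<X 1%g>]%:R : k^o); first exact: fE.
  by case: asboolP => // nX1; case: nX1; apply: subgroup1.
case: asboolP => // _; rewrite mulr0n sub0r => /eqP; by rewrite oppr_eq0 oner_eq0.
Qed.

(* [rel_aug X] is the kernel of [kG -> k[G/X]] when [X] is normal; the second clause
   says that [X] has finite index. *)
Definition good X := (exists N, I N `<=` rel_aug X) /\
  exists T : seq G, forall g, exists2 t, t \in T & X (t^-1 * g)%g.

Lemma good_setT : good [set: G].
Proof.
split; last by exists [:: 1%g] => g; exists 1%g; rewrite ?inE.
exists 1%N; apply: ideal_pow_aug_ind => [|x y|y g _].
- exact: ideal0.
- exact: idealD.
- by apply: idealMl; exact: rel_aug_mem.
Qed.

Section Step.
Variables (p : nat) (p_gt0 : (0 < p)%N) (charkp : p \in [pchar k]).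
Variables (X : set G) (z : G).
Hypothesis sX : subgroup_axiom X.
Hypothesis Xz : forall g, X [~ g, z]%g.
Hypothesis Xzp : X (z ^+ p)%g.

Let Y : set G := [set y | exists i x, X x /\ y = (z ^+ i * x)%g].

Lemma rel_aug_central a i : rel_aug X (a * dif z ^+ i - dif z ^+ i * a).
Proof.
have h b : rel_aug X (b * dif z - dif z * b).
  elim/gr_ind: b => [|x y IHx IHy|c x IH|g].
  - by rewrite mulr0 mul0r subrr; apply: ideal0.
  - rewrite (mulrDl x y) (mulrDr (dif z)) opprD addrACA; exact: (idealD IHx IHy).
  - by rewrite -(scalerAl c x) -(scalerAr c _ x) -scalerBr; apply: idealZ.
  have -> : gr_gen k g * dif z - dif z * gr_gen k g = gr_gen k (z * g)%g * dif [~ g, z]%g.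
    rewrite -gdif_comm /gdif; move: (gr_gen k g) (gr_gen k z) => x y.
    by rewrite commrB1_sub mulrBr mulrBl mul1r mulr1 opprB addrA subrK.
  by apply: idealMl; exact: rel_aug_mem.
elim: i => [|i IH]; first by rewrite expr0 mulr1 mul1r subrr; apply: ideal0.
rewrite exprS !mulrA; apply: (@ideal_subKA _ _ (dif z * a * dif z ^+ i)).
  by rewrite -mulrBl; apply: idealMr.
by rewrite -!mulrA -mulrBr; apply: idealMl.
Qed.

(** The sum of [rel_aug X] and (z - 1)^i kG, two-sided because z - 1 is central modulo
    [rel_aug X]. *)
Let W i := [set u : kG | exists v, rel_aug X (u - dif z ^+ i * v)].

Lemma W_ideal i : ideal_axiom (W i).
Proof.
split=> [|u u' [v h] [v' h']|a u [v h]|a u [v h]].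
- by exists 0; rewrite mulr0 subrr; apply: ideal0.
- exists (v - v'); have E (x y s t : kG) : x - y - (s - t) = (x - s) - (y - t).
    by rewrite !opprD !opprK addrACA.
  by rewrite mulrBr E; apply: idealB.
- exists (a * v); rewrite mulrA; apply: (@ideal_subKA _ _ (a * (dif z ^+ i * v))).
    by rewrite -mulrBr; apply: idealMl.
  by rewrite mulrA -mulrBl; apply: idealMr; apply: rel_aug_central.
- by exists (v * a); rewrite mulrA -mulrBl; apply: idealMr.
Qed.

(** Some I^N lies in [rel_aug Y], hence in [W 1]. By centrality of z - 1, the power I^(N p) lies in
    [W p], and (z - 1)^p = z^p - 1 is in [rel_aug X]. For the index, the t z^i with i < p represent
    the cosets of X. *)
Lemma good_step : good Y -> good X.
Proof.
move=> [[N NY] [T TY]]; split; last first.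
  exists [seq (t * z ^+ i)%g | t <- T, i <- iota 0 p] => g.
  have [t tT [i [x [Xx E]]]] := TY g.
  exists (t * z ^+ (i %% p))%g.
    by apply: allpairs_f => //; rewrite mem_iota add0n ltn_mod.
  rewrite invgM -mulgA E.
  have -> : (z ^+ i = z ^+ (i %% p) * (z ^+ p) ^+ (i %/ p))%g.
    by rewrite -expgnA -expgnDr mulnC addnC -divn_eq.
  rewrite !mulgA mulVg mul1g.
  by apply: subgroupM => //; apply: subgroupX.
exists (N * p)%N; have YW : rel_aug Y `<=` Ideal (W_ideal 1).
  apply: ideal_gen_sub => _ [_ [i [x [Xx ->]]] <-].
  have [v v_def] : exists v, dif (z ^+ i)%g = dif z * v.
    elim: i => [|i [v IH]]; first by exists 0; rewrite gdif1 mulr0.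
    exists (gr_gen k (z ^+ i)%g + v); rewrite expgS mulrDr -IH /gdif gr_genM.
    by rewrite mulrBl mul1r addrA subrK.
  exists (v + v * dif x).
  rewrite expr1 (gdifM k (z ^+ i)%g x) v_def.
  have E (a b c : kG) : a * b + c + a * b * c - a * (b + b * c) = c.
    rewrite mulrDr (mulrA a); move: (a * b) (a * b * c) => P Q.
    by rewrite [P + c]addrC -(addrA c) addrK.
  by rewrite E; exact: rel_aug_mem.
suff h i : I (N * i)%N `<=` W i.
  move=> u /h [v uv]; rewrite -[u](subrK (dif z ^+ p * v)); apply: idealD => //.
  by apply: idealMr; rewrite -(gdifX charkp); apply: rel_aug_mem.
elim: i => [|i IH].
  by move=> u _; exists u; rewrite expr0 mul1r subrr; apply: ideal0.
rewrite mulnSr; suff : I (N * i + N)%N `<=` Ideal (W_ideal i.+1) by [].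
apply: ideal_pow_add_sub => x y /IH [v xv] /NY /YW [v' yv'].
exists (v * v'); apply: (@ideal_subKA _ _ (dif z ^+ i * v * y)).
  by rewrite -mulrBl; apply: idealMr.
apply: (@ideal_subKA _ _ (dif z ^+ i * v * (dif z ^+ 1 * v'))).
  by rewrite -mulrBr; apply: idealMl.
have := rel_aug_central v 1; rewrite expr1 exprSr.
move: (dif z) => d; set a := d ^+ i => vd.
have -> : a * v * (d * v') - a * d * (v * v') = a * ((v * d - d * v) * v').
  by rewrite mulrBl mulrBr !mulrA.
by apply/idealMl/idealMr.
Qed.
End Step.
End Nilpotence.

Section CentralExtension.
Variables (G : groupType) (X : set G).
Hypotheses (sX : subgroup_axiom X) (cX : conj_closed X).
Local Open Scope group_scope.

Lemma central_expgM t c i : (forall g, X [~ c, g]) ->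
  exists2 u, X u & (t * c) ^+ i = t ^+ i * c ^+ i * u.
Proof.
move=> Xc; elim: i => [|i [u Xu IH]].
  by exists 1; [exact: subgroup1|rewrite !expg0 !mulg1].
exists ([~ c, t ^+ i] ^ (c ^+ i) * u); first by apply: subgroupM => //; apply: cX.
rewrite expgS IH [t ^+ i.+1]expgS [c ^+ i.+1]expgS /conjg /commg /conjg.
by rewrite !mulgA !mulgK.
Qed.
End CentralExtension.

Section Chain.
Variables (k : comNzRingType) (p : nat) (charkp : p \in [pchar k]).
Variables (G : groupType) (K K' : set G).
Hypothesis sK : subgroup_axiom K.
Hypothesis (KC : forall x g, K x -> K' [~ x, g]%g).
Hypothesis (KX : forall x, K x -> K' (x ^+ p)%g).

(** K / K' is central and of exponent p, so every subgroup in between is normal. Adjoining the [zs]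
    one at a time climbs from X to K, and [good_step] descends each step. *)
Lemma good_chain (zs : seq G) (X : set G) : subgroup_axiom X -> K' `<=` X -> X `<=` K ->
  (forall z, z \in zs -> K z) ->
  (forall H, subgroup_axiom H -> X `<=` H -> (forall z, z \in zs -> H z) -> K `<=` H) ->
  good k K -> good k X.
Proof.
have p_gt0 : (0 < p)%N by apply: prime_gt0; apply: (pcharf_prime charkp).
elim: zs X => [|z zs IH] X sX K'X XK zsK H gK.
  by have -> : X = K by apply/seteqP; split=> //; apply: H.
have Kz : K z by apply: zsK; rewrite inE eqxx.
have cX : conj_closed X.
  move=> x y Xx; rewrite -[(x ^ y)%g](mulVKg x); apply: subgroupM => //.
  by apply: K'X; rewrite -/(commg x y); apply: KC; apply: XK.
have Xz g : X [~ g, z]%g by rewrite -[[~ g, z]%g]invgK invgR; apply: subgroupV => //; apply: K'X; apply: KC.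
have Xzp : X (z ^+ p)%g by apply/K'X/KX.
apply: (good_step p_gt0 charkp sX Xz Xzp); apply: IH => //.
- split=> [|_ _ [i [x [Xx ->]]] [j [y [Xy ->]]]].
    by exists 0%N, 1%g; split; [exact: subgroup1|rewrite expg0 mulg1].
  (* Only natural powers of z are allowed, so z^(-j) is written as z^(j(p-1)) (z^p)^(-j). *)
  exists (i + j * p.-1)%N, ((z ^+ p)^-1 ^+ j * (x * y^-1) ^ (z ^- j))%g; split.
    apply: subgroupM => //; first by apply: subgroupX => //; apply: subgroupV.
    by apply: cX; apply: sX.2.
  have -> : (z ^+ (i + j * p.-1) = z ^+ i * (z ^- j * (z ^+ p) ^+ j))%g.
    rewrite expgnDr; congr (_ * _)%g; rewrite -expgnA -{2}(prednK p_gt0) mulSn expgnDr mulKg.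
    by rewrite mulnC.
  by rewrite invgM expVgn /conjg invgK !mulgA mulgK mulgVK.
- by move=> x K'x; exists 0%N, x; split; [exact: K'X|rewrite expg0 mul1g].
- by move=> _ [i [x [Xx ->]]]; apply: subgroupM => //; [exact: subgroupX|exact: XK].
- by move=> t tz; apply: zsK; rewrite inE tz orbT.
move=> H' sH' YH' zsH'; apply: H => //.
  by move=> x Xx; apply: YH'; exists 0%N, x; rewrite expg0 mul1g.
move=> t; rewrite inE => /orP [/eqP ->|]; last exact: zsH'.
by apply: YH'; exists 1%N, 1%g; split; [exact: subgroup1|rewrite expg1 mulg1].
Qed.
End Chain.

Section FinitelyGenerated.
Variables (p : nat) (p_prime : prime p) (G : groupType) (gens : seq G).
Hypothesis gensP : forall H : set G, subgroup_axiom H -> (forall x, x \in gens -> H x) -> forall g, H g.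
Local Notation k := 'F_p.
Let p1 : (1 < p)%N := prime_gt1 p_prime.
Let charkp : p \in [pchar k].
Proof. exact: pchar_Fp. Qed.
Let gs n : subgroup_axiom (@gammap G p n) := @gammap_subgroup G p p1 n.
Let gc n : conj_closed (@gammap G p n) := @gammap_conj G p p1 n.

(** Modulo gamma_(n+1,p), the commutators and p-th powers generating gamma_(n,p) depend only on
    classes modulo gamma_(n,p). A finite transversal thus gives finitely many generators of the
    layer. *)
Lemma gammap_transversal_gen n (T : seq G) (H : set G) :
  (1 < n)%N -> (forall g, exists2 t, t \in T & gammap p n (t^-1 * g)%g) ->
  subgroup_axiom H -> @gammap G p n.+1 `<=` H ->
  (forall t t', t \in T -> t' \in T -> gammap p n.-1 t -> H [~ t, t']%g) ->
  (forall t, t \in T -> gammap p n (t ^+ p)%g -> H (t ^+ p)%g) ->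
  @gammap G p n `<=` H.
Proof.
move=> n1 TP sH nH HC HX; apply: gammap_min => // [x y xn|m x nm mn xm].
  have [t tT xt] := TP x; have [t' tT' yt] := TP y.
  have tn : gammap p n.-1 t.
    rewrite -[t]invgK -[t^-1%g](mulgK x); apply: subgroupV => //; apply: subgroupM => //.
      by apply: (gammap_leq p1) xt; lia.
    exact: subgroupV.
  have ttn : gammap p n [~ t, t']%g by rewrite -(prednK (ltnW n1)); apply: gammap_commg.
  rewrite -[x](mulVKg t) -[y](mulVKg t'); move: (t^-1 * x)%g (t'^-1 * y)%g xt yt => c c' cn c'n.
  have h1 : H [~ t, c']%g.
    by apply: nH; rewrite -invgR; apply: subgroupV => //; apply: gammap_commg.
  have h2 : H ([~ t, t'] ^ c')%g.
    rewrite -[([~ t, t'] ^ c')%g](mulVKg [~ t, t']%g); apply: subgroupM => //; first exact: HC.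
    by apply: nH; rewrite -commgEl; apply: gammap_commg.
  have h3 : H ([~ t, t' * c']%g).
    have -> : ([~ t, t' * c'] = [~ t, c'] * [~ t, t'] ^ c')%g.
      by rewrite /commg /conjg !invgM !mulgA !mulgK; congr (_ * _ * _)%g; rewrite !mulgA ?mulgK ?mulgVK.
    exact: subgroupM.
  have h4 : gammap p n [~ t, t' * c']%g.
    by rewrite -(prednK (ltnW n1)); apply: gammap_commg.
  have -> : ([~ t * c, t' * c'] = [~ t, t' * c'] ^ c * [~ c, t' * c'])%g.
    move: (t' * c')%g => z; rewrite /commg /conjg !invgM !mulgA !mulgK.
    by rewrite ?mulgK ?mulgVK.
  apply: subgroupM => //; last by apply: nH; apply: gammap_commg.
  rewrite -[([~ t, t' * c'] ^ c)%g](mulVKg [~ t, t' * c']%g); apply: subgroupM => //.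
  by apply: nH; rewrite -commgEl; apply: gammap_commg.
have [t tT xt] := TP x.
have tm : gammap p m t.
  rewrite -[t]invgK -[t^-1%g](mulgK x); apply: subgroupV => //; apply: subgroupM => //.
    by apply: (gammap_leq p1) xt; lia.
  exact: subgroupV.
rewrite -[x](mulVKg t); move: (t^-1 * x)%g xt => c cn.
have [u un ->] := central_expgM (gs n.+1) (@gc n.+1) t p (fun g => gammap_commg p1 g cn).
apply: subgroupM => //; last exact: nH.
apply: subgroupM => //; first by apply: HX => //; apply: gammap_expg tm.
by apply: nH; apply: gammap_expg cn => //; nia.
Qed.

(** The finite index contained in [good] supplies the transversal for the next layer; the first
    layer is generated by [gens]. *)
Lemma good_gammap n : good k (@gammap G p n.+1).
Proof.
elim: n => [|n IH]; first exact: good_setT.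
have [zs zsK zsP] : exists2 zs : seq G, (forall z, z \in zs -> gammap p n.+1 z) &
    forall H : set G, subgroup_axiom H -> @gammap G p n.+2 `<=` H ->
    (forall z, z \in zs -> H z) -> @gammap G p n.+1 `<=` H.
  case: n IH => [|n] IH.
    by exists gens => // H sH _ h g _; apply: gensP.
  have [_ [T TP]] := IH.
  exists ([seq [~ t, t']%g | t <- [seq t <- T | `[<gammap p n.+1 t>]], t' <- T] ++
          [seq (t ^+ p)%g | t <- T & `[<gammap p n.+2 (t ^+ p)%g>]]).
    move=> z; rewrite mem_cat => /orP [/allpairsP [[t t'] /= [tT t'T ->]]|/mapP [t tT ->]].
      by move: tT; rewrite mem_filter => /andP [/asboolP tn _]; apply: gammap_commg.
    by move: tT; rewrite mem_filter => /andP [/asboolP].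
  move=> H sH nH HT; apply: (gammap_transversal_gen _ TP) => // [t t' tT t'T tn|t tT tn].
    apply: HT; rewrite mem_cat; apply/orP; left; apply: allpairs_f => //.
    by rewrite mem_filter tT andbT; apply/asboolP.
  apply: HT; rewrite mem_cat; apply/orP; right; apply: map_f.
  by rewrite mem_filter tT andbT; apply/asboolP.
have KC x g : gammap p n.+1 x -> @gammap G p n.+2 [~ x, g]%g by apply: gammap_commg.
have KX x : gammap p n.+1 x -> @gammap G p n.+2 (x ^+ p)%g by apply: gammap_expg => //; nia.
apply: (good_chain charkp (gs n.+1) KC KX (zs := zs)) => //.
by apply: gammap_leq => //; lia.
Qed.

Theorem jennings_lazard n : (0 < n)%N -> gdelta k n `<=` @gammap G p n.
Proof.
case: n => // n _ g gn.
have [[N NX] _] := good_gammap n.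
have [h hn ghN] := gdelta_steps p_prime gensP N (ltn0Sn n) gn.
rewrite -[g](mulgVK h); apply: subgroupM => //; apply: (rel_aug_gdif (gs _) (@gc _)).
by apply: NX; move: ghN; apply: gdelta_leq; rewrite leq_addl.
Qed.
End FinitelyGenerated.

(** * Monomials in partially commuting variables *)

Lemma sum_scalerB (k : pzRingType) (M : lmodType k) (T : Type) (s : seq (k * T)) (f : k * T -> M) (w : M) :
  \sum_(a <- s) a.1 *: (f a - w) = \sum_(a <- s) a.1 *: f a - (\sum_(a <- s) a.1) *: w.
Proof.
by rewrite scaler_suml -sumrB; apply: eq_bigr => a _; rewrite scalerBr.
Qed.

Section TraceEquivalence.
Variables (V : choiceType) (E : rel V).
Implicit Types (w t : seq V).

(* The classes of [teq] are the monomials in partially commuting variables. *)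
Inductive teq : seq V -> seq V -> Prop :=
| teq_refl (u : seq V) : teq u u
| teq_sym (u : seq V) w : teq u w -> teq w u
| teq_trans (u v : seq V) w : teq u v -> teq v w -> teq u w
| teq_swap s x y s' of E x y : teq (s ++ x :: y :: s') (s ++ y :: x :: s').

Lemma teq_inv (T : Type) (f : seq V -> T) :
  (forall s x y s', E x y -> f (s ++ x :: y :: s') = f (s ++ y :: x :: s')) ->
  forall (u : seq V) w, teq u w -> f u = f w.
Proof.
by move=> h u w; elim=> [//|//|{}u v {}w _ -> //|s x y s' xy]; apply: h.
Qed.

Lemma teq_size (u : seq V) w : teq u w -> size u = size w.
Proof. by apply: teq_inv => s x y s' _; rewrite !size_cat. Qed.

Lemma teq_class (u : seq V) w : teq u w -> teq u = teq w.
Proof.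
move=> uw; apply: funext => t; apply: propext; split; last exact: teq_trans.
by apply: teq_trans; apply: teq_sym.
Qed.

Variable k : comNzRingType.
Local Notation F := (free_alg k V).

Definition free_word w : F := mkmalgU (FMonom w) 1.

Lemma free_word0 : free_word [::] = 1.
Proof. by rewrite -[RHS]/(mkmalgU (fmone V) 1) fmoneE. Qed.

Lemma free_wordM (u : seq V) w : free_word (u ++ w) = free_word u * free_word w.
Proof.
rewrite -[RHS]/(fgmul _ _) fgmulUU mulr1 /free_word; congr mkmalgU.
by rewrite -[mmul _ _]/(fmmul _ _) fmmulE.
Qed.

Lemma free_word1 v : free_word [:: v] = free_gen k v.
Proof. by rewrite /free_word /free_gen fmuE. Qed.

Definition lcomb (s : seq (k * seq V)) : F := \sum_(a <- s) a.1 *: free_word a.2.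

Lemma lcomb_exists x : exists s, x = lcomb s.
Proof.
elim/free_indU: x => [|_ _ [s ->] [s' ->]|c m].
- by exists [::]; rewrite /lcomb big_nil.
- by exists (s ++ s'); rewrite /lcomb big_cat.
- by exists [:: (c, m : seq V)]; rewrite /lcomb big_seq1 /free_word -mkmalgUZ fmK.
Qed.

Lemma lcomb_cat s s' : lcomb (s ++ s') = lcomb s + lcomb s'.
Proof. by rewrite /lcomb big_cat. Qed.

Lemma lcombM s s' :
  lcomb [seq (a.1 * b.1, a.2 ++ b.2) | a <- s, b <- s'] = lcomb s * lcomb s'.
Proof.
rewrite /lcomb big_allpairs_dep mulr_suml; apply: eq_bigr => a _.
rewrite mulr_sumr; apply: eq_bigr => b _ /=.
by rewrite free_wordM -scalerAl -scalerAr scalerA.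
Qed.

Lemma lcombN s : lcomb [seq (- a.1, a.2) | a <- s] = - lcomb s.
Proof. by rewrite /lcomb big_map -sumrN; apply: eq_bigr => a _; rewrite scaleNr. Qed.

(* The coefficient at the monomial represented by [t]. *)
Definition tcoef t (x : F) : k^o := lext (fun m : {fmonom V} => (`[<teq m t>]%:R : k^o)) x.

Lemma tcoefD t x y : tcoef t (x + y) = tcoef t x + tcoef t y.
Proof. exact: lextD. Qed.
Lemma tcoef0 t : tcoef t 0 = 0.
Proof. exact: lext0. Qed.
Lemma tcoefZ t c x : tcoef t (c *: x) = c * tcoef t x.
Proof. exact: lextZ. Qed.
Lemma tcoefN t x : tcoef t (- x) = - tcoef t x.
Proof. exact: lextN. Qed.
Lemma tcoefB t x y : tcoef t (x - y) = tcoef t x - tcoef t y.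
Proof. by rewrite tcoefD tcoefN. Qed.
Lemma tcoef_word t w : tcoef t (free_word w) = `[<teq w t>]%:R.
Proof. by rewrite /tcoef lextU scale1r. Qed.

Lemma tcoef_lcomb t s : tcoef t (lcomb s) = \sum_(a <- s) a.1 * `[<teq a.2 t>]%:R.
Proof.
rewrite /lcomb; elim: s => [|a s IH]; first by rewrite !big_nil tcoef0.
by rewrite !big_cons tcoefD tcoefZ tcoef_word IH.
Qed.

(** The extension of f is not multiplicative, so its vanishing is checked on all multiples a (vw -
    wv) b through [two_sided_kernel]. *)
Lemma lext_pc_ideal (Z : lmodType k) (f : seq V -> Z) x :
  (forall s i j s', E i j -> f (s ++ i :: j :: s') = f (s ++ j :: i :: s')) ->
  pc_ideal E k x -> lext (fun m : {fmonom V} => f m) x = 0.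
Proof.
move=> fE; pose L := lext (fun m : {fmonom V} => f m).
have LD y z : L (y + z) = L y + L z by apply: lextD.
have LB y z : L (y - z) = L y - L z by rewrite LD /L lextN.
have Ll s : L (lcomb s) = \sum_(a <- s) a.1 *: f a.2.
  rewrite /lcomb; elim: s => [|a s IH]; first by rewrite !big_nil; apply: lext0.
  by rewrite !big_cons LD IH /L lextZ lextU scale1r.
pose K := [set y : F | forall u v : F, L (u * y * v) = 0].
have Ki : ideal_axiom K by apply: (two_sided_kernel (f := L)); exact: LB.
move=> xpc; suff /(_ _ xpc 1 1) : pc_ideal E k `<=` Ideal Ki by rewrite mul1r mulr1.
apply: ideal_gen_sub => _ [v [w [vw ->]]] a b.
have [s ->] := lcomb_exists a; have [s' ->] := lcomb_exists b.
have vwE (i j : V) : free_gen k i * free_gen k j = lcomb [:: (1, [:: i; j])].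
  by rewrite /lcomb big_seq1 scale1r (free_wordM [:: i] [:: j]) 2!free_word1.
rewrite (vwE v w) (vwE w v) (mulrBr (lcomb s)) (mulrBl (lcomb s')) -!lcombM.
rewrite LB !Ll !big_allpairs_dep -sumrB big1 // => -[c u] _.
rewrite !big_seq1 -sumrB big1 // => -[d u'] _ /=.
by rewrite -!catA /= (fE _ _ _ _ vw) subrr.
Qed.

Lemma tcoef_pc_ideal t x : pc_ideal E k x -> tcoef t x = 0.
Proof.
apply: (lext_pc_ideal (Z := k^o) (f := fun m => (`[<teq m t>]%:R : k^o))) => s i j s' ij.
by rewrite (teq_class (teq_swap s s' ij)).
Qed.

Lemma teq_pc_ideal (u : seq V) w : teq u w -> pc_ideal E k (free_word u - free_word w).
Proof.
elim=> [{}u|{}u {}w _ IH|{}u v {}w _ IH1 _ IH2|s x y s' xy].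
- by rewrite subrr; apply: ideal0.
- by rewrite -opprB; apply: idealN.
- exact: ideal_subKA IH1 IH2.
have E1 (i j : V) : free_word (s ++ i :: j :: s') =
    free_word s * ((free_gen k i * free_gen k j) * free_word s').
  rewrite (free_wordM s (i :: j :: s')) (free_wordM [:: i; j] s') (free_wordM [:: i] [:: j]).
  by rewrite 2!free_word1.
rewrite (E1 x y) (E1 y x) -(mulrBr (free_word s)) -(mulrBl (free_word s')).
apply/idealMl/idealMr.
by apply: sub_gen_smallest; exists x, y.
Qed.

Definition spans (J : seq V -> Prop) (x : F) :=
  exists2 s, (forall a, a \in s -> J a.2) & x = lcomb s.

Lemma spans_word (J : seq V -> Prop) w c : J w -> spans J (c *: free_word w).
Proof.
by move=> Jw; exists [:: (c, w)]; [move=> a; rewrite inE => /eqP ->|rewrite /lcomb big_seq1].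
Qed.

Lemma spans0 J : spans J 0.
Proof. by exists [::]; rewrite // /lcomb big_nil. Qed.

Lemma spansD J x y : spans J x -> spans J y -> spans J (x + y).
Proof.
move=> [s Js ->] [s' Js' ->]; exists (s ++ s'); last by rewrite lcomb_cat.
by move=> a; rewrite mem_cat => /orP [/Js|/Js'].
Qed.

Lemma spansN J x : spans J x -> spans J (- x).
Proof.
move=> [s Js ->]; exists [seq (- a.1, a.2) | a <- s]; last by rewrite lcombN.
by move=> _ /mapP [a /Js ? ->].
Qed.

Lemma spansT x : spans (fun _ => True) x.
Proof. by have [s ->] := lcomb_exists x; exists s. Qed.

Lemma spansM (J1 J2 J : seq V -> Prop) x y :
  (forall (u : seq V) w, J1 u -> J2 w -> J (u ++ w)) -> spans J1 x -> spans J2 y -> spans J (x * y).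
Proof.
move=> JJ [s Js ->] [s' Js' ->]; eexists; last by rewrite -lcombM.
by move=> _ /allpairsP [[a b] /= [/Js ? /Js' ? ->]]; apply: JJ.
Qed.

Lemma spans_mono (J1 J2 : seq V -> Prop) x : (forall u, J1 u -> J2 u) -> spans J1 x -> spans J2 x.
Proof. by move=> JJ [s Js ->]; exists s => // a /Js /JJ. Qed.

Lemma spans_coef0 J t x : (forall u, J u -> ~ teq u t) -> spans J x -> tcoef t x = 0.
Proof.
move=> Jt [s Js ->]; rewrite tcoef_lcomb big_seq big1 // => a /Js /Jt at_.
by rewrite asboolF // mulr0.
Qed.

(** Short words are removed one class at a time. The coefficients of a class have sum 0, so its part
    is a combination of differences of equivalent words, which lie in [pc_ideal]. *)
Lemma tcoef0_spans n x : (forall t, (size t < n)%N -> tcoef t x = 0) ->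
  exists2 y, spans (fun u => n <= size u)%N y & pc_ideal E k (x - y).
Proof.
have [s ->] := lcomb_exists x.
have [m] := ubnP (size s); elim: m s => // m IH s /ltnSE sm hs.
have [/hasP [[c w] ws /= wn]|/hasPn h] := boolP (has (fun a : k * seq V => size a.2 < n)%N s); last first.
  exists (lcomb s); first by exists s => // a /h; rewrite -leqNgt.
  by rewrite subrr; apply: ideal0.
pose P (a : k * seq V) := `[<teq a.2 w>].
have sP : lcomb s = lcomb (filter P s) + lcomb (filter (predC P) s).
  by rewrite /lcomb (bigID P) /= !big_filter.
have h1 : pc_ideal E k (lcomb (filter P s)).
  have cw0 : \sum_(a <- filter P s) a.1 = 0.
    rewrite -[RHS](hs w wn) tcoef_lcomb big_filter [LHS]big_mkcond.
    apply: (eq_bigr (R := k)) => a _.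
    by rewrite /P; case: asboolP => _; rewrite ?mulr1 ?mulr0.
  have <- : \sum_(a <- filter P s) a.1 *: (free_word a.2 - free_word w) = lcomb (filter P s).
    by rewrite (sum_scalerB (filter P s) (fun a => free_word a.2)) cw0 scale0r subr0.
  rewrite big_seq; apply: (big_ind (pc_ideal E k)) => [|y z|a].
  - exact: ideal0.
  - exact: idealD.
  - by rewrite mem_filter => /andP [/asboolP aw _]; apply: idealZ; exact: teq_pc_ideal.
have [|t tn|y yn xy] := IH (filter (predC P) s).
- apply: leq_trans sm; rewrite size_filter -(count_predC P s) addnC -[X in (X < _)%N]addn0 ltn_add2l.
  by rewrite -has_count; apply/hasP; exists (c, w) => //; apply/asboolP/teq_refl.
- by have := hs t tn; rewrite sP tcoefD (tcoef_pc_ideal t h1) add0r.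
exists y; first exact: yn.
by rewrite sP -(addrA (lcomb (filter P s))); exact: (idealD h1 xy).
Qed.

Lemma tcoef_aug x : tcoef [::] x = aug x.
Proof.
rewrite -[aug x]/(mcoeff mone x).
elim/free_indU: x => [|x y IHx IHy|c m]; first by rewrite tcoef0 mcoeff0.
  by rewrite tcoefD IHx IHy mcoeffD.
rewrite /tcoef lextU mcoeffU -[c in RHS]mulr1 -mulrnAr -[LHS]/(c * _); congr (_ * (nat_of_bool _)%:R).
have -> : (m == mone) = (m == [::] :> seq V) by rewrite fmP fm1.
apply/idP/eqP => [/asboolP/teq_size|->]; last exact/asboolP/teq_refl.
by case: (m : seq V).
Qed.

Lemma spans_ideal n : ideal_axiom
  [set z : pc_alg E k | exists2 y, spans (fun u => n <= size u)%N y & z = qpi (pc_ideal E k) y].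
Proof.
split=> [|_ _ [y hy ->] [y' hy' ->]|a _ [y hy ->]|a _ [y hy ->]].
- by exists 0; [exact: spans0|rewrite qpi0].
- by exists (y - y'); [apply: spansD => //; apply: spansN|rewrite qpiB].
- exists (qrepr a * y); last by rewrite qpiM qreprK.
  by apply: spansM (spansT _) hy => u w _; rewrite size_cat; lia.
- exists (y * qrepr a); last by rewrite qpiM qreprK.
  by apply: spansM hy (spansT _) => u w; rewrite size_cat; lia.
Qed.

Lemma ideal_pow_spans n : ideal_pow (aug_ideal (pc_alg E k)) n `<=` Ideal (spans_ideal n).
Proof.
elim: n => [|n IH].
  by move=> z _; exists (qrepr z); [apply: spans_mono (spansT _)|rewrite qreprK].
apply: ideal_gen_sub => _ [z /IH [y hy ->] [z' z'a <-]].
have [|y' hy' /qpiP yy'] := @tcoef0_spans 1 (qrepr z').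
  by case=> // _; rewrite tcoef_aug; exact: z'a.
exists (y * y'); last by rewrite (qpiM _ y y') -yy' qreprK.
by apply: spansM hy hy' => u w; rewrite size_cat; lia.
Qed.

Lemma ideal_pow_free_word w : ideal_pow (aug_ideal (pc_alg E k)) (size w) (qpi (pc_ideal E k) (free_word w)).
Proof.
elim: w => [|v w IH]; first by [].
have -> : size (v :: w) = (1 + size w)%N by [].
rewrite (free_wordM [:: v] w) (qpiM _ (free_word [:: v])) (free_word1 v); apply: ideal_powM => //.
by apply: ideal_pow1; exact: (aug_pc_gen E k v).
Qed.

Lemma ideal_pow_coefP n x : ideal_pow (aug_ideal (pc_alg E k)) n (qpi (pc_ideal E k) x) <->
  forall t, (size t < n)%N -> tcoef t x = 0.
Proof.
split=> [/ideal_pow_spans [y hy /qpiP xy] t tn|h].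
  rewrite -[x](subrK y) tcoefD (tcoef_pc_ideal t xy) add0r.
  by apply: spans_coef0 hy => u un /teq_size; lia.
have [y [s Js ->] /qpiP ->] := tcoef0_spans h.
rewrite /lcomb (big_morph (qpi (pc_ideal E k)) (@qpiD _ _) (qpi0 _)) big_seq.
apply: (big_ind (ideal_pow (aug_ideal (pc_alg E k)) n)) => [|? ?|a /Js an].
- exact: ideal0.
- exact: idealD.
rewrite qpiZ; apply: idealZ; apply: (ideal_pow_leq an); exact: ideal_pow_free_word.
Qed.
End TraceEquivalence.

(** * Integer coefficients and change of the coefficient ring *)

Section IdealCongruences.
Variables (A : pzRingType) (I : ideal A).

Lemma ideal_subM (x g y h : A) : I (x - g) -> I (y - h) -> I (x * y - g * h).
Proof.
move=> xg yh; apply: (@ideal_subKA _ _ (g * y)).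
  by rewrite -mulrBl; apply: idealMr.
by rewrite -mulrBr; apply: idealMl.
Qed.

Lemma ideal_sub_inv (x y z : A) : x * y = 1 -> I (z * x - 1) -> I (z - y).
Proof.
move=> xy; have -> : z - y = (z * x - 1) * y by rewrite mulrBl -mulrA xy mulr1 mul1r.
exact: idealMr.
Qed.
End IdealCongruences.

Section IntegralForms.
Variables (V : choiceType).

(* Families of elements, one over each ring, with common integral coefficients. *)
Definition int_form (x : forall k : comNzRingType, free_alg k V) : Prop :=
  exists s : seq (int * seq V), forall k, x k = lcomb [seq (a.1%:~R : k, a.2) | a <- s].

Lemma int_form1 : int_form (fun k => 1).
Proof. by exists [:: (1, [::])] => k; rewrite /lcomb big_seq1 scale1r free_word0. Qed.

Lemma int_form_gen v : int_form (fun k => free_gen k v).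
Proof. by exists [:: (1, [:: v])] => k; rewrite /lcomb big_seq1 scale1r free_word1. Qed.

Lemma int_formN x : int_form x -> int_form (fun k => - x k).
Proof.
move=> [s sE]; exists [seq (- a.1, a.2) | a <- s] => k.
rewrite sE -lcombN -!map_comp; congr lcomb.
by apply: eq_map => a /=; rewrite rmorphN.
Qed.

Lemma int_formD x y : int_form x -> int_form y -> int_form (fun k => x k + y k).
Proof.
by move=> [s sE] [s' sE']; exists (s ++ s') => k; rewrite map_cat lcomb_cat sE sE'.
Qed.

Lemma int_formM x y : int_form x -> int_form y -> int_form (fun k => x k * y k).
Proof.
move=> [s sE] [s' sE']; exists [seq (a.1 * b.1, a.2 ++ b.2) | a <- s, b <- s'] => k.
rewrite sE sE' -lcombM allpairs_mapl map_allpairs; congr lcomb.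
elim: s {sE} => //= a s ->; congr (_ ++ _); rewrite -map_comp.
by apply: eq_map => b /=; rewrite rmorphM.
Qed.

Lemma int_form0 : int_form (fun k => 0).
Proof. by exists [::] => k; rewrite /lcomb big_nil. Qed.

Lemma int_form_prod (T : Type) (s : seq T) (x : T -> forall k, free_alg k V) :
  (forall i, int_form (x i)) -> int_form (fun k => \prod_(i <- s) x i k).
Proof.
move=> hx; elim: s => [|i s IH].
  by have [s' h] := int_form1; exists s' => k; rewrite big_nil.
by have [s' h] := int_formM (hx i) IH; exists s' => k; rewrite big_cons.
Qed.

Lemma int_form_geo n x : int_form x -> int_form (fun k => geo (x k) n).
Proof.
move=> hx; have hX i : int_form (fun k => (- x k) ^+ i).
  elim: i => [|i IH]; first exact: int_form1.
  by have [s h] := int_formM (int_formN hx) IH; exists s => k; rewrite exprS.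
elim: n => [|n IH]; first by have [s h] := int_form0; exists s => k; rewrite /geo big_ord0.
by have [s h] := int_formD IH (hX n); exists s => k; rewrite /geo big_ord_recr.
Qed.

(** A polynomial for mu(w) that is correct in degrees below n: the inverse of 1 + v is truncated, so
    the coefficients are integers common to all k. *)
Definition magnus_word n (w : word V) (k : comNzRingType) : free_alg k V :=
  \prod_(a <- w) (if a.2 then 1 + free_gen k a.1 else geo (free_gen k a.1) n).

Lemma magnus_word_int n w : int_form (magnus_word n w).
Proof.
have h (a : V * bool) : int_form (fun k => if a.2 then 1 + free_gen k a.1 else geo (free_gen k a.1) n).
  case: a => v [] /=; first by have [s sE] := int_formD int_form1 (int_form_gen v); exists s.
  by have [s sE] := int_form_geo n (int_form_gen v); exists s.
by have [s sE] := int_form_prod w h; exists s => k; apply: sE.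
Qed.
End IntegralForms.

Section FreeEvaluation.
Variables (V : choiceType) (E : rel V) (k : comNzRingType).
Local Notation kA := (group_ring k (raag E)).
Local Notation I := (ideal_pow (aug_ideal kA)).
Implicit Types (x y : free_alg k V).

(** The evaluation of a free polynomial at the elements v - 1, in kA and without recourse to the
    completion. *)
Definition fev x : kA := unmag E k (qpi (pc_ideal E k) x).

Lemma fevD x y : fev (x + y) = fev x + fev y.
Proof. by rewrite /fev (qpiD _ x y) unmagD. Qed.
Lemma fevB x y : fev (x - y) = fev x - fev y.
Proof. by rewrite /fev (qpiB _ x y) unmagB. Qed.
Lemma fevM x y : fev (x * y) = fev x * fev y.
Proof. by rewrite /fev (qpiM _ x y) unmagM. Qed.
Lemma fev1 : fev 1 = 1.
Proof. by rewrite /fev qpi1 unmag1. Qed.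
Lemma fev_gen v : fev (free_gen k v) = gr_gen k (raag_gen E v) - 1.
Proof. exact: unmag_pc_gen. Qed.

Lemma fev_ideal_powP n x : I n (fev x) <-> forall t, (size t < n)%N -> tcoef E t x = 0.
Proof.
by split=> [/unmag_ideal_powP/ideal_pow_coefP|h] //; apply/unmag_ideal_powP/ideal_pow_coefP.
Qed.

(** Any [x] whose evaluation approximates g modulo I^n has the coefficients of mu(g) in degrees
    below n. *)
Lemma gdelta_coefP n g x : I n (fev x - gr_gen k g) ->
  gdelta k n g <-> forall t, (size t < n)%N -> tcoef E t (x - 1) = 0.
Proof.
move=> xg; split=> [gn|/fev_ideal_powP].
  by apply/fev_ideal_powP; rewrite fevB fev1; apply: ideal_subKA xg gn.
rewrite fevB fev1 => h; rewrite /gdelta /mkset /gdif.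
by apply: (ideal_subKA _ h); rewrite -opprB; exact: (idealN xg).
Qed.

Lemma fev_mul_approx n x y g h : I n (fev x - gr_gen k g) -> I n (fev y - gr_gen k h) ->
  I n (fev (x * y) - gr_gen k (g * h)%g).
Proof.
by move=> xg yh; rewrite fevM (gr_genM k g h); exact: (ideal_subM xg yh).
Qed.

Lemma fev_gen1 v : fev (1 + free_gen k v) = gr_gen k (raag_gen E v).
Proof. by rewrite fevD fev1 fev_gen addrC subrK. Qed.

Lemma fev_geo n v : I n (fev (geo (free_gen k v) n) - gr_gen k (raag_gen E v)^-1%g).
Proof.
have e1 : gr_gen k (raag_gen E v) * gr_gen k (raag_gen E v)^-1%g = 1 by apply: gr_genV.
have e2 : fev (geo (free_gen k v) n) * gr_gen k (raag_gen E v) = fev (1 - (- free_gen k v) ^+ n).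
  by rewrite -geoMr fevM fev_gen1.
have : I n (fev (1 - (- free_gen k v) ^+ n) - 1).
  rewrite fevB fev1 addrAC subrr add0r; apply: idealN; apply/unmag_ideal_powP.
  rewrite (rmorphXn (qpi (pc_ideal E k))) /= (raddfN (qpi _)).
  by apply: ideal_pow_aug_exp; exact: (aug_pc_gen E k v).
by rewrite -e2; apply: ideal_sub_inv.
Qed.

Lemma fev_magnus_word n w : I n (fev (magnus_word n w k) - gr_gen k (word_class (raag_rel E) w)).
Proof.
elim: w => [|[v b] w IH].
  rewrite /magnus_word big_nil fev1 -[X in _ - X]/(1 : kA) subrr; apply: ideal0.
rewrite word_class_cons /magnus_word big_cons; apply: fev_mul_approx IH.
case: b; first by rewrite fev_gen1 subrr; apply: ideal0.
by rewrite word_class_false; apply: fev_geo.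
Qed.
End FreeEvaluation.

Lemma gdelta_transfer (V : choiceType) (E : rel V) (k k' : comNzRingType) :
  (forall c : int, c%:~R = 0 :> k -> c%:~R = 0 :> k') ->
  forall n, gdelta k n `<=` @gdelta k' (raag E) n.
Proof.
move=> kk n g; rewrite -[g]word_reprK; set w := word_repr g => gn.
apply/(gdelta_coefP (fev_magnus_word E k' n w)) => t tn.
move/(gdelta_coefP (fev_magnus_word E k n w))/(_ t tn): gn.
have [s sE] := int_formD (magnus_word_int n w) (int_formN (int_form1 V)).
rewrite (sE k) (sE k').
have cE (l : comNzRingType) : tcoef E t (lcomb [seq (a.1%:~R : l, a.2) | a <- s]) =
    (\sum_(a <- s) a.1 * `[<teq E a.2 t>]%:R)%:~R.
  rewrite tcoef_lcomb big_map raddf_sum; apply: eq_bigr => a _.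
  by case: asboolP => _ /=; rewrite ?mulr1 ?mulr0.
by rewrite !cE; apply: kk.
Qed.

Lemma ideal_mulrn_congr (R : pzRingType) (I : ideal R) (x y : R) m :
  I (x - y) -> I (y *+ m) -> I (x *+ m).
Proof.
move=> xy ym; rewrite -[x](subrK y) mulrnDl; apply: idealD => //.
by rewrite -mulr_natl; apply: idealMl.
Qed.

Section TorsionFree.
Variables (V : choiceType) (E : rel V).
Local Notation A := (raag E).
Local Notation kA := (group_ring int A).
Local Notation I := (ideal_pow (aug_ideal kA)).

Lemma gdif_torsion_free n (m : nat) (g : A) : (0 < m)%N -> I n (gdif int g *+ m) -> gdelta int n g.
Proof.
move=> m0; rewrite -[g]word_reprK; set w := word_repr g => mg.
have wg := fev_magnus_word E int n w.
apply/(gdelta_coefP wg) => t tn; set y := magnus_word n w int - 1.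
suff : tcoef E t (y *+ m) = 0.
  rewrite -scaler_nat tcoefZ => /eqP; rewrite mulf_eq0 => /orP [|/eqP //].
  by rewrite Num.Theory.pnatr_eq0; case: m m0 {mg}.
have yE : I n (fev E y - gdif int (word_class (raag_rel E) w)).
  rewrite fevB fev1 /gdif; move: wg; move: (fev _ _) (gr_gen _ _) => a b ab.
  by rewrite opprB addrA subrK.
suff ymE : I n (fev E (y *+ m)) by move/fev_ideal_powP: ymE; apply.
have -> : fev E (y *+ m) = fev E y *+ m.
  elim: (m) => [|j IH]; first by rewrite !mulr0n -(subrr 1) fevB subrr.
  by rewrite !mulrS fevD IH.
exact: ideal_mulrn_congr yE mg.
Qed.

(** One degree is gained at a time: for g in delta_(i+1), g^m - 1 is congruent to m (g - 1) modulo
    I^(i+2), and [gdif_torsion_free] cancels m. *)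
Lemma gamma0_gdelta n : gamma0 n `<=` @gdelta int A n.
Proof.
move=> g [z z0 gz]; pose m := `|z|%N.
have m0 : (0 < m)%N by rewrite absz_gt0.
have gm : gdelta int n (g ^+ m)%g.
  apply: gamma_gdelta; move: gz; rewrite /m /expgz; case: (z) => j //= h.
  by rewrite -[(g ^+ j.+1)%g]invgK; apply: subgroupV => //; exact: (@gamma_subgroup A n).
suff h i : (i <= n)%N -> gdelta int i g by apply: h.
elim: i => [//|[|i] IH] lin; first exact: gdelta1.
have gi := IH (ltnW lin).
apply: (gdif_torsion_free m0).
suff h j : I i.+2 (gdif int (g ^+ j)%g - gdif int g *+ j).
  rewrite -[_ *+ m](subrK (gdif int (g ^+ m)%g)); apply: idealD; last exact: (gdelta_leq lin gm).
  by rewrite -opprB; exact: (idealN (h m)).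
elim: j => [|j IHj]; first by rewrite expg0 gdif1 mulr0n subrr; apply: ideal0.
rewrite expgS mulrS.
have gj : gdelta int i.+1 (g ^+ j)%g by exact: (subgroupX j (@gdelta_subgroup int A i.+1) gi).
have c := gdifM_congr gi gj.
apply: (@ideal_subKA _ _ (gdif int g + gdif int (g ^+ j)%g)).
  by apply: (ideal_pow_leq _ c); lia.
by rewrite opprD addrACA subrr add0r.
Qed.
End TorsionFree.

(** * Faithfulness *)

Section SyllableCount.
Variables (V : choiceType) (E : rel V).
Hypotheses (E_sym : symmetric E) (E_irr : irreflexive E).

(* After reading a word, the open letters are those whose last occurrence is
   followed only by letters commuting with them. *)
Definition open_upd (c : V) (O : pred V) : pred V := fun d => (d == c) || O d && E c d.

Fixpoint opens (O : pred V) (w : seq V) : pred V :=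
  if w is c :: w' then opens (open_upd c O) w' else O.

Fixpoint nsyl (O : pred V) (w : seq V) : nat :=
  if w is c :: w' then (~~ O c + nsyl (open_upd c O) w')%N else 0.

Lemma opens_cat O u w : opens O (u ++ w) = opens (opens O u) w.
Proof. by elim: u O => /=. Qed.

Lemma nsyl_cat O u w : nsyl O (u ++ w) = (nsyl O u + nsyl (opens O u) w)%N.
Proof. by elim: u O => //= c u IH O; rewrite IH addnA. Qed.

Lemma open_updC x y O : E x y -> open_upd x (open_upd y O) = open_upd y (open_upd x O).
Proof.
move=> xy; apply: funext => d; rewrite /open_upd.
have [->|dx] := eqVneq d x; first by rewrite E_sym xy !orbT.
have [->|dy] := eqVneq d y; first by rewrite xy.
by rewrite /= -!andbA [E y d && _]andbC.
Qed.

(** Reading x leaves the status of a commuting letter y unchanged, and conversely; irreflexivity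
    guarantees that x and y differ. *)
Lemma nsyl_teq O u w : teq E u w -> nsyl O u = nsyl O w.
Proof.
apply: (teq_inv (f := nsyl O)) => s x y s' xy; rewrite !nsyl_cat /= (open_updC _ xy).
congr (_ + _)%N; rewrite !addnA; congr (_ + _)%N; rewrite addnC; move: (opens O s) => O'.
have yx : y != x by apply: contraTneq xy => ->; rewrite E_irr.
by rewrite /open_upd (negPf yx) eq_sym (negPf yx) xy E_sym xy !andbT.
Qed.

Lemma open_upd_idem c O : open_upd c (open_upd c O) = open_upd c O.
Proof.
by apply: funext => d; rewrite /open_upd; case: (d == c) => //=; rewrite -andbA andbb.
Qed.

Lemma opens_nseq O c j : (0 < j)%N -> opens O (nseq j c) = open_upd c O.
Proof.
case: j => // j _ /=; elim: j => //= j; by rewrite open_upd_idem.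
Qed.

Lemma nsyl_nseq O c j : nsyl O (nseq j c) = ((0 < j)%N && ~~ O c) :> nat.
Proof.
case: j => //= j; suff -> : nsyl (open_upd c O) (nseq j c) = 0%N by rewrite addn0.
by elim: j => //= j IH; rewrite {1}/open_upd eqxx open_upd_idem.
Qed.
End SyllableCount.

Lemma expgzS (G : groupType) (x : G) (a : int) : (expgz x (a + 1)%R = expgz x a * x)%g.
Proof.
case: a => [m|[|m]].
- by rewrite -PoszD addn1 /= expgSr.
- by rewrite /= expg1 mulVg.
- have -> : Negz m.+1 + 1 = Negz m by lia.
  by rewrite /expgz [(x ^+ m.+2)%g]expgS invgM mulgVK.
Qed.

Lemma expgzD (G : groupType) (x : G) (a b : int) : (expgz x (a + b)%R = expgz x a * expgz x b)%g.
Proof.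
have e0 : expgz x 0 = 1%g by rewrite /= expg0.
have eP c : expgz x (c - 1)%R = (expgz x c * x^-1)%g.
  by rewrite -[c in RHS](subrK 1) expgzS mulgK.
elim/int_ind: b => [|n IH|n IH]; first by rewrite addr0 e0 mulg1.
- have -> : a + n.+1%:Z = a + n + 1 by lia.
  have -> : n.+1%:Z = n%:Z + 1 by lia.
  by rewrite !expgzS IH mulgA.
- have -> : a - n.+1%:Z = a - n%:Z - 1 by lia.
  have -> : - n.+1%:Z = - n%:Z - 1 by lia.
  by rewrite !eP IH mulgA.
Qed.

Section Syllables.
Variables (V : choiceType) (E : rel V).
Hypotheses (E_sym : symmetric E) (E_irr : irreflexive E).
Local Notation A := (raag E).
Implicit Types s : seq (V * int).

Definition syl_eval s : A := (\prod_(a <- s) expgz (raag_gen E a.1) a.2)%g.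

Lemma syl_eval_cat s s' : syl_eval (s ++ s') = (syl_eval s * syl_eval s')%g.
Proof. by rewrite /syl_eval big_cat. Qed.
Lemma syl_eval1 a : syl_eval [:: a] = expgz (raag_gen E a.1) a.2.
Proof. by rewrite /syl_eval big_seq1. Qed.

Lemma syl_eval_surj g : exists s, syl_eval s = g.
Proof.
elim/raag_ind: g => [|v x [s <-]|v x [s <-]]; first by exists [::]; rewrite /syl_eval big_nil.
- by exists ((v, 1) :: s); rewrite -cat1s syl_eval_cat syl_eval1 /= expg1.
- by exists ((v, -1) :: s); rewrite -cat1s syl_eval_cat syl_eval1 /= expg1.
Qed.

Lemma expgz_commute (G : groupType) (x y : G) a b : commute x y -> commute (expgz x a) (expgz y b).
Proof.
move=> xy; have h m n : commute (x ^+ m)%g (y ^+ n)%g by apply: commuteX2.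
by case: a => m; case: b => n; rewrite /expgz //; [apply: commuteV|apply: commute_sym; apply: commuteV; apply: commute_sym|
  apply: commuteV; apply: commute_sym; apply: commuteV; apply: commute_sym].
Qed.

Lemma syl_commute d s : all (fun a => E a.1 d.1) s ->
  commute (syl_eval s) (expgz (raag_gen E d.1) d.2).
Proof.
elim: s => [|a s IH] /=; first by move=> _; rewrite /syl_eval big_nil; apply: commute_sym; apply: commute1.
move=> /andP [ad /IH sd]; rewrite -cat1s syl_eval_cat syl_eval1.
apply: commute_sym; apply: commuteM; last exact: commute_sym.
by apply: expgz_commute; apply: commute_sym; apply: raag_genC.
Qed.

(* By [reduced_merge], two syllables of a reduced expression over the same letter are
   separated by one not commuting with it. *)
Definition reduced s := forall s', syl_eval s' = syl_eval s -> (size s <= size s')%N.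

Lemma reduced_exists g : exists2 s, syl_eval s = g & reduced s.
Proof.
have [s0 s0g] := syl_eval_surj g.
have ex : exists n, `[<exists s, syl_eval s = g /\ size s = n>].
  by exists (size s0); apply/asboolP; exists s0.
have [n /asboolP [s [sg <-]] nP] := ex_minnP ex.
exists s => // s' s's; apply: nP; apply/asboolP; exists s'; split=> //; by rewrite s's.
Qed.

Lemma reduced_rcons s a : reduced (rcons s a) -> reduced s.
Proof.
move=> rs s' s's; have := rs (rcons s' a).
by rewrite -!cats1 !syl_eval_cat s's !size_cat !addn1 ltnS; apply.
Qed.

Lemma reduced_neq0 s a : reduced (rcons s a) -> a.2 != 0.
Proof.
move=> rs; apply/eqP => a0; have := rs s.
by rewrite -cats1 syl_eval_cat syl_eval1 a0 /= expg0 mulg1 size_cat addn1 ltnn => /(_ erefl).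
Qed.

(** The last syllable can be moved back to the earlier one over [d] and merged with it, which saves
    a syllable. *)
Lemma reduced_merge s s' d e e' : all (fun a => E a.1 d) s' ->
  ~ reduced (rcons (s ++ (d, e) :: s') (d, e')).
Proof.
move=> s'd /(_ (s ++ (d, e + e') :: s')).
have -> : syl_eval (s ++ (d, e + e') :: s') = syl_eval (rcons (s ++ (d, e) :: s') (d, e')).
  rewrite -cats1 -(cat1s (d, e)) -(cat1s (d, e + e')) !syl_eval_cat !syl_eval1 /= expgzD.
  by rewrite !mulgA -(mulgA _ (syl_eval s')) (syl_commute (d := (d, e')) s'd) mulgA.
by rewrite size_rcons !size_cat /= ltnn => /(_ erefl).
Qed.

Variable q : V * int -> nat.
Hypothesis q_gt0 : forall a, (0 < q a)%N.

Definition syl_word s : seq V := flatten [seq nseq (q a) a.1 | a <- s].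

Lemma syl_word_rcons s a : syl_word (rcons s a) = syl_word s ++ nseq (q a) a.1.
Proof. by rewrite /syl_word map_rcons flatten_rcons. Qed.

Lemma opens_syl_word s d : opens E xpred0 (syl_word s) d ->
  exists s1 e s2, s = s1 ++ (d, e) :: s2 /\ all (fun a => E a.1 d) s2.
Proof.
elim/last_ind: s => [//|s [c e] IH]; rewrite syl_word_rcons opens_cat opens_nseq //.
rewrite /open_upd => /orP [/eqP ->|/andP [/IH [s1 [e' [s2 [-> h]]]] cd]].
  by exists s, e, [::]; rewrite cats1.
by exists s1, e', (rcons s2 (c, e)); rewrite all_rcons h andbT rcons_cat.
Qed.

(** If the letter of a new syllable were open, an earlier syllable over it would commute with all
    those in between, against [reduced_merge]. *)
Lemma nsyl_reduced s : reduced s -> nsyl E xpred0 (syl_word s) = size s.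
Proof.
elim/last_ind: s => [//|s [c e] IH] rs.
rewrite syl_word_rcons nsyl_cat nsyl_nseq IH ?size_rcons; last exact: reduced_rcons rs.
rewrite q_gt0 /=; case: (boolP (opens _ _ _ _)) => [/opens_syl_word [s1 [e' [s2 [sE s2c]]]]|_].
  by case: (@reduced_merge s1 s2 c e' e s2c); rewrite -sE.
by rewrite addn1.
Qed.
End Syllables.

Section SyllablePolynomials.
Variables (k : fieldType) (p : nat) (charkp : p \in [pchar k]).

Lemma coef1_exp (P : {poly k}) m : P`_0 = 1 -> (P ^+ m)`_0 = 1 /\ (P ^+ m)`_1 = P`_1 *+ m.
Proof.
move=> P0; elim: m => [|m [IH0 IH1]]; first by rewrite expr0 !coef1 mulr0n.
rewrite exprS coef0M P0 IH0 mul1r; split=> //.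
by rewrite coefM big_ord_recl big_ord1 /= P0 IH0 IH1 mul1r mulr1 mulrS addrC.
Qed.

(** Let N = m q with q the p-part. Then P^m = 1 + X h with h(0) = m P_1 nonzero, since p does not
    divide m, and Frobenius gives P^N = 1 + X^q h^q. *)
Lemma coef_exp_part (P : {poly k}) N : P`_0 = 1 -> P`_1 != 0 -> (0 < N)%N ->
  [/\ (P ^+ N)`_(N`_p)%N != 0 & forall i, (0 < i < N`_p)%N -> (P ^+ N)`_i = 0].
Proof.
move=> P0 P1 N0; have pp : prime p := pcharf_prime charkp.
set q := (N`_p)%N; set m := (N`_p^')%N.
have NE : N = (m * q)%N by rewrite mulnC partnC.
have mk : (m%:R : k) != 0.
  by rewrite -(dvdn_pcharf charkp) -p'natE // part_pnat.
have [Q0 Q1] := coef1_exp m P0; set Q := P ^+ m in Q0 Q1.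
have [h QE] : exists h, Q = 1 + 'X * h.
  exists (\poly_(i < size Q) Q`_i.+1); apply/polyP => -[|i].
    by rewrite coefD coef1 coefXM addr0.
  rewrite coefD coef1 coefXM add0r coef_poly; case: ltnP => // h.
  by rewrite nth_default // (leq_trans h).
have h0 : h`_0 != 0.
  have := Q1; rewrite QE coefD coef1 coefXM /= add0r => ->.
  by rewrite -mulr_natr mulf_neq0.
have E1 : P ^+ N = 1 + 'X^q * h ^+ q.
  rewrite NE exprM -/Q QE exprDn_pchar ?expr1n ?exprMn //.
  have charpp : p \in [pchar {poly k}] by rewrite pchar_poly.
  by rewrite (eq_pnat _ (pcharf_eq charpp)) part_pnat.
split=> [|i /andP [i0 iq]]; rewrite E1 coefD coef1 coefXnM.
  rewrite ltnn subnn -[(h ^+ q)`_0]horner_coef0 horner_exp horner_coef0.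
  by rewrite eqn0Ngt part_gt0 add0r expf_neq0.
by rewrite iq addr0; case: i i0 {iq}.
Qed.
End SyllablePolynomials.

Fact horner_alg_exists (k : comNzRingType) (B : algType k) (a : B) :
  {H : {rmorphism {poly k} -> B} | H 'X = a /\ forall c, H c%:P = c%:A}.
Proof.
by exists (horner_alg a); split=> [|c]; [apply: horner_algX|apply: horner_algC].
Qed.

Section Faithful.
Variables (V : choiceType) (E : rel V) (k : fieldType) (p : nat) (charkp : p \in [pchar k]).
Hypotheses (E_sym : symmetric E) (E_irr : irreflexive E).
Local Notation A := (raag E).
Local Notation kA := (group_ring k A).
Implicit Types (v : V).
Local Notation I := (ideal_pow (aug_ideal kA)).

Lemma free_word_nseq v j : free_word k (nseq j v) = free_gen k v ^+ j.
Proof.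
elim: j => [|j IH]; first by rewrite free_word0 expr0.
by rewrite exprS -IH -[nseq j.+1 v]/([:: v] ++ nseq j v) (free_wordM k [:: v] (nseq j v)) free_word1.
Qed.

Definition free_horner v : {rmorphism {poly k} -> free_alg k V} := sval (horner_alg_exists (free_gen k v)).

Lemma free_hornerX v : free_horner v 'X = free_gen k v.
Proof. by have [] := svalP (horner_alg_exists (free_gen k v)). Qed.
Lemma free_hornerD v P Q : free_horner v (P + Q) = free_horner v P + free_horner v Q.
Proof. exact: (raddfD (free_horner v)). Qed.
Lemma free_hornerN v P : free_horner v (- P) = - free_horner v P.
Proof. exact: (raddfN (free_horner v)). Qed.
Lemma free_hornerM v P Q : free_horner v (P * Q) = free_horner v P * free_horner v Q.
Proof. exact: (rmorphM (free_horner v)). Qed.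
Lemma free_hornerZ v c P : free_horner v (c *: P) = c *: free_horner v P.
Proof.
rewrite -mul_polyC free_hornerM.
have -> : free_horner v c%:P = c%:A by have [] := svalP (horner_alg_exists (free_gen k v)).
by rewrite -scalerAl mul1r.
Qed.
Lemma free_horner1 v : free_horner v 1 = 1.
Proof. exact: (rmorph1 (free_horner v)). Qed.
Lemma free_hornerXn v P n : free_horner v (P ^+ n) = free_horner v P ^+ n.
Proof. exact: (rmorphXn (free_horner v)). Qed.
Lemma free_horner_sum v I (r : seq I) (F : I -> {poly k}) :
  free_horner v (\sum_(i <- r) F i) = \sum_(i <- r) free_horner v (F i).
Proof. exact: (raddf_sum (free_horner v)). Qed.

Lemma free_horner_words v (P : {poly k}) :
  free_horner v P = \sum_(i < size P) P`_i *: free_word k (nseq i v).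
Proof.
rewrite -{1}[P]coefK poly_def free_horner_sum; apply: eq_bigr => i _.
by rewrite free_hornerZ free_hornerXn free_hornerX free_word_nseq.
Qed.

Lemma fev_horner_exp n v (g : A) (P : {poly k}) N :
  I n (fev E (free_horner v P) - gr_gen k g) ->
  I n (fev E (free_horner v (P ^+ N)) - gr_gen k (g ^+ N)%g).
Proof.
move=> h; elim: N => [|N IH].
  rewrite expr0 expg0 free_horner1 fev1.
  by rewrite -[X in _ - X]/(1 : kA) subrr; apply: ideal0.
rewrite exprS expgS free_hornerM; exact: fev_mul_approx h IH.
Qed.

(** A generator and its inverse are put in the common form required by [coef_exp_part]; n > 1 keeps
    the linear term of the truncated inverse. *)
Lemma syllable_poly n v (b : bool) : (1 < n)%N -> exists P : {poly k}, [/\ P`_0 = 1, P`_1 != 0 &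
  I n (fev E (free_horner v P) - gr_gen k (if b then raag_gen E v else (raag_gen E v)^-1%g))].
Proof.
move=> n1; case: b.
  exists (1 + 'X); rewrite !coefD !coef1 !coefX add0r addr0 oner_eq0; split=> //.
  rewrite free_hornerD free_horner1 free_hornerX.
  by rewrite fev_gen1 subrr; apply: ideal0.
exists (\sum_(i < n) (- 'X) ^+ i); have cE j : (\sum_(i < n) (- 'X) ^+ i : {poly k})`_j = (-1) ^+ j *+ (j < n)%N.
  under eq_bigr => i _ do rewrite -scaleN1r exprZn.
  by rewrite -(poly_def n (fun i => (-1) ^+ i)) coef_poly; case: ltnP.
rewrite !cE n1 (ltnW n1) expr0 expr1 oppr_eq0 oner_eq0; split=> //.
suff -> : free_horner v (\sum_(i < n) (- 'X) ^+ i) = geo (free_gen k v) n by exact: fev_geo.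
rewrite free_horner_sum; apply: eq_bigr => i _.
by rewrite free_hornerXn free_hornerN free_hornerX.
Qed.

(** For a nonzero exponent e, the lowest positive degree occurring in (1 + v)^e in characteristic
    p. *)
Definition syl_exp (a : V * int) : nat := (`|a.2|%N`_p)%N.

Lemma syllable_approx n (a : V * int) : (1 < n)%N -> a.2 != 0 -> exists (c : k) (r : free_alg k V), [/\ c != 0,
  spans (fun m : seq V => m = [::] \/ exists2 j, (syl_exp a < j)%N & m = nseq j a.1) r &
  I n (fev E (c *: free_word k (nseq (syl_exp a) a.1) + r) - gr_gen k (expgz (raag_gen E a.1) a.2))].
Proof.
move=> n1 a0; set q := syl_exp a.
have [P [P0 P1 PI]] := syllable_poly a.1 (0 <= a.2) n1.
have N0 : (0 < `|a.2|)%N by rewrite absz_gt0.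
have [cq ci] := coef_exp_part charkp P0 P1 N0; rewrite -/(syl_exp a) -/q in cq ci.
set Q := P ^+ `|a.2|%N in cq ci.
have qs : (q < size Q)%N by rewrite ltnNge; apply: contra cq => /(nth_default 0) ->.
exists (Q`_q), (\sum_(i < size Q | i != Ordinal qs) Q`_i *: free_word k (nseq i a.1)); split; first exact: cq.
  apply: (big_ind (spans _)) => [|x y|i iq]; [exact: spans0|exact: spansD|].
  have [i0|i0] := posnP i.
    by apply: spans_word; left; rewrite i0.
  have [qi|iq'|qi] := ltngtP q i; first by apply: spans_word; right; exists i.
    by rewrite ci ?i0 // scale0r; apply: spans0.
  by case/eqP: iq; apply: val_inj.
have -> : expgz (raag_gen E a.1) a.2 = ((if 0 <= a.2 then raag_gen E a.1 else (raag_gen E a.1)^-1) ^+ `|a.2|)%g.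
  by case: (a.2) => j //=; rewrite expVgn.
have := fev_horner_exp `|a.2| PI; rewrite -/Q free_horner_words (bigD1 (Ordinal qs)) //=.
Qed.
Lemma syl_exp_gt0 a : (0 < syl_exp a)%N.
Proof. exact: part_gt0. Qed.

Local Notation nsyl := (nsyl E xpred0).
Local Notation W := (syl_word syl_exp).

Lemma nsyl_cat_nseq (u : seq V) j v : (nsyl (u ++ nseq j v) <= (nsyl u).+1)%N.
Proof. by rewrite nsyl_cat nsyl_nseq -[X in (_ <= X)%N]addn1 leq_add2l leq_b1. Qed.

Lemma nsyl_syl_word s : (nsyl (W s) <= size s)%N.
Proof.
elim/last_ind: s => // s a IH; rewrite syl_word_rcons size_rcons.
exact: leq_trans (nsyl_cat_nseq _ _ _) _.
Qed.

(* No such [m] is equivalent to [W s] when [s] is reduced. *)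
Definition negligible s (m : seq V) : Prop :=
  (nsyl m <= size s)%N /\ ((nsyl m < size s)%N \/ (size (W s) < size m)%N).

(** In the product of the syllable polynomials, taking a constant term loses a syllable, and taking
    a power above the leading one lengthens the word without adding a syllable. *)
Lemma syl_approx n s : (1 < n)%N -> all (fun a => a.2 != 0) s ->
  exists (c : k) (r : free_alg k V), [/\ c != 0, spans (negligible s) r &
  I n (fev E (c *: free_word k (W s) + r) - gr_gen k (syl_eval E s))].
Proof.
move=> n1; elim/last_ind: s => [_|s a IH].
  exists 1, 0; split; [exact: oner_neq0|exact: spans0|].
  rewrite scale1r addr0 free_word0 fev1 /syl_eval big_nil.
  by rewrite -[X in _ - X]/(1 : kA) subrr; apply: ideal0.
rewrite all_rcons => /andP [a0 /IH [c [r [c0 rs cI]]]].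
have [d [r' [d0 r's dI]]] := syllable_approx n1 a0.
have := fev_mul_approx cI dI.
rewrite -(syl_eval1 E a) -(syl_eval_cat E s [:: a]) cats1.
have E1 (B : algType k) (x y z t : B) :
    (c *: x + y) * (d *: z + t) = (c * d) *: (x * z) + ((c *: x) * t + y * (d *: z + t)).
  by rewrite mulrDl mulrDr -scalerAl -scalerAr scalerA -addrA.
rewrite E1 -free_wordM -syl_word_rcons => xI.
exists (c * d), ((c *: free_word k (W s)) * r' + r * (d *: free_word k (nseq (syl_exp a) a.1) + r')).
split; [by rewrite mulf_neq0| |exact: xI].
have sW : size (W (rcons s a)) = (size (W s) + syl_exp a)%N.
  by rewrite syl_word_rcons size_cat size_nseq.
apply: spansD.
  apply: (spansM (J1 := fun m => m = W s)) r's; last by apply: spans_word.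
  move=> _ m -> [->|[j qj ->]]; rewrite /negligible size_rcons sW.
    rewrite cats0; have h := nsyl_syl_word s; split; first exact: leqW.
    by left; rewrite ltnS.
  split; last by right; rewrite size_cat size_nseq ltn_add2l.
  by apply: leq_trans (nsyl_cat_nseq _ _ _) _; rewrite ltnS nsyl_syl_word.
apply: (spansM (J2 := fun m : seq V => m = [::] \/ exists2 j, (syl_exp a <= j)%N & m = nseq j a.1)) rs _.
  move=> u m [u1 u2] [->|[j qj ->]]; rewrite /negligible size_rcons sW.
    by rewrite cats0; split; [exact: leqW|left; rewrite ltnS].
  have h := nsyl_cat_nseq u j a.1; rewrite size_cat size_nseq; split.
    by apply: leq_trans h _; rewrite ltnS.
  by case: u2 => u2; [left; apply: leq_ltn_trans h _; rewrite ltnS|right; rewrite -addSn leq_add].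
apply: spansD; first by apply: spans_word; right; exists (syl_exp a).
apply: spans_mono r's => m [->|[j qj ->]]; first by left.
by right; exists j => //; apply: ltnW.
Qed.

Theorem raag_gdelta_eq1 g : (forall n, gdelta k n g) -> g = 1%g :> A.
Proof.
have [s <- rs] := reduced_exists g => gd; case: (posnP (size s)) => [/size0nil ->|s0].
  by rewrite /syl_eval big_nil.
have s_neq0 : all (fun a => a.2 != 0) s.
  elim/last_ind: (s) rs => // s' a IH rs; rewrite all_rcons (reduced_neq0 rs) /=.
  by apply: IH; apply: reduced_rcons rs.
(* One more than the coefficient at [W s] requires, so that n > 1 as well. *)
pose n := (size (W s)).+2.
have [c [r [c0 rs' cI]]] := @syl_approx n s isT s_neq0.
have [+ _] := gdelta_coefP cI; move=> /(_ (gd n) (W s) (leqnSn _)).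
have szW : (0 < size (W s))%N.
  case: (s) s0 => // a s1 _.
  by rewrite /syl_word /= size_cat size_nseq addn_gt0 syl_exp_gt0.
have e1 : tcoef E (W s) (1 : free_alg k V) = 0.
  rewrite -free_word0 tcoef_word asboolF // => /teq_size W0.
  by move: szW; rewrite -W0.
rewrite tcoefB tcoefD tcoefZ tcoef_word e1 subr0.
rewrite asboolT; last exact: teq_refl.
rewrite mulr1 (spans_coef0 _ rs') ?addr0 => [|u [_ [us|us]] uW].
- by move/eqP: c0.
- move: us; rewrite (nsyl_teq E_sym E_irr xpred0 uW) nsyl_reduced ?ltnn //.
  exact: syl_exp_gt0.
- by move: us; rewrite (teq_size uW) ltnn.
Qed.
End Faithful.

(** * The Lie ring of the lower central series *)

Section LowerCentralBracket.
Variable G : groupType.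
Local Open Scope group_scope.
Implicit Types x y z : G.
Local Notation gam := (@gamma G).

Lemma hall_witt x y z :
  [~ [~ x, y^-1], z] ^ y * [~ [~ y, z^-1], x] ^ z * [~ [~ z, x^-1], y] ^ x = 1.
Proof.
rewrite /conjg /commg /conjg !invgM !invgK !mulgA.
by rewrite !(mulgK, mulgVK, mulVg, mulgV, mul1g).
Qed.

Lemma commgMr x y z : [~ x, y * z] = [~ x, z] * [~ x, y] ^ z.
Proof. by rewrite /commg /conjg !invgM !mulgA !(mulgK, mulgVK). Qed.

Lemma commgMl x y z : [~ x * y, z] = [~ x, z] ^ y * [~ y, z].
Proof. by rewrite /commg /conjg !invgM !mulgA !(mulgK, mulgVK). Qed.

Lemma commgVr x y : [~ x, y^-1] = [~ y, x] ^ y^-1.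
Proof. by rewrite /commg /conjg !invgK !mulgA !(mulgK, mulgVK, mulgV, mul1g). Qed.

Lemma gam_sub n : subgroup_axiom (gam n). Proof. exact: gamma_subgroup. Qed.

Lemma gamV n x : gam n x -> gam n x^-1.
Proof. exact: subgroupV (gam_sub n). Qed.
Lemma gamM n x y : gam n x -> gam n y -> gam n (x * y).
Proof. exact: subgroupM (gam_sub n). Qed.
Lemma gam1 n : gam n 1.
Proof. exact: subgroup1 (gam_sub n). Qed.

Lemma gam_conjE n x y : gam n (x ^ y) -> gam n x.
Proof. by move=> h; rewrite -(conjgK y x); apply: gamma_conj. Qed.

(** The three subgroups argument: two factors of the Hall-Witt identity lie deep by induction on m,
    and hence so does the third. *)
Lemma gamma_comm j m x y : gam j x -> gam m y -> gam (j + m)%N [~ x, y].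
Proof.
elim: m j x y => [|m IH] j x y xj ym.
  by rewrite addn0 commgEl; apply: gamM; [apply: gamV|apply: gamma_conj].
case: m IH ym => [|m] IH ym; first by rewrite addn1; apply: gamma_commg.
pose H := [set u | forall i v, gam i v -> gam (i + m.+2)%N [~ v, u]].
suff /(_ _ ym) : gam m.+2 `<=` H by apply.
apply: subgroup_gen_min => [|_ [u um [z _ <-]] i v vi].
  split=> [i v vi|a b Ha Hb i v vi]; first by rewrite commg1; apply: gam1.
  rewrite commgMr; apply: gamM; last by apply: gamma_conj; apply: Ha.
  by rewrite commgVr; apply: gamma_conj; rewrite -invgR; apply: gamV; apply: Hb.
have := hall_witt u z^-1 v; rewrite invgK => hw.
have h2 : gam (i + m.+2)%N ([~ [~ z^-1, v^-1], u] ^ v).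
  apply: gamma_conj; rewrite addnS -addSn; apply: IH => //.
  by rewrite -invgR; apply: gamV; apply: gamma_commg; apply: gamV.
have h3 : gam (i + m.+2)%N ([~ [~ v, u^-1], z^-1] ^ u).
  by apply: gamma_conj; rewrite addnS; apply: gamma_commg; apply: IH => //; apply: gamV.
rewrite -invgR; apply: gamV; apply: (@gam_conjE _ _ z^-1).
move: hw h2 h3; move: (_ ^ z^-1) (_ ^ v) (_ ^ u) => a b c abc hb hc.
by rewrite -[a](mulgK b) -[a * b](mulgK c) abc mul1g; apply: gamM; apply: gamV.
Qed.
End LowerCentralBracket.

Section LieRing.
Variable G : groupType.
Local Open Scope quotient_scope.
Local Notation gam := (@gamma G).

Definition gcong n (x y : G) : Prop := gam n.+1 (x^-1 * y)%g.

Lemma gcong_refl n x : gcong n x x.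
Proof. by rewrite /gcong mulVg; apply: gam1. Qed.
Lemma gcong_sym n x y : gcong n x y -> gcong n y x.
Proof. by move=> h; have := gamV h; rewrite invgM invgK. Qed.
Lemma gcong_trans n x y z : gcong n x y -> gcong n y z -> gcong n x z.
Proof. by move=> h1 h2; have := gamM h1 h2; rewrite mulgA mulgK. Qed.
Lemma gcongM n x y x' y' : gcong n x y -> gcong n x' y' -> gcong n (x * x')%g (y * y')%g.
Proof.
move=> h1 h2; rewrite /gcong.
have -> : ((x * x')^-1 * (y * y') = (x^-1 * y) ^ x' * (x'^-1 * y'))%g.
  by rewrite /conjg invgM !mulgA mulgK.
by apply: gamM h2; apply: gamma_conj.
Qed.
Lemma gcongV n x y : gcong n x y -> gcong n x^-1%g y^-1%g.
Proof.
move=> /gcong_sym h; rewrite /gcong invgK.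
have -> : (x * y^-1 = (y^-1 * x) ^ y^-1)%g by rewrite /conjg invgK !mulgA mulgV mul1g.
exact: gamma_conj.
Qed.
Lemma gcongC n x y : gam n x -> gcong n (x * y)%g (y * x)%g.
Proof.
move=> xn; rewrite /gcong invgM -mulgA.
have -> : (y^-1 * (x^-1 * (y * x)) = [~ y, x])%g by rewrite /commg /conjg.
by rewrite -invgR; apply: gamV; apply: gamma_commg.
Qed.

Record gseq := Gseq { gval :> nat -> G; gvalP : forall n, gam n (gval n) }.
HB.instance Definition _ := gen_eqMixin gseq.
HB.instance Definition _ := gen_choiceMixin gseq.

Definition gseq_eqb (f g : gseq) : bool := `[<forall n, gcong n (f n) (g n)>].
Fact gseq_eqb_equiv : equiv_class_of gseq_eqb.
Proof.
split=> [f|f g|g f h].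
- by apply/asboolP => n; apply: gcong_refl.
- by apply/asboolP/asboolP => h n; apply: gcong_sym.
- by move=> /asboolP h1 /asboolP h2; apply/asboolP => n; apply: gcong_trans (h2 n).
Qed.
Canonical gseq_eqb_equivRel := EquivRelPack gseq_eqb_equiv.
Canonical gseq_eqb_encModRel := defaultEncModRel gseq_eqb.

(* The (completed) associated graded of the lower central series: the product
   over n of the groups gamma_n / gamma_(n+1). *)
Definition lie : Type := {eq_quot gseq_eqb}.
HB.instance Definition _ := Choice.on lie.

Definition lclass (f : gseq) : lie := (\pi_{eq_quot gseq_eqb} f)%qT.
Definition lrepr (l : lie) : gseq := repr (l : {eq_quot gseq_eqb}).
Lemma lreprK l : lclass (lrepr l) = l. Proof. exact: reprK. Qed.
Lemma lclassP f g : lclass f = lclass g <-> forall n, gcong n (f n) (g n).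
Proof. by split=> [/eqmodP/asboolP //|h]; apply/eqmodP/asboolP. Qed.
Lemma lrepr_cong f n : gcong n (lrepr (lclass f) n) (f n).
Proof. by move: n; apply/lclassP; rewrite lreprK. Qed.

Definition gseq1 := Gseq (fun n => gam1 G n).
Definition gseqM (f g : gseq) := Gseq (fun n => gamM (gvalP f n) (gvalP g n)).
Definition gseqV (f : gseq) := Gseq (fun n => gamV (gvalP f n)).

Definition lie_add a b := lclass (gseqM (lrepr a) (lrepr b)).
Definition lie_opp a := lclass (gseqV (lrepr a)).
Definition lie_zero := lclass gseq1.

Lemma lie_add_class f g : lie_add (lclass f) (lclass g) = lclass (gseqM f g).
Proof. by apply/lclassP => n; apply: gcongM; apply: lrepr_cong. Qed.
Lemma lie_opp_class f : lie_opp (lclass f) = lclass (gseqV f).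
Proof. by apply/lclassP => n; apply: gcongV; apply: lrepr_cong. Qed.

Fact lie_addA : associative lie_add.
Proof.
move=> a b c; rewrite -[a]lreprK -[b]lreprK -[c]lreprK !lie_add_class.
by apply/lclassP => n; rewrite /= mulgA; apply: gcong_refl.
Qed.
Fact lie_addC : commutative lie_add.
Proof.
move=> a b; rewrite -[a]lreprK -[b]lreprK !lie_add_class.
by apply/lclassP => n; apply: gcongC; apply: gvalP.
Qed.
Fact lie_add0 : left_id lie_zero lie_add.
Proof.
move=> a; rewrite -[a]lreprK lie_add_class.
by apply/lclassP => n; rewrite /= mul1g; apply: gcong_refl.
Qed.
Fact lie_addN : left_inverse lie_zero lie_opp lie_add.
Proof.
move=> a; rewrite -[a]lreprK lie_opp_class lie_add_class.
by apply/lclassP => n; rewrite /= mulVg; apply: gcong_refl.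
Qed.
HB.instance Definition _ := GRing.isZmodule.Build lie lie_addA lie_addC lie_add0 lie_addN.

Lemma lclassM f g : lclass (gseqM f g) = lclass f + lclass g.
Proof. by rewrite -lie_add_class. Qed.
Lemma lclassV f : lclass (gseqV f) = - lclass f.
Proof. by rewrite -lie_opp_class. Qed.

Definition lie_scale (n : int) (x : lie) : lie := x *~ n.
Fact lie_scaleA m n x : lie_scale m (lie_scale n x) = lie_scale (m * n) x.
Proof. by rewrite /lie_scale mulrC mulrzA. Qed.
Fact lie_scale1 : left_id 1 lie_scale.
Proof. by move=> x; exact: mulr1z. Qed.
Fact lie_scaleDr : right_distributive lie_scale +%R.
Proof. by move=> n x y; exact: mulrzDl. Qed.
Fact lie_scaleDl x : {morph lie_scale^~ x : m n / m + n}.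
Proof. by move=> m n; exact: mulrzDr. Qed.
HB.instance Definition _ := GRing.Zmodule_isLmodule.Build int lie
  lie_scaleA lie_scale1 lie_scaleDr lie_scaleDl.

(** The membership test makes [lsingle] total, with value 0 when x is not in gamma_n, instead of
    taking a proof as argument. *)
Fact gseq_single_subproof n x i : gam i (if (i == n) && `[<gam n x>] then x else 1%g).
Proof. by case: eqP => [->|_] /=; [case: asboolP => // _|]; apply: gam1. Qed.
Definition lsingle n x : lie := lclass (Gseq (gseq_single_subproof n x)).
Local Notation e := lsingle.

Lemma lsingle_eq n x y : gam n x -> gam n y -> e n x = e n y <-> gcong n x y.
Proof.
move=> xn yn; split=> [/lclassP /(_ n) /=|h]; first by rewrite eqxx !asboolT.
by apply/lclassP => i /=; rewrite !asboolT // andbT; case: eqP => [->|_] //; apply: gcong_refl.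
Qed.

Lemma lsingleM n x y : gam n x -> gam n y -> e n (x * y)%g = e n x + e n y.
Proof.
move=> xn yn; rewrite -lclassM; apply/lclassP => i /=.
rewrite !asboolT ?andbT //; last exact: gamM.
by case: eqP => _; rewrite ?mulg1; apply: gcong_refl.
Qed.

Lemma lsingle_eq0 n x : gam n x -> e n x = 0 <-> gam n.+1 x.
Proof.
move=> xn; have e1 : e n 1%g = 0.
  have := lsingleM (gam1 G n) (gam1 G n); rewrite mulg1 => /eqP.
  by rewrite addrC -subr_eq subrr eq_sym => /eqP.
rewrite -e1 lsingle_eq //; last exact: gam1.
rewrite /gcong mulg1; split=> [/gamV|h]; first by rewrite invgK.
exact: gamV.
Qed.

Lemma lsingleV n x : gam n x -> e n x^-1%g = - e n x.
Proof.
move=> xn; apply/eqP; rewrite -addr_eq0 -lsingleM //; last exact: gamV.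
by rewrite mulVg; apply/eqP/lsingle_eq0; apply: gam1.
Qed.

Lemma lsingleX n x i : gam n x -> e n (x ^+ i)%g = e n x *+ i.
Proof.
move=> xn; elim: i => [|i IH]; first by apply/lsingle_eq0; apply: gam1.
by rewrite expgS mulrS lsingleM ?IH //; apply: subgroupX => //; apply: gam_sub.
Qed.

Lemma gcong_conj n x y : gam n x -> gcong n x (x ^ y)%g.
Proof. by move=> xn; rewrite /gcong -commgEl; apply: gamma_commg. Qed.

Lemma lsingleJ n x y : gam n x -> e n (x ^ y)%g = e n x.
Proof.
by move=> xn; apply/esym/lsingle_eq => //; [apply: gamma_conj|apply: gcong_conj].
Qed.

Fact gseq_br_subproof m c (f : gseq) i :
  gam i (if (m <= i)%N && `[<gam m c>] then [~ f (i - m)%N, c]%g else 1%g).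
Proof.
case: leqP => [mi|_] /=; [case: asboolP => [cm|_]|]; try exact: gam1.
by rewrite -[X in gam X](subnK mi); apply: gamma_comm => //; apply: gvalP.
Qed.
Definition gseq_br m c f := Gseq (gseq_br_subproof m c f).
(** The operator l |-> [l, c], with c placed in degree m. Only brackets with one homogeneous
    argument occur, so the full bilinear bracket is not constructed. *)
Definition lbr m c (l : lie) : lie := lclass (gseq_br m c (lrepr l)).

Lemma gcong_commg j m x y c : gam j x -> gam m c -> gcong j x y -> gcong (j + m)%N [~ x, c]%g [~ y, c]%g.
Proof.
move=> xj cm xy; rewrite -[y](mulVKg x) commgMl; set u := (x^-1 * y)%g.
have h : gam (j + m).+1%N [~ u, c]%g by rewrite -addSn; apply: gamma_comm.
rewrite -[X in gcong _ X _]mulg1; apply: gcongM; last by rewrite /gcong invg1 mul1g.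
by apply: gcong_conj; apply: gamma_comm.
Qed.

Lemma lbr_class m c f : lbr m c (lclass f) = lclass (gseq_br m c f).
Proof.
apply/lclassP => i /=; case: leqP => [mi|_] /=; [case: asboolP => [cm|_]|]; try exact: gcong_refl.
by rewrite -{1}(subnK mi); apply: gcong_commg (lrepr_cong _ _) => //; apply: gvalP.
Qed.

Lemma lbrD m c a b : lbr m c (a + b) = lbr m c a + lbr m c b.
Proof.
rewrite -[a]lreprK -[b]lreprK -lclassM !lbr_class -lclassM; apply/lclassP => i /=.
case: leqP => [mi|_] /=; [case: asboolP => [cm|_]|]; rewrite ?mulg1; try exact: gcong_refl.
rewrite commgMl; apply: gcongM (gcong_refl _ _); apply: gcong_sym; apply: gcong_conj.
by rewrite -{1}(subnK mi); apply: gamma_comm => //; apply: gvalP.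
Qed.

Lemma lbr0 m c : lbr m c 0 = 0.
Proof. by apply: (addrI (lbr m c 0)); rewrite -lbrD !addr0. Qed.
Lemma lbrN m c a : lbr m c (- a) = - lbr m c a.
Proof. by apply/eqP; rewrite -addr_eq0 -lbrD addNr lbr0. Qed.

Lemma lbr_single j m x c : gam j x -> gam m c -> lbr m c (e j x) = e (j + m)%N [~ x, c]%g.
Proof.
move=> xj cm; rewrite lbr_class; apply/lclassP => i /=.
have xc := gamma_comm xj cm; rewrite (asboolT xj) (asboolT cm) (asboolT xc) !andbT.
case: leqP => mi; last by case: eqP => [ij|_]; [lia|apply: gcong_refl].
have -> : (i - m == j)%N = (i == j + m)%N by lia.
by case: eqP => [->|_]; rewrite ?comm1g; apply: gcong_refl.
Qed.

Section Bilinear.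
Variables (j m : nat) (x c : G).
Hypotheses (xj : gam j x) (cm : gam m c).

Lemma lsingleR : e (j + m)%N [~ x, c]%g = - e (m + j)%N [~ c, x]%g.
Proof. by have h := gamma_comm cm xj; rewrite -invgR [(j + m)%N]addnC lsingleV. Qed.

Lemma lsingleRVl : e (j + m)%N [~ x^-1, c]%g = - e (j + m)%N [~ x, c]%g.
Proof. by rewrite -!lbr_single ?lsingleV ?lbrN //; apply: gamV. Qed.
End Bilinear.

Lemma lsingleRVr j m x c : gam j x -> gam m c ->
  e (j + m)%N [~ x, c^-1]%g = - e (j + m)%N [~ x, c]%g.
Proof.
move=> xj cm; rewrite lsingleR ?lsingleRVl ?opprK //; last exact: gamV.
by rewrite [RHS](congr1 _ (lsingleR xj cm)) opprK.
Qed.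

Lemma lsingleRMr j m x c d : gam j x -> gam m c -> gam m d ->
  e (j + m)%N [~ x, c * d]%g = e (j + m)%N [~ x, c]%g + e (j + m)%N [~ x, d]%g.
Proof.
move=> xj cm dm; rewrite (lsingleR xj cm) (lsingleR xj dm) (lsingleR xj (gamM cm dm)).
by rewrite -!lbr_single ?lsingleM ?lbrD ?opprD //; apply: gamM.
Qed.

(** The Hall-Witt identity in gamma_N / gamma_(N+1), where conjugations disappear and inverses
    become signs. *)
Lemma lsingle_jacobi j m x y z : gam j x -> gam m y ->
  e (j + m).+1 [~ x, [~ y, z]]%g = e (j + m).+1 [~ [~ x, y], z]%g - e (j + m).+1 [~ [~ x, z], y]%g.
Proof.
move=> xj ym; set N := (j + m).+1.
have z1 (g : G) : gam 1 g by [].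
have xy := gamma_comm xj ym; have yz : gam m.+1 [~ y, z]%g by apply: gamma_commg.
have xz : gam j.+1 [~ x, z]%g by apply: gamma_commg.
have NE1 : (m.+1 + j)%N = N by lia.
have NE2 : (j.+1 + m)%N = N by lia.
have NE3 : ((j + m) + 1)%N = N by lia.
have ha : gam N [~ [~ y, z], x]%g by rewrite -NE1; apply: gamma_comm.
have hb : gam N [~ [~ z^-1, x^-1], y]%g.
  by rewrite -NE2; apply: gamma_comm => //; rewrite -invgR; apply/gamV/gamma_commg/gamV.
have hc : gam N [~ [~ x, y^-1], z^-1]%g.
  by apply: gamma_commg; apply: gamma_comm => //; apply: gamV.
have := hall_witt y z^-1 x; rewrite invgK => /(congr1 (e N)).
have -> : e N 1%g = 0 by apply/lsingle_eq0; apply: gam1.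
have hJ g t : gam N g -> gam N (g ^ t)%g by apply: gamma_conj.
rewrite (lsingleM (gamM (hJ _ z^-1%g ha) (hJ _ x hb)) (hJ _ y hc)).
rewrite (lsingleM (hJ _ z^-1%g ha) (hJ _ x hb)) (lsingleJ _ ha) (lsingleJ _ hb) (lsingleJ _ hc).
have -> : e N [~ [~ y, z], x]%g = - e N [~ x, [~ y, z]]%g.
  by rewrite -[in LHS]NE1 lsingleR //; congr (- e _ _); lia.
have -> : e N [~ [~ z^-1, x^-1], y]%g = - e N [~ [~ x, z], y]%g.
  rewrite -NE2 -lbr_single //; last by rewrite -invgR; apply/gamV/gamma_commg/gamV.
  rewrite -lbr_single // -lbrN; congr lbr.
  have E1 : (1 + j)%N = j.+1 by [].
  rewrite -E1 lsingleRVl ?lsingleRVr ?opprK //; try exact: gamV.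
  by rewrite lsingleR // addn1.
have -> : e N [~ [~ x, y^-1], z^-1]%g = e N [~ [~ x, y], z]%g.
  rewrite -NE3 lsingleRVr //; last by apply: gamma_comm => //; apply: gamV.
  rewrite -(lbr_single (gamma_comm xj (gamV ym)) (z1 z)) -(lbr_single xy (z1 z)).
  by rewrite lsingleRVr // lbrN opprK.
by move/eqP; rewrite -addrA addrC addr_eq0 opprK => /eqP <-; rewrite addrC.
Qed.

Lemma lbr_jacobi m g h l : (0 < m)%N -> gam m g ->
  lbr m.+1 [~ g, h]%g l = lbr 1 h (lbr m g l) - lbr m g (lbr 1 h l).
Proof.
move=> m0 gm; rewrite -[l]lreprK; move: (lrepr l) => f.
rewrite !lbr_class -lclassV -lclassM; apply/lclassP => i /=.
rewrite (asboolT gm) (asboolT (gamma_commg h gm)) (@asboolT (gam 1 h)) // !andbT.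
(* In degrees i <= m all the iterated brackets are out of range and equal 1. *)
have [mi|im] := ltnP m i; last first.
  case: (leqP 1 i) => i1; last first.
    by rewrite (leqNgt m i) (leq_trans _ m0) //= invg1 mulg1; apply: gcong_refl.
  have -> : (m <= i - 1)%N = false by lia.
  case: (leqP m i) => mi; rewrite ?comm1g; last by rewrite invg1 mulg1; apply: gcong_refl.
  have -> : (1 <= i - m)%N = false by lia.
  by rewrite comm1g invg1 mulg1; apply: gcong_refl.
have -> : (0 < i)%N by lia.
have -> : (m <= i - 1)%N by lia.
have -> : (m <= i)%N by lia.
have -> : (1 <= i - m)%N by lia.
have -> : (i - 1 - m = i - m.+1)%N by lia.
have -> : (i - m - 1 = i - m.+1)%N by lia.
have iE : (i - m.+1 + m).+1 = i by lia.
have := lsingle_jacobi h (gvalP f (i - m.+1)) gm; rewrite iE.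
have fi := gvalP f (i - m.+1); move: (f (i - m.+1)%N) fi => x xi.
have h1 : gam i [~ x, [~ g, h]]%g by rewrite -iE -addnS; apply: gamma_comm => //; apply: gamma_commg.
have h2 : gam i [~ [~ x, g], h]%g by rewrite -iE; apply: gamma_commg; apply: gamma_comm.
have h3 : gam i [~ [~ x, h], g]%g by rewrite -iE -addSn; apply: gamma_comm => //; apply: gamma_commg.
rewrite -lsingleV // -lsingleM //; last exact: gamV.
by move/lsingle_eq; apply=> //; apply: gamM => //; apply: gamV.
Qed.

Lemma lbrMr m c d l : gam m c -> gam m d -> lbr m (c * d)%g l = lbr m c l + lbr m d l.
Proof.
move=> cm dm; rewrite -[l]lreprK; move: (lrepr l) => f.
rewrite !lbr_class -lclassM; apply/lclassP => i /=.
rewrite (asboolT cm) (asboolT dm) (asboolT (gamM cm dm)) !andbT.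
case: leqP => mi; last by rewrite mulg1; apply: gcong_refl.
have h c' : gam m c' -> gam i [~ f (i - m)%N, c']%g.
  by move=> c'm; rewrite -[X in gam X](subnK mi); apply: gamma_comm => //; apply: gvalP.
apply/lsingle_eq; [by apply: h; apply: gamM|by apply: gamM; apply: h|].
rewrite lsingleM; [|exact: h|exact: h].
by have := lsingleRMr (gvalP f (i - m)) cm dm; rewrite subnK.
Qed.

Lemma lbr1 m l : lbr m 1%g l = 0.
Proof.
apply: (addrI (lbr m 1%g l)); rewrite -lbrMr ?mulg1 ?addr0 //; exact: gam1.
Qed.
Lemma lbrVr m c l : gam m c -> lbr m c^-1%g l = - lbr m c l.
Proof.
move=> cm; apply/eqP; rewrite -addr_eq0 -lbrMr //; last exact: gamV.
by rewrite mulVg lbr1.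
Qed.
End LieRing.

(** * Dynkin's operator *)

Section LieOperators.
Variable G : groupType.
Implicit Types l : lie G.

Lemma lbrB m (c : G) l l' : lbr m c (l - l') = lbr m c l - lbr m c l'.
Proof. by rewrite lbrD lbrN. Qed.
HB.instance Definition _ m (c : G) := GRing.isZmodMorphism.Build (lie G) (lie G) (lbr m c) (lbrB m c).

Lemma lbrZ m (c : G) (n : int) l : lbr m c (n *: l) = n *: lbr m c l.
Proof. exact: (raddfMz (lbr m c)). Qed.

Definition lproj n l : lie G := lsingle n (lrepr l n).

Lemma lproj_class n f : lproj n (lclass f) = lsingle n (f n).
Proof. by apply/lsingle_eq; [exact: gvalP|exact: gvalP|exact: lrepr_cong]. Qed.

Lemma lprojB n l l' : lproj n (l - l') = lproj n l - lproj n l'.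
Proof.
rewrite -[l]lreprK -[l']lreprK -lclassV -lclassM !lproj_class /=.
by rewrite lsingleM ?lsingleV //; [exact: gvalP|exact: gvalP|apply/gamV/gvalP].
Qed.
HB.instance Definition _ n := GRing.isZmodMorphism.Build (lie G) (lie G) (lproj n) (lprojB n).

Lemma lprojZ m (n : int) l : lproj m (n *: l) = n *: lproj m l.
Proof. exact: (raddfMz (lproj m)). Qed.

Lemma lproj_sum n (T : Type) (s : seq T) (f : T -> lie G) :
  lproj n (\sum_(a <- s) f a) = \sum_(a <- s) lproj n (f a).
Proof. exact: (raddf_sum (lproj n)). Qed.

Lemma lproj_single n m (x : G) : gamma m x -> lproj n (lsingle m x) = if n == m then lsingle n x else 0.
Proof.
move=> xm; rewrite lproj_class /= asboolT // andbT.
by case: eqP => [->|_] //; apply/lsingle_eq0; exact: gam1.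
Qed.
End LieOperators.

Section IdealSums.
Variables (R : pzRingType) (J : ideal R).

Lemma ideal_subD (a b c d : R) : J (a - c) -> J (b - d) -> J (a + b - (c + d)).
Proof. by move=> h1 h2; rewrite opprD addrACA; apply: idealD. Qed.
Lemma ideal_subB (a b c d : R) : J (a - c) -> J (b - d) -> J (a - b - (c - d)).
Proof.
move=> h1 h2; have -> : a - b - (c - d) = (a - c) - (b - d) by rewrite !opprD !opprK addrACA.
exact: idealB.
Qed.
Lemma ideal_subN (a b c : R) : J (a - b) -> J (- (b + c)) -> J (- a - c).
Proof.
move=> h1 h2; have -> : - a - c = - (a - b) + - (b + c) by rewrite -!opprD addrA subrK.
by apply: idealD => //; apply: idealN.
Qed.
End IdealSums.

Lemma ideal_pow_subM (R : pzRingType) (I : ideal R) m n (x y a b : R) :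
  ideal_pow I m.+1 (x - a) -> ideal_pow I m a -> ideal_pow I n.+1 (y - b) -> ideal_pow I n b ->
  ideal_pow I (m + n).+1 (x * y - a * b).
Proof.
move=> xa am yb bn; have yn : ideal_pow I n y.
  by rewrite -[y](subrK b); apply: idealD => //; exact: (ideal_pow_sub yb).
apply: (@ideal_subKA _ _ (a * y)).
  by rewrite -mulrBl -addSn; apply: ideal_powM.
by rewrite -mulrBr -addnS; apply: ideal_powM.
Qed.

Section Dynkin.
Variables (V : choiceType) (E : rel V).
Local Notation A := (raag E).
Local Notation kA := (group_ring int A).
Local Notation I := (ideal_pow (aug_ideal kA)).
Local Notation F := (free_alg int V).
Local Notation L := (lie A).
Local Notation e := (@lsingle A).
Local Notation xg := (raag_gen E).
Implicit Types (x y : F) (l : L) (w : seq V) (g h : A).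

Definition lie_actw w l : L := foldl (fun l v => lbr 1 (xg v) l) l w.

(* The left-normed bracket of the letters of [w]; on a Lie polynomial of degree n,
   its linear extension is multiplication by n (Dynkin). *)
Definition dynw w : L := if w is v :: w' then lie_actw w' (e 1 (xg v)) else 0.

(** The right action of the free algebra by adjoint operators, which explains the order of factors
    in [lie_actM]. *)
Definition lie_act x l : L := lext (fun m : {fmonom V} => lie_actw m l) x.
Definition dyn x : L := lext (fun m : {fmonom V} => dynw m) x.

Lemma lie_actw_cat u w l : lie_actw (u ++ w) l = lie_actw w (lie_actw u l).
Proof. exact: foldl_cat. Qed.

Lemma lie_actw_linear w n l l' : lie_actw w (n *: l + l') = n *: lie_actw w l + lie_actw w l'.
Proof. by elim: w l l' => //= v w IH l l'; rewrite lbrD lbrZ IH. Qed.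

Lemma lie_actw0 w : lie_actw w 0 = 0.
Proof. by elim: w => //= v w IH; rewrite lbr0. Qed.

Lemma lie_actw_sum w (s : seq (int * seq V)) (f : seq V -> L) :
  lie_actw w (\sum_(a <- s) a.1 *: f a.2) = \sum_(a <- s) a.1 *: lie_actw w (f a.2).
Proof.
elim: s => [|a s IH]; first by rewrite !big_nil lie_actw0.
by rewrite !big_cons lie_actw_linear IH.
Qed.

Lemma lie_actD x y l : lie_act (x + y) l = lie_act x l + lie_act y l.
Proof. exact: lextD. Qed.
Lemma lie_actN x l : lie_act (- x) l = - lie_act x l.
Proof. exact: lextN. Qed.
Lemma dynD x y : dyn (x + y) = dyn x + dyn y.
Proof. exact: lextD. Qed.
Lemma dynN x : dyn (- x) = - dyn x.
Proof. exact: lextN. Qed.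

Lemma lext_lcomb (f : seq V -> L) s :
  lext (fun m : {fmonom V} => f m) (lcomb s : F) = \sum_(a <- s) a.1 *: f a.2.
Proof.
rewrite /lcomb; elim: s => [|a s IH]; first by rewrite !big_nil lext0.
by rewrite !big_cons lextD IH lextZ lextU scale1r.
Qed.

Lemma lie_act_lcomb s l : lie_act (lcomb s) l = \sum_(a <- s) a.1 *: lie_actw a.2 l.
Proof. exact: (lext_lcomb (lie_actw^~ l)). Qed.
Lemma dyn_lcomb s : dyn (lcomb s) = \sum_(a <- s) a.1 *: dynw a.2.
Proof. exact: lext_lcomb. Qed.

Lemma lie_actM x y l : lie_act (x * y) l = lie_act y (lie_act x l).
Proof.
have [s ->] := lcomb_exists x; have [s' ->] := lcomb_exists y.
rewrite -lcombM !lie_act_lcomb big_allpairs_dep exchange_big; apply: eq_bigr => b _ /=.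
rewrite (lie_actw_sum b.2 s (lie_actw^~ l)) scaler_sumr; apply: eq_bigr => a _.
by rewrite lie_actw_cat scalerA mulrC.
Qed.

Lemma dynM x y : spans (fun w => 0 < size w)%N x -> dyn (x * y) = lie_act y (dyn x).
Proof.
move=> [s s0 ->]; have [s' ->] := lcomb_exists y.
rewrite -lcombM lie_act_lcomb !dyn_lcomb big_allpairs_dep exchange_big; apply: eq_bigr => b _ /=.
rewrite (lie_actw_sum b.2 s dynw) scaler_sumr [LHS]big_seq [RHS]big_seq; apply: eq_bigr => a /s0.
case: a => c [|v w] // _.
by rewrite -lie_actw_cat scalerA mulrC.
Qed.

Lemma dynw_single w : exists2 c, gamma (size w) c & dynw w = e (size w) c.
Proof.
case: w => [|v w]; first by exists 1%g => //; apply/esym/lsingle_eq0.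
rewrite -[size _]/(size w).+1 -[dynw _]/(lie_actw w (e 1 (xg v))).
elim/last_ind: w => [|w u [c cw IH]]; first by exists (xg v).
exists [~ c, xg u]%g; rewrite size_rcons; first exact: gamma_commg.
by rewrite -cats1 lie_actw_cat IH -[lie_actw _ _]/(lbr 1 _ _) lbr_single // addn1.
Qed.

(** At the head of the word the two brackets are trivial; further on, the Jacobi identity makes the
    adjoint operators of commuting letters commute. So [dyn] descends to R. *)
Lemma dynw_swap s i j s' : E i j -> dynw (s ++ i :: j :: s') = dynw (s ++ j :: i :: s').
Proof.
move=> ij; have c1 : [~ xg i, xg j]%g = 1%g by apply/eqP/commgP; exact: raag_genC.
have g1 v : gamma 1 (xg v) by [].
case: s => [|v s] /=.
  rewrite !lbr_single // c1 -[[~ xg j, xg i]%g]invgK invgR c1 invg1.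
  by congr lie_actw.
rewrite !lie_actw_cat /=; congr lie_actw; set l := lie_actw s _.
apply/eqP; rewrite -subr_eq0 -(@lbr_jacobi _ 1) // c1 lbr1; exact/eqP.
Qed.

Lemma dyn_pc_ideal x : pc_ideal E int x -> dyn x = 0.
Proof. exact: (lext_pc_ideal dynw_swap). Qed.

(** A Lie polynomial lifting the leading term of g. The last clause makes the third one inductive,
    through dyn(bc - cb) = lie_act c (dyn b) - lie_act b (dyn c). *)
Definition lie_poly m g (b : F) : Prop :=
  [/\ spans (fun w => size w = m) b, I m.+1 (fev E b - gdif int g),
      dyn b = e m g *+ m & forall l, lie_act b l = lbr m g l].

Lemma lie_polyM m g h b c : (0 < m)%N -> gamma m g -> gamma m h ->
  lie_poly m g b -> lie_poly m h c -> lie_poly m (g * h)%g (b + c).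
Proof.
move=> m0 gm hm [sb Ib Db Ab] [sc Ic Dc Ac]; split.
- exact: spansD.
- have h1 := gdifM_congr (gamma_gdelta int gm) (gamma_gdelta int hm).
  rewrite fevD; apply: (ideal_subKA (ideal_subD Ib Ic)).
  rewrite -opprB; apply: idealN; apply: (ideal_pow_leq _ h1); lia.
- by rewrite dynD Db Dc -mulrnDl lsingleM.
- by move=> l; rewrite lie_actD Ab Ac lbrMr.
Qed.

Lemma lie_poly1 m : lie_poly m 1%g 0.
Proof.
have e0 : e m 1%g = 0 by apply/lsingle_eq0; exact: gam1.
split=> [|||l]; [exact: spans0| |by rewrite e0 mul0rn; exact: lext0|by rewrite lbr1; exact: lext0].
by rewrite gdif1 subr0; apply/fev_ideal_powP => t _; exact: tcoef0.
Qed.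

Lemma lie_polyV m g b : (0 < m)%N -> gamma m g -> lie_poly m g b -> lie_poly m g^-1%g (- b).
Proof.
move=> m0 gm [sb Ib Db Ab]; have gm' := gamV gm; split.
- exact: spansN.
- have := gdifM_congr (gamma_gdelta int gm) (gamma_gdelta int gm').
  rewrite mulgV gdif1 sub0r => h1.
  have E1 : fev E (- b) = - fev E b.
    by rewrite -[in RHS](opprK b); apply/eqP; rewrite -addr_eq0 -fevD opprK addNr -(subrr 1) fevB subrr.
  rewrite E1; apply: (ideal_subN Ib); apply: (ideal_pow_leq _ h1); lia.
- by rewrite dynN Db lsingleV // mulNrn.
- by move=> l; rewrite lie_actN Ab lbrVr.
Qed.

Lemma lie_poly_gen v : lie_poly 1 (xg v) (free_gen int v).
Proof.
rewrite -(free_word1 int v); split.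
- by rewrite -[free_word _ _]scale1r; apply: spans_word.
- by rewrite free_word1 fev_gen subrr; apply: ideal0.
- by rewrite /dyn /free_word lextU scale1r.
- by move=> l; rewrite /lie_act /free_word lextU scale1r.
Qed.

(** The Dynkin factor comes from m [g, h] - [h, g] = (m + 1) [g, h]. *)
Lemma lie_polyR m g h b c : (0 < m)%N -> gamma m g ->
  lie_poly m g b -> lie_poly 1 h c -> lie_poly m.+1 [~ g, h]%g (b * c - c * b).
Proof.
move=> m0 gm [sb Ib Db Ab] [sc Ic Dc Ac]; have h1 : gamma 1 h by [].
have gd := gamma_gdelta int gm; have hd := gdelta1 (k := int) h.
split.
- apply: spansD; last apply: spansN.
    by apply: spansM sb sc => u w uE wE; rewrite size_cat uE wE addn1.
  by apply: spansM sc sb => u w uE wE; rewrite size_cat uE wE.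
- have := gdif_commg gd hd; rewrite addn1 => hc.
  have e1 : I m.+2 (fev E b * fev E c - gdif int g * gdif int h).
    by have := ideal_pow_subM Ib gd Ic hd; rewrite addn1.
  have e2 : I m.+2 (fev E c * fev E b - gdif int h * gdif int g).
    by have := ideal_pow_subM Ic hd Ib gd; rewrite add1n.
  rewrite (fevB E (b * c) (c * b)) (fevM E b c) (fevM E c b); apply: (ideal_subKA (ideal_subB e1 e2)).
  rewrite -opprB; exact: (idealN hc).
- rewrite (dynD (b * c) (- (c * b))) (dynN (c * b)) (dynM c (spans_mono _ sb)) ?(dynM b (spans_mono _ sc)); [|by move=> u ->|by move=> u ->].
  rewrite Db Dc Ac Ab mulr1n (raddfMn (lbr 1 h)) /= !lbr_single // add1n addn1.
  rewrite -(invgR g h) lsingleV ?opprK; last exact: gamma_commg.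
  by rewrite mulrSr.
- move=> l; rewrite (lie_actD (b * c) (- (c * b))) (lie_actN (c * b)) (lie_actM b c) (lie_actM c b) !Ab !Ac.
  by rewrite lbr_jacobi.
Qed.

Lemma lie_poly_exists m g : (0 < m)%N -> gamma m g -> exists b, lie_poly m g b.
Proof.
case: m => // m _.
have sP n : (0 < n)%N -> subgroup_axiom [set x : A | gamma n x /\ exists b, lie_poly n x b].
  move=> n0; split=> [|x y [xn [b xb]] [yn [c yc]]].
    by split; [exact: gam1|exists 0; exact: lie_poly1].
  have yV := gamV yn; split; first exact: gamM.
  by exists (b - c); apply: lie_polyM => //; apply: lie_polyV.
have P1 h : exists b, lie_poly 1 h b.
  elim/raag_ind: h => [|v x [b xb]|v x [b xb]].
  - by exists 0; exact: lie_poly1.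
  - by exists (free_gen int v + b); apply: lie_polyM => //; exact: lie_poly_gen.
  - exists (- free_gen int v + b); apply: lie_polyM => //.
    by apply: lie_polyV => //; exact: lie_poly_gen.
elim: m g => [|m IH] g gm; first exact: P1.
suff /(_ _ gm) [] : gamma m.+2 `<=` [set x : A | gamma m.+2 x /\ exists b, lie_poly m.+2 x b] by [].
apply: subgroup_gen_min => [|_ [x xm [y _ <-]]]; first exact: sP.
split; first exact: gamma_commg.
have [b xb] := IH x xm; have [c yc] := P1 y.
by exists (b * c - c * b); apply: lie_polyR.
Qed.

Lemma gamma_gdelta_succ n g : (0 < n)%N -> gamma n g -> gdelta int n.+1 g -> gamma n.+1 (g ^+ n)%g.
Proof.
move=> n0 gn gd; have [b [_ Ib Db _]] := lie_poly_exists n0 gn.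
(* Modulo the commutation relations, [b] becomes a polynomial [y] in words longer than n. Thus
   [dyn b] has no component in degree n, whereas it equals n times the class of g there. *)
have /fev_ideal_powP/tcoef0_spans [y sy by_] : I n.+1 (fev E b).
  by rewrite -[fev E b](subrK (gdif int g)); apply: idealD.
have gX : gamma n (g ^+ n)%g by exact: (subgroupX n (@gamma_subgroup A n) gn).
apply/(lsingle_eq0 gX); rewrite lsingleX //.
have <- : lproj n (e n g *+ n) = e n g *+ n.
  by rewrite (raddfMn (lproj n)) /= lproj_single // eqxx.
rewrite -Db -[b](subrK y) dynD (dyn_pc_ideal by_) add0r.
have [s ss ->] := sy; rewrite dyn_lcomb lproj_sum big_seq big1 // => a /ss an.
have [c cn] := dynw_single a.2; rewrite lprojZ => ->; rewrite lproj_single //.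
by case: eqP => [nE|_]; [move: an; rewrite /= -nE ltnn|rewrite scaler0].
Qed.

(** The climb from gamma_1 to gamma_(n+1) multiplies the exponent by 1, 2, ..., n in turn. *)
Theorem gdelta_gamma0 n : (0 < n)%N -> gdelta int n `<=` @gamma0 A n.
Proof.
case: n => // n _ g gd; suff h i : (i <= n)%N -> exists2 m, (0 < m)%N & gamma i.+1 (g ^+ m)%g.
  by have [m m0 gm] := h n (leqnn n); exists m%:Z => //; case: m m0 {gm}.
elim: i => [|i IH] lin; first by exists 1%N.
have [m m0 gm] := IH (ltnW lin); exists (m * i.+1)%N; first by rewrite muln_gt0 m0.
rewrite expgnA; apply: gamma_gdelta_succ => //.
apply: (subgroupX m (@gdelta_subgroup int A i.+2)).
by apply: (gdelta_leq _ gd); rewrite ltnS.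
Qed.
End Dynkin.

(** * The theorem *)

Section FiniteSubgraph.
Variables (V : choiceType) (E : rel V) (W : seq V).
Local Notation T := (seq_sub W).
Local Notation E0 := (relpre (val : T -> V) E).

Lemma subgraph_incl_genC (v w : T) : E0 v w ->
  (raag_gen E (val v) * raag_gen E (val w) = raag_gen E (val w) * raag_gen E (val v))%g.
Proof. by move=> vw; apply: raag_genC. Qed.
Definition subgraph_incl : raag E0 -> raag E := raag_lift subgraph_incl_genC.
HB.instance Definition _ := UMagmaMorphism.copy subgraph_incl (raag_lift subgraph_incl_genC).

(** Sending the letters outside [W] to 1 respects the commutation relations, so the group on the
    letters of [W] is a retract. *)
Definition retract_gen (v : V) : raag E0 := if insub v is Some t then raag_gen E0 t else 1%g.
Lemma retract_genC v w : E v w -> (retract_gen v * retract_gen w = retract_gen w * retract_gen v)%g.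
Proof.
rewrite /retract_gen; case: insubP => [t _ <-|_ _]; last by rewrite mul1g mulg1.
case: insubP => [s _ <-|_ _]; last by rewrite mul1g mulg1.
by move=> vw; apply: raag_genC.
Qed.
Definition subgraph_retract : raag E -> raag E0 := raag_lift retract_genC.
HB.instance Definition _ := UMagmaMorphism.copy subgraph_retract (raag_lift retract_genC).

Lemma subgraph_retractK (u : word V) : all (fun a => a.1 \in W) u ->
  subgraph_incl (subgraph_retract (word_class (raag_rel E) u)) = word_class (raag_rel E) u.
Proof.
pose f x := subgraph_incl (subgraph_retract x).
have fM x y : f (x * y)%g = (f x * f y)%g by rewrite /f !gmulfM.
have f1 : f 1%g = 1%g by rewrite /f !gmulf1.
have fV x : f x^-1%g = (f x)^-1%g by rewrite /f !gmulfV.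
rewrite -/(f _); elim: u => [_|[v b] u IH /= /andP [vW /IH uE]]; first exact: f1.
have vE : f (raag_gen E v) = raag_gen E v.
  rewrite /f /subgraph_retract raag_lift_gen /retract_gen insubT /= /subgraph_incl.
  by rewrite raag_lift_gen.
rewrite word_class_cons fM uE; congr (_ * _)%g.
by case: b; [exact: vE|rewrite word_class_false fV vE].
Qed.

Lemma raag_seq_sub_gens (H : set (raag E0)) : subgroup_axiom H ->
  (forall x, x \in [seq raag_gen E0 t | t <- enum {: T}] -> H x) -> forall g, H g.
Proof.
move=> sH hH; have hg t : H (raag_gen E0 t) by apply: hH; apply: map_f; rewrite mem_enum.
elim/raag_ind => [|v x Hx|v x Hx]; first exact: subgroup1.
- exact: subgroupM.
- by apply: subgroupM => //; apply: subgroupV.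
Qed.
End FiniteSubgraph.

(** With [W] the letters of a word for g, the retraction preserves delta_n, [jennings_lazard]
    applies to the finitely generated retract, and the inclusion preserves gamma_(n,p). *)
Lemma gdelta_gammap (V : choiceType) (E : rel V) p n : prime p -> (0 < n)%N ->
  gdelta 'F_p n `<=` @gammap (raag E) p n.
Proof.
move=> pp n0 g gn; pose u := word_repr g; pose W := map fst u.
have uW : all (fun a => a.1 \in W) u by apply/allP => a au; apply: map_f.
rewrite -[g]word_reprK -(subgraph_retractK E uW) word_reprK.
apply: gammap_morph; first exact: prime_gt1.
apply: (jennings_lazard pp (@raag_seq_sub_gens _ E W)) => //.
exact: gdelta_morph.
Qed.

Lemma intr_eq0_pchar (R : nzRingType) p (c : int) : p \in [pchar R] ->
  (c%:~R == 0 :> R) = (p %| `|c|)%N.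
Proof.
move=> charRp; rewrite (dvdn_pcharf charRp).
by case: c => n; rewrite ?NegzE /= ?mulrNz ?oppr_eq0 //= absz_nat.
Qed.

Section Transfer.
Variables (V : choiceType) (E : rel V) (k : comNzRingType).
Local Notation A := (raag E).

Lemma gdelta_pchar p n : p \in [pchar k] -> gdelta k n = @gdelta 'F_p A n.
Proof.
move=> charkp; have charFp := pchar_Fp (pcharf_prime charkp).
by apply/seteqP; split; apply: gdelta_transfer => c /eqP;
  rewrite (intr_eq0_pchar _ charkp, intr_eq0_pchar _ charFp) => h; apply/eqP;
  rewrite (intr_eq0_pchar _ charkp, intr_eq0_pchar _ charFp).
Qed.

Lemma gdelta_char_zero n : char_zero k -> gdelta k n = @gdelta int A n.
Proof.
move=> k0; apply/seteqP; split; apply: gdelta_transfer => c; last by rewrite intz => ->.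
case: c => m; rewrite ?NegzE ?mulrNz => /eqP; rewrite ?oppr_eq0 => /eqP /k0 ->; by [].
Qed.

(** If d > 0 is the least positive integer vanishing in k, every integer vanishing in k is a
    multiple of d, and a prime divisor of d works. If there is no such d, only 0 vanishes in k and
    any prime will do. *)
Lemma exists_residue_prime : exists2 p, prime p &
  forall c : int, c%:~R = 0 :> k -> c%:~R = 0 :> 'F_p.
Proof.
have absE (c : int) : c%:~R = 0 :> k -> `|c|%N%:R = 0 :> k.
  by case: c => m; rewrite ?NegzE ?mulrNz // => /eqP; rewrite oppr_eq0 => /eqP.
case: (pselect (exists n, (0 < n)%N && (n%:R == 0 :> k))) => [ex|nex]; last first.
  exists 2%N => // c /absE c0; case: (posnP `|c|%N) => [/eqP|cgt0].
    by rewrite absz_eq0 => /eqP ->.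
  by case: nex; exists `|c|%N; rewrite cgt0 c0 eqxx.
have [d /andP [d0 dk] dmin] := ex_minnP ex.
have d1 : (1 < d)%N by case: d d0 dk {dmin} => [|[|]] //; rewrite oner_eq0.
exists (pdiv d); first exact: pdiv_prime.
move=> c /absE c0; apply/eqP; rewrite (intr_eq0_pchar _ (pchar_Fp (pdiv_prime d1))).
apply: dvdn_trans (pdiv_dvd d) _; rewrite /dvdn; apply/negP => /negP r0.
have /dmin : (0 < `|c| %% d)%N && ((`|c| %% d)%:R == 0 :> k).
  rewrite lt0n r0 /=; move: c0; rewrite {1}(divn_eq `|c| d) natrD natrM (eqP dk) mulr0 add0r.
  by move=> ->.
by rewrite leqNgt ltn_mod d0.
Qed.
End Transfer.

Lemma magnus_injective (V : choiceType) (E : rel V) (k : comNzRingType) :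
  symmetric E -> irreflexive E -> injective (@magnus V E k).
Proof.
move=> E_sym E_irr g h gh.
have [p pp pk] := exists_residue_prime k.
have m1 : @magnus V E k (g * h^-1)%g = 1%g.
  transitivity (@magnus V E k g * (@magnus V E k h)^-1)%g; first by rewrite gmulfM gmulfV.
  by rewrite gh mulgV.
have gd n : gdelta k n (g * h^-1)%g.
  rewrite gdeltaE dimension_subgroup_magnus /dimension_subgroup /mkset m1 subrr.
  by apply/compl_filtrationE; exact: qpi0.
rewrite -[g](mulgVK h) (raag_gdelta_eq1 (k := 'F_p) (p := p) _ E_sym E_irr (g := (g * h^-1)%g)) ?mul1g //.
  exact: pchar_Fp.
by move=> n; apply: (gdelta_transfer pk); exact: gd.
Qed.

Theorem theorem1 (V : choiceType) (E : rel V)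
    (E_sym : symmetric E) (E_irr : irreflexive E) (k : comNzRingType) :
  let A := raag E in
  let kA := group_ring k A in
  let R := pc_alg E k in
  let Rbar := completion R in
  (exists mu : {multiplicative A -> units Rbar},
    [/\ forall v, uval (mu (raag_gen E v)) = 1 + compl_of (pc_gen E k v),
        injective mu,
        [/\ char_zero k -> forall n, (0 < n)%N ->
              dimension_subgroup (compl_filtration (A := R) n) mu
                = gamma0 (G := A) n,
            forall p, p \in [pchar k] -> forall n, (0 < n)%N ->
              dimension_subgroup (compl_filtration (A := R) n) mu
                = gammap (G := A) p n
          & forall n, (0 < n)%N ->
              dimension_subgroup (ideal_pow (aug_ideal Rbar) n) mu
                = dimension_subgroup (compl_filtration (A := R) n) mu]
      & forall n, (0 < n)%N ->
          dimension_subgroup (ideal_pow (aug_ideal kA) n)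
              (@regular_rep k A)
            = dimension_subgroup (compl_filtration (A := R) n) mu]) /\
  (exists phi : {lrmorphism completion kA -> Rbar},
    bijective phi /\
    forall n, phi @` compl_filtration (A := kA) n = compl_filtration (A := R) n).
Proof.
split; last by exists (@compl_Magnus V E k); split; [exact: compl_Magnus_bij|exact: compl_Magnus_filtration].
exists (@magnus V E k).
have dE n : dimension_subgroup (compl_filtration (A := pc_alg E k) n) (@magnus V E k) = gdelta k n.
  by rewrite gdeltaE dimension_subgroup_magnus.
split; [exact: magnus_raag_gen|exact: magnus_injective| |by move=> n _; rewrite dimension_subgroup_magnus].
split.
- move=> k0 n n0; rewrite dE (gdelta_char_zero E n k0); apply/seteqP; split.
    exact: gdelta_gamma0.
  exact: gamma0_gdelta.
- move=> p kp n n0; have pp := pcharf_prime kp.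
  rewrite dE (gdelta_pchar E n kp); apply/seteqP; split; first exact: gdelta_gammap.
  by apply: gammap_gdelta => //; exact: pchar_Fp.
- by move=> n _; rewrite dimension_subgroup_magnus_pow.
Qed.
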